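(* Let $p,q\ge1$, $G=GL(q+p,\mathbb C)$, $K=GL(q,\mathbb C)\times GL(p,\mathbb C)\subseteq G$ (block diagonal), $H=G\times G$, and embed $G$ (hence $K$) diagonally in $H$. Let $\mathfrak g,\mathfrak h$ be the Lie algebras of $G,H$, let $d=\dim\mathfrak g$, and let $\theta=\operatorname{Ad}_J$ with $J=\operatorname{diag}(I_q,-I_p)$, with eigenspace decomposition $\mathfrak g=\mathfrak k\oplus\mathfrak p$. Let $$Z=\{(g,g^{-1}) : g=\operatorname{diag}(\mu I_q,\nu I_p),\ \mu,\nu\in\mathbb C^\times\}\subseteq H .$$ Let $X_0\subseteq \operatorname{Gr}_d(\mathfrak h)$ be the set of all subspaces $\operatorname{Ad}_\zeta[\mathfrak g]$, $\zeta\in Z$, let $X$ be the closure of $X_0$ in the Grassmannian $\operatorname{Gr}_d(\mathfrak h)$, and let $\boldsymbol G$ be the closure in $\operatorname{Gr}_d(\mathfrak h)\times H$ of $\{(\operatorname{Ad}_\zeta[\mathfrak g],\,h): \zeta\in Z,\ h\in \zeta G\zeta^{-1}\}$. Then: (a) The subspace $\operatorname{Ad}_\zeta[\mathfrak g]$ depends only on $\mu^2\nu^{-2}\in\mathbb C^\times$; this identifies $X_0$ with $\mathbb C^\times$, and $X$ with $\mathbb{CP}^1$. (b) $\boldsymbol G$ is an algebraic family of groups over $X\cong\mathbb{CP}^1$ (a subfamily of the constant family with fiber $H$). Its fibers over the points of $X_0$ are isomorphic to $G$, and its fibers over the two remaining points $0=[0:1]$ and $\infty=[1:0]$ are isomorphic,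 as algebraic groups, to the semidirect products $K\ltimes\mathfrak p_0$ and $K\ltimes \mathfrak p_\infty$, where $\mathfrak p_0$, $\mathfrak p_\infty$ (viewed as additive groups) are the spaces of matrix pairs of the types $$\left(\begin{bmatrix}0&0\\C&0\end{bmatrix},\begin{bmatrix}0&B\\0&0\end{bmatrix}\right)\quad\text{and}\quad \left(\begin{bmatrix}0&B\\0&0\end{bmatrix},\begin{bmatrix}0&0\\C&0\end{bmatrix}\right).$$ (c) Over $\mathbb C=\mathbb{CP}^1\setminus\{\infty\}$ the algebraic family of Lie algebras associated to $\boldsymbol G$ is isomorphic to the contraction family associated to $\theta$. (d) The antiholomorphic involution $\sigma(g_1,g_2)=(\sigma(g_2),\sigma(g_1))$ of $H$, where $\sigma(g^* )=J g^{-1}J$ for $g\in G$ ($g^*$ being the conjugate transpose), determines a real structure on $\boldsymbol G$ over the standard real structure on $\mathbb{CP}^1$ (complex conjugation of homogeneous coordinates), and for $x\in\mathbb{RP}^1$ the corresponding groups of real points satisfy $$\boldsymbol G^\sigma|_x\cong\begin{cases}U(p,q)& x>0\\ (U(p)\times U(q))\ltimes\mathfrak p^\sigma & x=0,\infty\\ U(p+q)&x<0,\end{cases}$$ where $\mathfrak p^\sigma$ is the minus one eigenspace of the Cartan involution of the real Lie algebra $\mathfrak u(p,q)$ with fixed subalgebra $\mathfrak u(p)\times\mathfrak u(q)$, and $x$ is the usual coordinate on $\mathbb{RP}^1$.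
   Context: A variety is an irreducible nonsingular quasi-projective complex algebraic variety. An algebraic family of groups over a variety $X$ is a smooth morphism of varieties $\boldsymbol G\to X$ carrying the structure of a group scheme over $X$; its associated family of Lie algebras is the sheaf of sections of the normal bundle of the identity section with the induced fiberwise Lie brackets (a locally free sheaf of $O_X$-modules with an $O_X$-linear Lie bracket). Contraction family: given a complex Lie algebra $\mathfrak g$ with involution $\theta$ and decomposition $\mathfrak g=\mathfrak k\oplus\mathfrak p$ into $+1$ and $-1$ eigenspaces, the contraction family over $\mathbb C$ is the sheaf $O_{\mathbb C}\otimes\mathfrak g$ with bracket determined by $[\eta,\zeta](z)=z[\eta(z),\zeta(z)]_{\mathfrak g}$ if $\eta,\zeta$ are both sections of $O_{\mathbb C}\otimes\mathfrak p$, and $[\eta,\zeta](z)=[\eta(z),\zeta(z)]_{\mathfrak g}$ otherwise, for sections $\eta,\zeta$ each belonging to one of the summands $O_{\mathbb C}\otimes\mathfrak k$, $O_{\mathbb C}\otimes\mathfrak p$. A real structure on a family over $X$ (with $X$ itself carrying a real structure $\sigma_X$, i.e. an antiholomorphic involution) is an antiholomorphic involution of the family covering $\sigma_X$ and compatible with the group structures; over each real point $x$ of $X$ it gives a real structure on the fiber $\boldsymbol G|_x$, and $\boldsymbol G^\sigma|_x$ denotes its group of fixed points. *)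

(* Defs.v *)
(* Classical (point-set) algebraic geometry, mostly over R[i]. *)
From HB Require Import structures.
From mathcomp Require Import all_boot all_order all_algebra.
From mathcomp Require Import sesquilinear spectral.
From mathcomp Require Import boolp classical_sets reals.
From mathcomp Require Import complex.

Set Implicit Arguments.
Unset Strict Implicit.
Unset Printing Implicit Defensive.

Import Order.TTheory GRing.Theory Num.Theory.

Local Open Scope classical_set_scope.
Local Open Scope ring_scope.
Local Open Scope complex_scope.
Local Open Scope sesquilinear_scope.

(** * Spaces with functions

   A space with functions in the sense of Serre is a topological space with a
   sheaf of K-valued functions.  It is encoded by its set of points [dom],
   inside a type T, and by the predicate [regat x f]: "f is regular on some
   Zariski neighbourhood of x".  Here f is a total function T -> K, whose
   values away from x are irrelevant.  The topology is recovered from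
   [regat]: U is a neighbourhood of x iff the indicator function of U agrees
   near x with a regular function taking the value 1 at x, that is, iff it is
   regular at x (see [zopen] and the check [zopen_affE]). *)

Record cspace (K : fieldType) (T : Type) := CSpace {
  dom : set T;
  regat : T -> (T -> K) -> Prop }.

Section Spaces.
Variable K : fieldType.

Definition zopen T (M : cspace K T) (U : set T) : Prop :=
  forall x, dom M x -> U x -> regat M x (fun y => (y \in U)%:R).

Definition zclosed T (M : cspace K T) (Z : set T) : Prop := zopen M (~` Z).

Definition zclosure T (M : cspace K T) (A : set T) : set T :=
  [set x | dom M x /\
     forall U, zopen M U -> U x -> exists a, [/\ dom M a, A a & U a]].

Definition irreducible_space T (M : cspace K T) : Prop :=
  (exists x, dom M x) /\
  forall U V, zopen M U -> zopen M V ->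
    (exists x, dom M x /\ U x) -> (exists x, dom M x /\ V x) ->
    exists x, [/\ dom M x, U x & V x].

Definition morphism T S (M : cspace K T) (N : cspace K S) (f : T -> S) : Prop :=
  forall x, dom M x ->
    dom N (f x) /\ forall u, regat N (f x) u -> regat M x (u \o f).

Definition space_iso T S (M : cspace K T) (N : cspace K S)
    (f : T -> S) (g : S -> T) : Prop :=
  [/\ morphism M N f, morphism N M g,
      forall x, dom M x -> g (f x) = x & forall y, dom N y -> f (g y) = y].

(* Subset with the induced structure: the regular functions are locally
   restrictions of regular functions. *)
Definition subsp T (M : cspace K T) (A : set T) : cspace K T :=
  CSpace (dom M `&` A)
    (fun x f => exists2 g, regat M x g & forall y, dom M y -> A y -> f y = g y).

Inductive polyfun T (gens : set (T -> K)) : (T -> K) -> Prop :=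
| polyfun_gen f : gens f -> polyfun gens f
| polyfun_cst c : polyfun gens (fun=> c)
| polyfun_add f g : polyfun gens f -> polyfun gens g ->
    polyfun gens (fun x => f x + g x)
| polyfun_mul f g : polyfun gens f -> polyfun gens g ->
    polyfun gens (fun x => f x * g x).

Definition quotient_at T (gens : set (T -> K)) (x : T) (f : T -> K) : Prop :=
  exists g h, [/\ polyfun gens g, polyfun gens h, h x != 0 &
    forall y, h y != 0 -> f y = g y / h y].

Definition linear_forms (V : vectType K) : set (V -> K) :=
  [set f : V -> K | exists l : 'Hom(V, K^o), f = l].

Definition aff (V : vectType K) : cspace K V :=
  CSpace setT (quotient_at (@linear_forms V)).

Definition pt_space : cspace K unit := CSpace setT (quotient_at set0).

(* Product of varieties: near (x, y) regular functions are quotients of sums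
   of products a(u)b(v) with a regular near x and b regular near y. *)
Definition prodsp T S (M : cspace K T) (N : cspace K S) : cspace K (T * S) :=
  CSpace (dom M `*` dom N)
    (fun z f => exists (k : nat) (a c : 'I_k -> T -> K) (b d : 'I_k -> S -> K),
      let num u := \sum_i a i u.1 * b i u.2 in
      let den u := \sum_i c i u.1 * d i u.2 in
      [/\ forall i, [/\ regat M z.1 (a i), regat M z.1 (c i),
                        regat N z.2 (b i) & regat N z.2 (d i)],
          den z != 0 &
          forall u, dom M u.1 -> dom N u.2 -> den u != 0 -> f u = num u / den u]).

(* Quotient structure along r: a function is regular iff its pullback is. *)
Definition quotsp T S (M : cspace K T) (r : T -> S) : cspace K S :=
  CSpace (r @` dom M)
    (fun y f => forall x, dom M x -> r x = y -> regat M x (f \o r)).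

(* Gr_d(V), as the quotient by GL_d of the open set of linearly independent
   d-tuples in V^d. *)
Definition frames (d : nat) (V : vectType K) : cspace K {ffun 'I_d -> V} :=
  subsp (aff {ffun 'I_d -> V}) [set B | free (codom B)].

Definition grass (d : nat) (V : vectType K) : cspace K {vspace V} :=
  quotsp (frames d V) (fun B => <<codom B>>%VS).

Definition proj_space (N : nat) : cspace K {vspace 'rV[K]_N.+1} :=
  grass 1 'rV[K]_N.+1.

(* The point [a : b] of the projective line. *)
Definition hcoord (a b : K) : {vspace 'rV[K]_2} :=
  <[(\row_(j < 2) (if j == 0 then a else b))%R]>%VS.

Definition quasi_projective T (M : cspace K T) : Prop :=
  exists (N : nat) (U Z : set {vspace 'rV[K]_N.+1}) f g,
    [/\ zopen (proj_space N) U, zclosed (proj_space N) Z &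
        space_iso M (subsp (proj_space N) (U `&` Z)) f g].

(* Tangent vectors at x: derivations at x of the local ring of germs of
   regular functions. *)
Definition tangent T (M : cspace K T) (x : T) (D : (T -> K) -> K) : Prop :=
  forall f, regat M x f ->
    (forall c : K, D (fun y => c * f y) = c * D f) /\
    forall g, regat M x g ->
      D (fun y => f y + g y) = D f + D g /\
      D (fun y => f y * g y) = f x * D g + g x * D f.

Definition fiber T S (M : cspace K T) (pr : T -> S) (x : S) : cspace K T :=
  subsp M [set y | pr y = x].

(* Smoothness by the Jacobian criterion: near e, the space E is isomorphic
   over X to the zero locus, in an open subset W of X x A^n, of regular
   functions F_1, ..., F_c whose differentials relative to X are linearly
   independent at the image of e.  The independence is expressed by tangent
   vectors D_1, ..., D_c of {x} x A^n with det (D_k F_i) <> 0.  As X is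
   reduced, the scheme F_1 = ... = F_c = 0 is then reduced near this point,
   so it is enough to describe its set of points. *)
Definition smooth_at T S (E : cspace K T) (X : cspace K S) (pr : T -> S)
    (e : T) : Prop :=
  exists (n c : nat) (F : 'I_c -> S * 'rV[K]_n -> K)
         (U : set T) (W : set (S * 'rV[K]_n))
         (j : T -> S * 'rV[K]_n) (j' : S * 'rV[K]_n -> T)
         (D : 'I_c -> (S * 'rV[K]_n -> K) -> K),
  let XA := prodsp X (aff 'rV[K]_n) in
  [/\ zopen E U /\ U e,
      zopen XA W /\ (forall w i, dom XA w -> W w -> regat XA w (F i)),
      space_iso (subsp E U)
                (subsp XA (W `&` [set w | forall i, F i w = 0])) j j',
      forall y, dom E y -> U y -> (j y).1 = pr y &
      (forall k, tangent (fiber XA fst (pr e)) (j e) (D k)) /\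
      \det (\matrix_(i, k) D k (F i)) != 0].

Definition smooth_morphism T S (E : cspace K T) (X : cspace K S)
    (pr : T -> S) : Prop :=
  morphism E X pr /\ forall e, dom E e -> smooth_at E X pr e.

Definition nonsingular T (M : cspace K T) : Prop :=
  smooth_morphism M pt_space (fun=> tt).

(* The points of K stand for all the geometric points only if K is
   algebraically closed; used for K = R[i]. *)
Definition variety T (M : cspace K T) : Prop :=
  [/\ quasi_projective M, irreducible_space M & nonsingular M].

(** * Groups and families of groups *)

Record gspace (T : Type) := GSpace {
  gsp : cspace K T;
  gmul : T -> T -> T }.

(* Isomorphism of algebraic groups; over a real field, isomorphism of real
   algebraic groups, by maps that are regular in both directions. *)
Definition group_iso T S (A : gspace T) (B : gspace S) : Prop :=
  exists f g, space_iso (gsp A) (gsp B) f g /\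
    forall x y, dom (gsp A) x -> dom (gsp A) y ->
      f (gmul A x y) = gmul B (f x) (f y).

Definition gsub T (A : gspace T) (B : set T) : gspace T :=
  GSpace (subsp (gsp A) B) (gmul A).

(* A |x V for an action of A on an additive group V, with
   (a, v)(b, w) = (ab, v + a.w). *)
Definition semidirect T (V : zmodType) (A : gspace T) (S : cspace K V)
    (act : T -> V -> V) : gspace (T * V) :=
  GSpace (prodsp (gsp A) S)
    (fun x y => (gmul A x.1 y.1, x.2 + act x.1 y.2)).

Record fam_ops (T S : Type) := FamOps {
  fpr : T -> S;
  fmul : T -> T -> T;
  fone : S -> T;
  finv : T -> T }.

Record is_group_family T S (E : cspace K T) (X : cspace K S)
    (F : fam_ops T S) : Prop := IsGroupFamily {
  gf_total : variety E;
  gf_base : variety X;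
  gf_smooth : smooth_morphism E X (fpr F);
  gf_mul : morphism (subsp (prodsp E E) [set z | fpr F z.1 = fpr F z.2]) E
                    (fun z => fmul F z.1 z.2);
  gf_one : morphism X E (fone F);
  gf_inv : morphism E E (finv F);
  gf_pr_mul : forall a b, dom E a -> dom E b -> fpr F a = fpr F b ->
    fpr F (fmul F a b) = fpr F a;
  gf_pr_one : forall x, dom X x -> fpr F (fone F x) = x;
  gf_pr_inv : forall a, dom E a -> fpr F (finv F a) = fpr F a;
  gf_mulA : forall a b c, dom E a -> dom E b -> dom E c ->
    fpr F a = fpr F b -> fpr F b = fpr F c ->
    fmul F a (fmul F b c) = fmul F (fmul F a b) c;
  gf_mul1 : forall a, dom E a -> fmul F a (fone F (fpr F a)) = a;
  gf_1mul : forall a, dom E a -> fmul F (fone F (fpr F a)) a = a;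
  gf_mulV : forall a, dom E a -> fmul F a (finv F a) = fone F (fpr F a);
  gf_Vmul : forall a, dom E a -> fmul F (finv F a) a = fone F (fpr F a) }.

Definition fiber_group T S (E : cspace K T) (F : fam_ops T S) (x : S) :
    gspace T :=
  GSpace (fiber E (fpr F) x) (fmul F).

(** * Families of Lie algebras

   A sheaf of Lie algebras over a space on S: sections over an open set V are
   elements of a type satisfying [lsec V], taken up to the equivalence
   [leqs V]; restriction to a smaller open set is the identity on
   representatives. *)
Record lie_sheaf (S : Type) := LieSheaf {
  lsT : Type;
  lsec : set S -> set lsT;
  leqs : set S -> lsT -> lsT -> Prop;
  ladd : lsT -> lsT -> lsT;
  lscale : (S -> K) -> lsT -> lsT;
  lbr : lsT -> lsT -> lsT }.

(* Isomorphism of sheaves of O-Lie algebras covering an open embedding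
   i : Y -> X, from L over Y to the restriction of M to i(Y). *)
Definition lie_sheaf_iso T S (Y : cspace K T) (X : cspace K S) (i : T -> S)
    (L : lie_sheaf T) (M : lie_sheaf S) : Prop :=
  exists Phi : set T -> lsT L -> lsT M,
  forall V, zopen Y V -> V `<=` dom Y ->
  let iV := i @` V in
  [/\ forall s, lsec V s -> lsec iV (Phi V s),
      forall s t, lsec V s -> lsec V t ->
        leqs V s t <-> leqs iV (Phi V s) (Phi V t),
      forall t : lsT M, lsec iV t -> exists2 s, lsec V s & leqs iV (Phi V s) t,
      [/\ forall s t, lsec V s -> lsec V t ->
            leqs iV (Phi V (ladd s t)) (ladd (Phi V s) (Phi V t)),
          forall a s, (forall x, iV x -> regat X x a) -> lsec V s ->
            leqs iV (Phi V (lscale (a \o i) s)) (lscale a (Phi V s)) &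
          forall s t, lsec V s -> lsec V t ->
            leqs iV (Phi V (lbr s t)) (lbr (Phi V s) (Phi V t))] &
      forall V' s, zopen Y V' -> V' `<=` V -> lsec V s ->
        leqs (i @` V') (Phi V' s) (Phi V s)].

(* The family of Lie algebras of a family of groups.  The normal space of the
   identity section at 1_x is T(E) / T(identity section) = T(E_x), the tangent
   space of the fiber at 1_x; a section over V is a family of such vectors
   s_x, regular in the sense that x |-> s_x(f) is regular for every regular f.
   The bracket is that of left-invariant derivations:
   [s, t] f = s (g |-> t (h |-> f (g h))) - t (g |-> s (h |-> f (g h))). *)
Definition lie_of_family T S (E : cspace K T) (X : cspace K S)
    (F : fam_ops T S) : lie_sheaf S :=
  @LieSheaf S (S -> (T -> K) -> K)
    (fun V => [set s | forall x, dom X x -> V x ->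
       tangent (fiber E (fpr F) x) (fone F x) (s x) /\
       forall f, regat E (fone F x) f -> regat X x (fun x' => s x' f)])
    (fun V s t => forall x, dom X x -> V x ->
       forall f, regat (fiber E (fpr F) x) (fone F x) f -> s x f = t x f)
    (fun s t x f => s x f + t x f)
    (fun a s x f => a x * s x f)
    (fun s t x f => s x (fun g => t x (fun h => f (fmul F g h)))
                  - t x (fun g => s x (fun h => f (fmul F g h)))).

(* The contraction family over the affine line of the Lie algebra (g, br) with
   involution theta; X + theta X and X - theta X are twice the components of X
   in k and p. *)
Section Contraction.
Variables (g : vectType K) (br : g -> g -> g) (theta : g -> g).

Definition kpart (X : g) : g := 2%:R^-1 *: (X + theta X).
Definition ppart (X : g) : g := 2%:R^-1 *: (X - theta X).

Definition contraction_bracket (z : K) (X Y : g) : g :=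
  br (kpart X) (kpart Y) + br (kpart X) (ppart Y) + br (ppart X) (kpart Y)
  + z *: br (ppart X) (ppart Y).

Definition contraction_family : lie_sheaf K^o :=
  @LieSheaf K^o (K^o -> g)
    (fun V => [set s | morphism (subsp (aff K^o) V) (aff g) s])
    (fun V s t => forall z, V z -> s z = t z)
    (fun s t z => s z + t z)
    (fun a s z => a z *: s z)
    (fun s t z => contraction_bracket z (s z) (t z)).
End Contraction.

Lemma zopen_affE (V : vectType K) (U : set V) :
  zopen (aff V) U <->
  forall x, U x -> exists h, [/\ polyfun (@linear_forms V) h, h x != 0 &
                                 forall y, h y != 0 -> U y].
Proof.
split=> [oU x Ux | oU x _ Ux].
  have [a [b [pa pb bx e]]] := oU x I Ux.
  exists (fun y => b y * a y); split; first exact: polyfun_mul.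
    rewrite mulf_neq0 //; apply: contra_neq (oner_neq0 K) => ax0.
    by have := e x bx; rewrite (mem_set Ux) ax0 mul0r.
  move=> y; rewrite mulf_eq0 negb_or => /andP[by0 ay0].
  have := e y by0; case: (boolP (y \in U)) => [/set_mem // | _ /eqP].
  by rewrite eq_sym mulf_eq0 invr_eq0 (negbTE ay0) (negbTE by0).
have [h [ph hx hU]] := oU x Ux; exists h, h; split=> // y hy.
by rewrite (mem_set (hU y hy)) divff.
Qed.

End Spaces.

Arguments pt_space {K}.
Arguments lsec {K S} l _ _.
Arguments leqs {K S} l _ _ _.

(** * Real structures *)

Section Real.
Variable R : rcfType.
Local Notation C := R[i].

(* Antiholomorphic morphism of varieties: a morphism to the complex conjugate
   variety, the variety whose regular functions are the conjugates of those of
   N. *)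
Definition antimorphism T S (M : cspace C T) (N : cspace C S) (f : T -> S) :
    Prop :=
  forall x, dom M x ->
    dom N (f x) /\ forall u, regat N (f x) u -> regat M x (fun y => (u (f y))^*).

Definition real_structure T (M : cspace C T) (sigma : T -> T) : Prop :=
  antimorphism M M sigma /\ forall x, dom M x -> sigma (sigma x) = x.

Definition family_real_structure T S (E : cspace C T) (X : cspace C S)
    (F : fam_ops T S) (sigmaX : S -> S) (sigmaE : T -> T) : Prop :=
  [/\ real_structure X sigmaX,
      real_structure E sigmaE,
      forall a, dom E a -> fpr F (sigmaE a) = sigmaX (fpr F a) &
      forall a b, dom E a -> dom E b -> fpr F a = fpr F b ->
        sigmaE (fmul F a b) = fmul F (sigmaE a) (sigmaE b)].

(* The underlying real algebraic space: near x, real regular functions are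
   quotients of real polynomials in the real and imaginary parts of complex
   regular functions. *)
Definition realify T (M : cspace C T) : cspace R T :=
  CSpace (dom M)
    (fun x => quotient_at
      [set u | exists2 f, regat M x f & u = (fun y => complex.Re (f y)) \/
                                        u = (fun y => complex.Im (f y))] x).

(* The group of fixed points of sigmaE in the fiber over x. *)
Definition real_fiber_group T S (E : cspace C T) (F : fam_ops T S)
    (sigmaE : T -> T) (x : S) : gspace R T :=
  GSpace (subsp (realify E) [set y | fpr F y = x /\ sigmaE y = y]) (fmul F).

(* Complex conjugation of homogeneous coordinates. *)
Definition conj_proj (W : {vspace 'rV[C]_2}) : {vspace 'rV[C]_2} :=
  <<[seq map_mx (fun z : C => z^*) v | v <- vbasis W]>>%VS.

Definition real_affine_group (V : vectType C) (A : set V) (mul : V -> V -> V) :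
    gspace R V :=
  GSpace (subsp (realify (aff V)) A) mul.

Definition unitary_group (n : nat) : gspace R 'M[C]_n :=
  real_affine_group [set g | g \is unitarymx] mulmx.

Definition Ipq (p q : nat) : 'M[C]_(p + q) := block_mx 1%:M 0 0 (- 1%:M).

Definition unitary_pq (p q : nat) : gspace R 'M[C]_(p + q) :=
  real_affine_group [set g | g ^t* *m Ipq p q *m g = Ipq p q] mulmx.

Definition unitary_prod (p q : nat) : gspace R ('M[C]_p * 'M[C]_q)%type :=
  real_affine_group [set k | k.1 \is unitarymx /\ k.2 \is unitarymx]
    (fun k l => (k.1 *m l.1, k.2 *m l.2)).

Definition u_pq (p q : nat) : set 'M[C]_(p + q) :=
  [set X | X ^t* *m Ipq p q + Ipq p q *m X = 0].

Definition cartan_involution n (X : 'M[C]_n) : 'M[C]_n := - X ^t*.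

Definition p_sigma (p q : nat) : set 'M[C]_(p + q) :=
  [set X | u_pq X /\ cartan_involution X = - X].

(* (U(p) x U(q)) |x p^sigma *)
Definition motion_pq (p q : nat) :
    gspace R (('M[C]_p * 'M[C]_q) * 'M[C]_(p + q))%type :=
  semidirect (unitary_prod p q) (subsp (realify (aff 'M[C]_(p + q))) (@p_sigma p q))
    (fun k X => let g := block_mx k.1 0 0 k.2 in g *m X *m invmx g).

End Real.

(** * The family of the theorem *)

Section Family.
Variables (R : realType) (p q : nat).
Local Notation C := R[i].
Local Notation g := 'M[C]_(q + p).
Local Notation h := ('M[C]_(q + p) * 'M[C]_(q + p))%type.

Definition mulh (a b : h) : h := (a.1 *m b.1, a.2 *m b.2).
Definition invh (a : h) : h := (invmx a.1, invmx a.2).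

Definition Jmx : g := block_mx 1%:M 0 0 (- 1%:M).
Definition theta (X : g) : g := Jmx *m X *m invmx Jmx.
Definition commutator (X Y : g) : g := X *m Y - Y *m X.

Definition GLset : set g := [set x | x \in unitmx].
Definition Kset : set g :=
  [set x | exists A D, [/\ A \in unitmx, D \in unitmx & x = block_mx A 0 0 D]].
Definition Hset : set h := [set x | x.1 \in unitmx /\ x.2 \in unitmx].

Definition GL_group : gspace C g := GSpace (subsp (aff g) GLset) mulmx.
Definition Kgroup : gspace C g := GSpace (subsp (aff g) Kset) mulmx.
Definition Hspace : cspace C h := subsp (aff h) Hset.

Definition dim_g : nat := \dim {: g}.
Definition Gr : cspace C {vspace h} := grass dim_g h.

Definition diag_g : {vspace h} := limg (linfun (fun X : g => (X, X) : h)).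

Definition Ad (z Y : h) : h := mulh (mulh z Y) (invh z).
Definition Ad_g (z : h) : {vspace h} := (linfun (Ad z) @: diag_g)%VS.

Definition zeta (mu nu : C) : h :=
  let x := block_mx mu%:M 0 0 nu%:M : g in (x, invmx x).
Definition Zset : set h :=
  [set z | exists mu nu, [/\ mu != 0, nu != 0 & z = zeta mu nu]].

Definition X0set : set {vspace h} := [set W | exists2 z, Zset z & W = Ad_g z].
(* X is the Zariski closure; as X_0 is constructible, it is also the closure in
   the analytic topology.  The same applies to bG below. *)
Definition X0sp : cspace C {vspace h} := subsp Gr X0set.
Definition Xsp : cspace C {vspace h} := subsp Gr (zclosure Gr X0set).

Definition G0set : set ({vspace h} * h) :=
  [set y | exists z, [/\ Zset z, y.1 = Ad_g z &
     exists2 x, GLset x & y.2 = mulh (mulh z (x, x)) (invh z)]].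
Definition GrH : cspace C ({vspace h} * h)%type := prodsp Gr Hspace.
Definition bG : cspace C ({vspace h} * h)%type := subsp GrH (zclosure GrH G0set).

(* The group operations of the constant family with fiber H. *)
Definition const_ops : fam_ops ({vspace h} * h)%type {vspace h} :=
  FamOps fst (fun a b => (a.1, mulh a.2 b.2)) (fun W => (W, (1%:M, 1%:M)))
         (fun a => (a.1, invh a.2)).

Definition const_family : cspace C ({vspace h} * h)%type := prodsp Xsp Hspace.

Definition p_zero : set h :=
  [set P | exists (c : 'M[C]_(p, q)) (b : 'M[C]_(q, p)),
     P = (block_mx 0 0 c 0, block_mx 0 b 0 0)].
Definition p_infty : set h :=
  [set P | exists (c : 'M[C]_(p, q)) (b : 'M[C]_(q, p)),
     P = (block_mx 0 b 0 0, block_mx 0 0 c 0)].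

(* K |x P, where K, embedded diagonally in H, acts by Ad. *)
Definition K_semidirect (P : set h) : gspace C (g * h)%type :=
  semidirect Kgroup (subsp (aff h) P) (fun k => Ad (k, k)).

(* The solution of: sigma of the adjoint of x is J x^-1 J (see [sigmaG_adj]). *)
Definition sigmaG (x : g) : g := Jmx *m invmx (x ^t*) *m Jmx.
Definition sigmaH (x : h) : h := (sigmaG x.2, sigmaG x.1).

Lemma sigmaG_adj (x : g) : sigmaG (x ^t*) = Jmx *m invmx x *m Jmx.
Proof. by rewrite /sigmaG trmxCK. Qed.

End Family.

(* Main.v *)
Require Import Defs.
From HB Require Import structures.
From mathcomp Require Import all_boot all_order all_algebra.
From mathcomp Require Import sesquilinear spectral.
From mathcomp Require Import boolp classical_sets reals.
From mathcomp Require Import complex.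
From mathcomp Require Import ring.

Set Implicit Arguments.
Unset Strict Implicit.
Unset Printing Implicit Defensive.

Import Order.TTheory GRing.Theory Num.Theory.

Local Open Scope classical_set_scope.
Local Open Scope ring_scope.
Local Open Scope complex_scope.
Local Open Scope sesquilinear_scope.

(* Ad_zeta[g], for zeta = (g, g^-1) and g = diag(mu I, nu I), is the space W_c of
   pairs ([A, a B; b D, E], [A, b B; a D, E]) with c = (a, b) = (mu^2, nu^2).  The
   definition of W_c makes sense for all c <> 0, depends only on the point [a : b]
   of the projective line, and W_c is an associative subalgebra of pairs of
   matrices: in the linear coordinates X = [A, B; D, E] its product is the matrix
   product with the terms B D' and D B' multiplied by ab.  So the closure of X_0
   is { W_c } (the quadratic equations expressing that some W_c contains W are
   closed conditions), the total space is the set of pairs (W_c, invertible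
   element of W_c), and it is covered by two charts, a = 1 and b = 1, each of
   which is an open subset of an affine space.  All the claims are then read off
   the product of parameter t = ab in such a chart: smoothness is trivial; the
   fiber at t = 0 is K |x p; the commutator for this product is the contraction
   bracket; the fixed points of sigma are given by equations in the blocks of X
   which, for t = r^2 and t = - r^2, become those of U(p, q) and U(p + q) after a
   rescaling of the off-diagonal blocks by r. *)

(** * Spaces with functions and their morphisms *)

(** Conjugation by zeta multiplies the off-diagonal blocks of the first component by mu / nu and nu
    / mu, and those of the second by the inverse factors. Writing the off-diagonal blocks of a
    matrix as mu nu times new coordinates turns all these factors into mu^2 and nu^2, which still
    make sense when one of them is zero; since (mu nu)^2 = ab, this change of coordinates is also
    the origin of the factor ab in the product. The Grassmannian has no coordinates at hand:
    functions on it are tested on frames, and the coordinate t of a subspace is found by solving a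
    linear system in a frame with Cramer's rule. Some properties are not read off a single chart.
    Density and irreducibility rest on a point where neither of two nonzero polynomials vanishes,
    hence the hypothesis that the field is infinite; quasi-projectivity is global and uses a Segre
    embedding. Derivatives are formal, along lines, and a tangent vector at 1 is identified by its
    values on matrix entries. *)

Section Ringed.
Variable K : fieldType.

(* [regat_div] with denominator 1 says that regularity is local and depends
   only on the values on the domain. *)
Record ringed T (M : cspace K T) : Prop := Ringed {
  regat_cst : forall x c, dom M x -> regat M x (fun=> c);
  regat_add : forall x f g, dom M x -> regat M x f -> regat M x g ->
    regat M x (fun y => f y + g y);
  regat_mul : forall x f g, dom M x -> regat M x f -> regat M x g ->
    regat M x (fun y => f y * g y);
  regat_div : forall x f g u, dom M x -> regat M x f -> regat M x g ->
    g x != 0 -> (forall y, dom M y -> g y != 0 -> u y = f y / g y) ->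
    regat M x u }.

Section RingedTheory.
Variables (T : Type) (M : cspace K T).
Hypothesis rM : ringed M.

Lemma regat_ext x f u : dom M x -> regat M x f ->
  (forall y, dom M y -> u y = f y) -> regat M x u.
Proof.
move=> Mx rf e; apply: (regat_div rM Mx rf (regat_cst rM 1 Mx)).
  exact: oner_neq0.
by move=> y My _; rewrite e ?divr1.
Qed.

(** Using [w] both as a factor of the numerator and as the denominator asks nothing of [u] where [w]
    vanishes. *)
Lemma regat_near x w f u : dom M x -> regat M x w -> w x != 0 ->
  regat M x f -> (forall y, dom M y -> w y != 0 -> u y = f y) -> regat M x u.
Proof.
move=> Mx rw wx rf e; apply: (regat_div rM Mx (regat_mul rM Mx rf rw) rw wx).
by move=> y My wy; rewrite e // mulfK.
Qed.

Lemma regat_opp x f : dom M x -> regat M x f -> regat M x (fun y => - f y).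
Proof.
move=> Mx rf; have := regat_mul rM Mx (regat_cst rM (-1) Mx) rf.
by move/(regat_ext Mx); apply=> y _; rewrite mulN1r.
Qed.

Lemma regat_sub x f g : dom M x -> regat M x f -> regat M x g ->
  regat M x (fun y => f y - g y).
Proof. by move=> Mx rf rg; apply: (regat_add rM) => //; exact: regat_opp. Qed.

Lemma regat_sum x (I : Type) (r : seq I) (P : pred I) (F : I -> T -> K) :
  dom M x -> (forall i, regat M x (F i)) ->
  regat M x (fun y => \sum_(i <- r | P i) F i y).
Proof.
move=> Mx rF; elim: r => [|i r IH].
  by apply: (regat_ext Mx (regat_cst rM 0 Mx)) => y _; rewrite big_nil.
case: (boolP (P i)) => Pi.
  apply: (regat_ext Mx (regat_add rM Mx (rF i) IH)) => y _.
  by rewrite big_cons Pi.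
by apply: (regat_ext Mx IH) => y _; rewrite big_cons (negbTE Pi).
Qed.

Lemma regat_prod x (I : Type) (r : seq I) (P : pred I) (F : I -> T -> K) :
  dom M x -> (forall i, regat M x (F i)) ->
  regat M x (fun y => \prod_(i <- r | P i) F i y).
Proof.
move=> Mx rF; elim: r => [|i r IH].
  by apply: (regat_ext Mx (regat_cst rM 1 Mx)) => y _; rewrite big_nil.
case: (boolP (P i)) => Pi.
  apply: (regat_ext Mx (regat_mul rM Mx (rF i) IH)) => y _.
  by rewrite big_cons Pi.
by apply: (regat_ext Mx IH) => y _; rewrite big_cons (negbTE Pi).
Qed.

Lemma regat_inv x f : dom M x -> regat M x f -> f x != 0 ->
  regat M x (fun y => (f y)^-1).
Proof.
move=> Mx rf fx; apply: (regat_div rM Mx (regat_cst rM 1 Mx) rf fx) => y _ _.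
by rewrite div1r.
Qed.

Lemma regat_polyfun x (gens : set (T -> K)) f : dom M x ->
  (forall u, gens u -> regat M x u) -> polyfun gens f -> regat M x f.
Proof.
move=> Mx rg; elim=> [g|c|g h _ pg _ ph|g h _ pg _ ph].
- exact: rg.
- exact: regat_cst.
- exact: regat_add.
- exact: regat_mul.
Qed.

(** Together with [regat_indicator], this replaces indicator functions by basic open sets, which is
    how openness is proved and used from here on. *)
Lemma zopen_nonvanishing (U : set T) :
  (forall x, dom M x -> U x -> exists w, [/\ regat M x w, w x != 0 &
     forall y, dom M y -> w y != 0 -> U y]) -> zopen M U.
Proof.
move=> oU x Mx Ux; have [w [rw wx wU]] := oU x Mx Ux.
apply: (regat_near Mx rw wx (regat_cst rM 1 Mx)) => y My wy.
by rewrite mem_set //; exact: wU.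
Qed.

Lemma regat_indicator x (U : set T) : zopen M U -> dom M x -> U x ->
  exists w, [/\ regat M x w, w x != 0 & forall y, w y != 0 -> U y].
Proof.
move=> oU Mx Ux; exists (fun y => (y \in U)%:R); split; first exact: oU.
  by rewrite mem_set // oner_neq0.
by move=> y; case: (boolP (y \in U)) => [/set_mem // | _]; rewrite eqxx.
Qed.

Lemma zopenI (U V : set T) : zopen M U -> zopen M V -> zopen M (U `&` V).
Proof.
move=> oU oV; apply: zopen_nonvanishing => x Mx [Ux Vx].
have [u [ru ux uU]] := regat_indicator oU Mx Ux.
have [v [rv vx vV]] := regat_indicator oV Mx Vx.
exists (fun y => u y * v y); split; first exact: regat_mul.
  by rewrite mulf_neq0.
by move=> y _; rewrite mulf_eq0 negb_or => /andP[/uU ? /vV].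
Qed.

Lemma zopenU (U V : set T) : zopen M U -> zopen M V -> zopen M (U `|` V).
Proof.
move=> oU oV; apply: zopen_nonvanishing => x Mx [Ux|Vx].
  by have [u [ru ux uU]] := regat_indicator oU Mx Ux; exists u; split=> // y _ /uU; left.
by have [u [ru ux uU]] := regat_indicator oV Mx Vx; exists u; split=> // y _ /uU; right.
Qed.

Lemma zopenT : zopen M setT.
Proof.
by move=> x Mx _; apply: (regat_ext Mx (regat_cst rM 1 Mx)) => y _; rewrite in_setT.
Qed.

End RingedTheory.

(** [quotient_at] constrains a function wherever the denominator is nonzero, even off [D], while
    [regat_div] only controls values on [D]. The hypothesis supplies a factor [e] that vanishes off
    [D]. *)
Lemma ringed_quotient T (D : set T) (gens : T -> set (T -> K)) :
  (forall x, D x -> exists e, [/\ polyfun (gens x) e, e x != 0 &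
     forall y, e y != 0 -> D y]) ->
  ringed (CSpace D (fun x => quotient_at (gens x) x)).
Proof.
move=> De; split.
- move=> x c Dx /=; exists (fun=> c), (fun=> 1); split; try exact: polyfun_cst.
    exact: oner_neq0.
  by move=> y _; rewrite divr1.
- move=> x f g Dx /= [n [d [pn pd dx e]]] [n' [d' [pn' pd' dx' e']]].
  exists (fun y => n y * d' y + n' y * d y), (fun y => d y * d' y); split.
  + by apply: polyfun_add; exact: polyfun_mul.
  + exact: polyfun_mul.
  + by rewrite mulf_neq0.
  + move=> y; rewrite mulf_eq0 negb_or => /andP[dy dy'].
    by rewrite e // e' // addf_div.
- move=> x f g Dx /= [n [d [pn pd dx e]]] [n' [d' [pn' pd' dx' e']]].
  exists (fun y => n y * n' y), (fun y => d y * d' y); split.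
  + exact: polyfun_mul.
  + exact: polyfun_mul.
  + by rewrite mulf_neq0.
  + move=> y; rewrite mulf_eq0 negb_or => /andP[dy dy'].
    by rewrite e // e' // mulf_div.
- move=> x f g u Dx /= [n [d [pn pd dx e]]] [n' [d' [pn' pd' dx' e']]] gx eu.
  have [c [pc cx cD]] := De _ Dx.
  (* The common factor [d' * c] makes the denominator vanish where [d'] does and off [D], where
     nothing is known of [u]. *)
  exists (fun y => (n y * d' y) * (d' y * c y)), (fun y => (d y * n' y) * (d' y * c y)).
  have n'x : n' x != 0.
    by move: gx; rewrite e' // mulf_eq0 negb_or => /andP[].
  split.
  + by apply: polyfun_mul; exact: polyfun_mul.
  + by apply: polyfun_mul; exact: polyfun_mul.
  + by rewrite !mulf_neq0.
  + move=> y; rewrite !mulf_eq0 !negb_or => /andP[/andP[dy ny']] /andP[dy' cy].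
    rewrite eu; [|exact: cD|by rewrite e' // mulf_neq0 // invr_neq0].
    rewrite e // e' //; field; exact/and4P.
Qed.

Lemma ringed_quotientT T (gens : set (T -> K)) :
  ringed (CSpace setT (quotient_at gens)).
Proof.
apply: (@ringed_quotient T setT (fun=> gens)) => x _.
by exists (fun=> 1); split=> //; [exact: polyfun_cst | exact: oner_neq0].
Qed.

Lemma ringed_aff (V : vectType K) : ringed (aff V).
Proof. exact: ringed_quotientT. Qed.

Lemma ringed_pt : ringed (@pt_space K).
Proof. exact: ringed_quotientT. Qed.

Lemma ringed_subsp T (M : cspace K T) A : ringed M -> ringed (subsp M A).
Proof.
move=> rM; split=> /=.
- by move=> x c [Mx _]; exists (fun=> c) => //; exact: regat_cst.
- move=> x f g [Mx _] [f' rf ef] [g' rg eg].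
  exists (fun y => f' y + g' y); first exact: regat_add.
  by move=> y My Ay; rewrite ef ?eg.
- move=> x f g [Mx _] [f' rf ef] [g' rg eg].
  exists (fun y => f' y * g' y); first exact: regat_mul.
  by move=> y My Ay; rewrite ef ?eg.
- move=> x f g u [Mx Ax] [f' rf ef] [g' rg eg] gx eu.
  have gx' : g' x != 0 by rewrite -eg.
  (* The extension must agree with [u] on all of [A], including the points where the denominator
     vanishes; there it copies [u]. *)
  exists (fun y => if g' y == 0 then u y else f' y / g' y).
    by apply: (regat_div rM Mx rf rg gx') => y _ /negbTE->.
  move=> y My Ay; case: eqP => // /eqP gy; rewrite eu ?ef ?eg //.
Qed.

Lemma ringed_quotsp T S (M : cspace K T) (r : T -> S) :
  ringed M -> ringed (quotsp M r).
Proof.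
move=> rM; split=> /=.
- by move=> y c _ x Mx _; exact: regat_cst.
- by move=> y f g _ rf rg x Mx rx; apply: (regat_add rM Mx); [exact: rf|exact: rg].
- by move=> y f g _ rf rg x Mx rx; apply: (regat_mul rM Mx); [exact: rf|exact: rg].
- move=> y f g u _ rf rg gy eu x Mx rx.
  apply: (regat_div rM Mx (rf x Mx rx) (rg x Mx rx)); first by rewrite /= rx.
  by move=> x' Mx' gx' /=; apply: eu => //; exists x'.
Qed.

Section Product.
Variables (T S : Type) (M : cspace K T) (N : cspace K S).
Hypotheses (rM : ringed M) (rN : ringed N).

(** [prodsp] uses one ordinal for numerator and denominator. Arbitrary finite index types separate
    the two, and make sums and products of such functions a matter of sum and product types. *)
Definition tensor_at (z : T * S) (u : T * S -> K) : Prop :=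
  exists (I : finType) (a : I -> T -> K) (b : I -> S -> K),
    (forall i, regat M z.1 (a i) /\ regat N z.2 (b i)) /\
    forall w, u w = \sum_i a i w.1 * b i w.2.

Lemma tensor_cst z c : dom M z.1 -> dom N z.2 -> tensor_at z (fun=> c).
Proof.
move=> Mz Nz; exists 'I_1, (fun=> fun=> c), (fun=> fun=> 1); split.
  by move=> i; split; exact: regat_cst.
by move=> w; rewrite big_ord1 mulr1.
Qed.

Lemma tensor_add z u v : tensor_at z u -> tensor_at z v ->
  tensor_at z (fun w => u w + v w).
Proof.
move=> [I [a [b [r e]]]] [J [c [d [r' e']]]].
exists (I + J)%type, (fun k => match k with inl i => a i | inr j => c j end),
  (fun k => match k with inl i => b i | inr j => d j end); split; first by case.
by move=> w; rewrite big_sumType /= e e'.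
Qed.

Lemma tensor_mul z u v : dom M z.1 -> dom N z.2 ->
  tensor_at z u -> tensor_at z v -> tensor_at z (fun w => u w * v w).
Proof.
move=> Mz Nz [I [a [b [r e]]]] [J [c [d [r' e']]]].
exists (I * J)%type, (fun k x => a k.1 x * c k.2 x), (fun k x => b k.1 x * d k.2 x).
split=> [k|w].
  have [? ?] := r k.1; have [? ?] := r' k.2.
  by split; [exact: (regat_mul rM)|exact: (regat_mul rN)].
rewrite e e' big_distrlr /= pair_big /=; apply: eq_bigr => k _.
by rewrite mulrACA.
Qed.

Lemma regat_prodspP z f : dom M z.1 -> dom N z.2 ->
  regat (prodsp M N) z f <-> exists num den,
    [/\ tensor_at z num, tensor_at z den, den z != 0 &
        forall u, dom M u.1 -> dom N u.2 -> den u != 0 -> f u = num u / den u].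
Proof.
move=> Mz Nz; split=> /=.
  move=> [k [a [c [b [d [r dz e]]]]]].
  exists (fun u => \sum_i a i u.1 * b i u.2), (fun u => \sum_i c i u.1 * d i u.2).
  split=> //; [exists 'I_k, a, b | exists 'I_k, c, d]; split=> // i;
  by have [] := r i.
move=> [num [den [[I [a [b [r e]]]] [J [c [d [r' e']]]] dz h]]].
have bij : bijective (@enum_val (I + J)%type (@predT (I + J)%type)).
  exact: enum_val_bij.
(* Numerator and denominator are brought to the common index type [I + J], padded with zero
   functions. *)
exists #|{: I + J}|,
  (fun k => match enum_val k with inl i => a i | inr _ => fun=> 0 end),
  (fun k => match enum_val k with inl i => fun=> 0 | inr j => c j end),
  (fun k => match enum_val k with inl i => b i | inr _ => fun=> 0 end),
  (fun k => match enum_val k with inl i => fun=> 0 | inr j => d j end).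
pose num' w (k : I + J) := match k with inl i => a i | inr _ => fun=> 0 end w.1 *
  match k with inl i => b i | inr _ => fun=> 0 end w.2 : K.
pose den' w (k : I + J) := match k with inl i => fun=> 0 | inr j => c j end w.1 *
  match k with inl i => fun=> 0 | inr j => d j end w.2 : K.
have en w : \sum_(k < #|{: I + J}|) num' w (enum_val k) = num w.
  transitivity (\sum_k num' w k); first by rewrite [RHS](reindex _ (onW_bij _ bij)).
  rewrite big_sumType /= e [X in _ + X]big1 ?addr0 // => j _.
  by rewrite /num' mul0r.
have ed w : \sum_(k < #|{: I + J}|) den' w (enum_val k) = den w.
  transitivity (\sum_k den' w k); first by rewrite [RHS](reindex _ (onW_bij _ bij)).
  rewrite big_sumType /= e' big1 ?add0r // => j _.
  by rewrite /den' mul0r.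
split.
- move=> k; case: (enum_val k) => i; first by have [? ?] := r i; split=> //; exact: regat_cst.
  by have [? ?] := r' i; split=> //; exact: regat_cst.
- by have := ed z; rewrite /den' => ->.
- move=> u Mu Nu; have := ed u; have := en u; rewrite /den' /num' => -> ->.
  exact: h.
Qed.

Lemma ringed_prodsp : ringed (prodsp M N).
Proof.
split.
- move=> z c [Mz Nz]; apply/regat_prodspP => //.
  exists (fun=> c), (fun=> 1); split; try exact: tensor_cst.
    exact: oner_neq0.
  by move=> *; rewrite divr1.
- move=> z f g [Mz Nz] /regat_prodspP [] // n [d [tn td dz e]].
  move=> /regat_prodspP [] // n' [d' [tn' td' dz' e']].
  apply/regat_prodspP => //.
  exists (fun y => n y * d' y + n' y * d y), (fun y => d y * d' y); split.
  + by apply: tensor_add; exact: tensor_mul.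
  + exact: tensor_mul.
  + by rewrite mulf_neq0.
  + move=> y My Ny; rewrite mulf_eq0 negb_or => /andP[dy dy'].
    by rewrite e // e' // addf_div.
- move=> z f g [Mz Nz] /regat_prodspP [] // n [d [tn td dz e]].
  move=> /regat_prodspP [] // n' [d' [tn' td' dz' e']].
  apply/regat_prodspP => //.
  exists (fun y => n y * n' y), (fun y => d y * d' y); split.
  + exact: tensor_mul.
  + exact: tensor_mul.
  + by rewrite mulf_neq0.
  + move=> y My Ny; rewrite mulf_eq0 negb_or => /andP[dy dy'].
    by rewrite e // e' // mulf_div.
- move=> z f g u [Mz Nz] /regat_prodspP [] // n [d [tn td dz e]].
  move=> /regat_prodspP [] // n' [d' [tn' td' dz' e']] gz eu.
  apply/regat_prodspP => //.
  have n'x : n' z != 0.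
    by move: gz; rewrite e' // mulf_eq0 negb_or => /andP[].
  exists (fun y => n y * d' y * d' y), (fun y => d y * n' y * d' y); split.
  + by do 2?[apply: tensor_mul => //].
  + by do 2?[apply: tensor_mul => //].
  + by rewrite !mulf_neq0.
  + move=> y My Ny; rewrite !mulf_eq0 !negb_or => /andP[/andP[dy ny'] dy'].
    rewrite eu //; last by rewrite e' // mulf_neq0 // invr_neq0.
    rewrite e // e' //; field; exact/and3P.
Qed.

Lemma regat_fst z f : dom M z.1 -> dom N z.2 -> regat M z.1 f ->
  regat (prodsp M N) z (f \o fst).
Proof.
move=> Mz Nz rf; apply/regat_prodspP => //.
exists (f \o fst), (fun=> 1); split.
- exists 'I_1, (fun=> f), (fun=> fun=> 1); split; last first.
    by move=> w; rewrite big_ord1 mulr1.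
  by split=> //; exact: regat_cst.
- exact: tensor_cst.
- exact: oner_neq0.
- by move=> *; rewrite divr1.
Qed.

Lemma regat_snd z f : dom M z.1 -> dom N z.2 -> regat N z.2 f ->
  regat (prodsp M N) z (f \o snd).
Proof.
move=> Mz Nz rf; apply/regat_prodspP => //.
exists (f \o snd), (fun=> 1); split.
- exists 'I_1, (fun=> fun=> 1), (fun=> f); split; last first.
    by move=> w; rewrite big_ord1 mul1r.
  by split=> //; exact: regat_cst.
- exact: tensor_cst.
- exact: oner_neq0.
- by move=> *; rewrite divr1.
Qed.

End Product.
End Ringed.

Section Morphisms.
Variable K : fieldType.

(** The pointwise form of [morphism]: different formulas for the same map can be used near different
    points. *)
Definition morph_at T S (M : cspace K T) (N : cspace K S) (f : T -> S) x : Prop :=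
  dom N (f x) /\ forall u, regat N (f x) u -> regat M x (u \o f).

Lemma morph_at_id T (M : cspace K T) x : dom M x -> morph_at M M id x.
Proof. by []. Qed.

Lemma morph_at_comp T S U (M : cspace K T) (N : cspace K S) (L : cspace K U)
    f g x :
  morph_at M N f x -> morph_at N L g (f x) -> morph_at M L (fun y => g (f y)) x.
Proof.
move=> [Nf rf] [Lg rg]; split=> // u /rg ru.
exact: (rf _ ru).
Qed.

Lemma morph_at_near T S (M : cspace K T) (N : cspace K S) f f' (U : set T) x :
  ringed M -> dom M x -> zopen M U -> U x ->
  (forall y, dom M y -> U y -> f y = f' y) ->
  morph_at M N f' x -> morph_at M N f x.
Proof.
move=> rM Mx oU Ux e [Nf rf]; rewrite /morph_at (e x Mx Ux); split=> // u /rf ru.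
have [w [rw wx wU]] := regat_indicator oU Mx Ux.
apply: (regat_near rM Mx rw wx ru) => y My /wU Uy /=.
by rewrite e.
Qed.

Lemma morph_at_ext T S (M : cspace K T) (N : cspace K S) f f' x :
  ringed M -> dom M x -> (forall y, dom M y -> f y = f' y) ->
  morph_at M N f' x -> morph_at M N f x.
Proof.
move=> rM Mx e; apply: (morph_at_near rM Mx (zopenT rM)) => // y My _.
exact: e.
Qed.

Lemma morph_at_cst T S (M : cspace K T) (N : cspace K S) c x :
  ringed M -> dom M x -> dom N c -> morph_at M N (fun=> c) x.
Proof. by move=> rM Mx Nc; split=> // u _; exact: regat_cst. Qed.

Lemma morph_at_incl T (M : cspace K T) A x : dom M x -> morph_at (subsp M A) M id x.
Proof. by move=> Mx; split=> // u ru; exists u. Qed.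

Lemma morph_at_subdom T S (M : cspace K T) (N : cspace K S) A f x :
  morph_at M N f x -> morph_at (subsp M A) N f x.
Proof. by move=> [Nf rf]; split=> // u /rf ru; exists (u \o f). Qed.

Lemma morph_at_subcod T S (M : cspace K T) (N : cspace K S) A f x :
  ringed M -> dom M x -> (forall y, dom M y -> dom (subsp N A) (f y)) ->
  morph_at M N f x -> morph_at M (subsp N A) f x.
Proof.
move=> rM Mx MA [Nf rf]; split; first exact: MA.
move=> u [u' /rf ru e]; apply: (regat_ext rM Mx ru) => y /MA[Ny Ay] /=.
exact: e.
Qed.

Lemma morph_at_subcodW T S (M : cspace K T) (N : cspace K S) A f x :
  morph_at M (subsp N A) f x -> morph_at M N f x.
Proof. by case=> -[Nf Af] rf; split=> // u ru; apply: rf; exists u. Qed.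

Lemma morph_at_pair T S1 S2 (M : cspace K T) (N1 : cspace K S1)
    (N2 : cspace K S2) f1 f2 x :
  ringed M -> dom M x -> (forall y, dom M y -> dom N1 (f1 y) /\ dom N2 (f2 y)) ->
  morph_at M N1 f1 x -> morph_at M N2 f2 x ->
  morph_at M (prodsp N1 N2) (fun y => (f1 y, f2 y)) x.
Proof.
move=> rM Mx MN [Nf1 rf1] [Nf2 rf2]; split=> // u /= [k [a [c [b [d [r dz e]]]]]].
apply: (regat_div rM Mx (f := fun y => \sum_i a i (f1 y) * b i (f2 y))
         (g := fun y => \sum_i c i (f1 y) * d i (f2 y))) => //.
- apply: regat_sum => // i; have [ra rc rb rd] := r i.
  by apply: (regat_mul rM Mx); [exact: rf1|exact: rf2].
- apply: regat_sum => // i; have [ra rc rb rd] := r i.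
  by apply: (regat_mul rM Mx); [exact: rf1|exact: rf2].
- by move=> y /MN[? ?] dy; exact: e.
Qed.

Lemma morph_at_fst T S (M : cspace K T) (N : cspace K S) z :
  ringed M -> ringed N -> dom M z.1 -> dom N z.2 -> morph_at (prodsp M N) M fst z.
Proof. by move=> rM rN Mz Nz; split=> // u; exact: regat_fst. Qed.

Lemma morph_at_snd T S (M : cspace K T) (N : cspace K S) z :
  ringed M -> ringed N -> dom M z.1 -> dom N z.2 -> morph_at (prodsp M N) N snd z.
Proof. by move=> rM rN Mz Nz; split=> // u; exact: regat_snd. Qed.

Lemma morph_at_quot T S L (N : cspace K L) (M : cspace K T) (r : T -> S) f x :
  morph_at N M f x -> morph_at N (quotsp M r) (fun y => r (f y)) x.
Proof.
move=> [Mf rf]; split; first by exists (f x).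
by move=> u /(_ _ Mf erefl); exact: rf.
Qed.

Lemma morph_at_from_quot T S L (M : cspace K T) (r : T -> S) (N : cspace K L)
    g y :
  (exists2 x, dom M x & r x = y) ->
  (forall x, dom M x -> r x = y -> morph_at M N (fun z => g (r z)) x) ->
  morph_at (quotsp M r) N g y.
Proof.
move=> [x Mx rx] h; split; first by rewrite -rx; have [] := h x Mx rx.
by move=> u ru x' Mx' rx'; have [_] := h x' Mx' rx'; apply; rewrite rx'.
Qed.

Lemma zopen_preimage T S (M : cspace K T) (N : cspace K S) f (U : set S) :
  morphism M N f -> zopen N U -> zopen M (f @^-1` U).
Proof.
move=> mf oU x Mx Ux; have [Nf rf] := mf x Mx.
have := rf _ (oU _ Nf Ux); congr regat; apply/funext => y /=; congr (_%:R).
Qed.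

Lemma zopen_subsp T (M : cspace K T) (A U : set T) :
  zopen M U -> zopen (subsp M A) U.
Proof. by move=> oU x [Mx Ax] Ux; exists (fun y => (y \in U)%:R) => //; exact: oU. Qed.

Lemma zopen_eqdom T (M : cspace K T) (U V : set T) : ringed M ->
  (forall x, dom M x -> U x <-> V x) -> zopen M U -> zopen M V.
Proof.
move=> rM UV oU; apply: zopen_nonvanishing => // x Mx Vx.
have [w [rw wx wU]] := regat_indicator oU Mx ((UV x Mx).2 Vx).
by exists w; split=> // y My /wU; rewrite UV.
Qed.

Lemma space_iso_sym T S (M : cspace K T) (N : cspace K S) f g :
  space_iso M N f g -> space_iso N M g f.
Proof. by case. Qed.

End Morphisms.

(** * Regular maps to affine spaces and matrix spaces *)

Section PairLinear.
Variables (K : fieldType) (V W : vectType K).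
Definition pair_inl (v : V) : V * W := (v, 0).
Definition pair_inr (w : W) : V * W := (0, w).
Fact pair_inl_linear : linear pair_inl.
Proof. by move=> a u v; congr (_, _); rewrite /= scaler0 addr0. Qed.
Fact pair_inr_linear : linear pair_inr.
Proof. by move=> a u v; congr (_, _); rewrite /= scaler0 addr0. Qed.
HB.instance Definition _ := GRing.isLinear.Build K V (V * W)%type _ pair_inl pair_inl_linear.
HB.instance Definition _ := GRing.isLinear.Build K W (V * W)%type _ pair_inr pair_inr_linear.
End PairLinear.

Section FfunLinear.
Variables (K : fieldType) (I : finType) (V : vectType K) (i : I).
Definition ffun_single (v : V) : {ffun I -> V} := [ffun j => if j == i then v else 0].
Definition ffun_eval (B : {ffun I -> V}) : V := B i.
Fact ffun_single_linear : linear ffun_single.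
Proof.
move=> a u v; apply/ffunP => j; rewrite !ffunE; case: ifP => // _.
by rewrite scaler0 addr0.
Qed.
Fact ffun_eval_linear : linear ffun_eval.
Proof. by move=> a u v; rewrite /ffun_eval !ffunE. Qed.
HB.instance Definition _ := GRing.isLinear.Build K V {ffun I -> V} _ ffun_single ffun_single_linear.
HB.instance Definition _ := GRing.isLinear.Build K {ffun I -> V} V _ ffun_eval ffun_eval_linear.
End FfunLinear.

Section AffineMorphisms.
Variable K : fieldType.

Lemma regat_aff (V : vectType K) (f : V -> K) x :
  polyfun (@linear_forms K V) f -> regat (aff V) x f.
Proof.
move=> pf; exists f, (fun=> 1); split=> //; first exact: polyfun_cst.
  exact: oner_neq0.
by move=> y _; rewrite divr1.
Qed.

Lemma polyfun_linear (V : vectType K) (l : 'Hom(V, K^o)) :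
  polyfun (@linear_forms K V) l.
Proof. by apply: polyfun_gen; exists l. Qed.

Lemma regat_aff_linear (V : vectType K) (l : 'Hom(V, K^o)) x : regat (aff V) x l.
Proof. by apply: regat_aff; exact: polyfun_linear. Qed.

Section ToAffine.
Variables (T : Type) (M : cspace K T) (x : T).
Hypotheses (rM : ringed M) (Mx : dom M x).

(** Regular functions on an affine space are quotients of polynomials in linear forms, so linear
    forms are enough to test a map. *)
Lemma morph_at_aff (V : vectType K) (f : T -> V) :
  (forall l : 'Hom(V, K^o), regat M x (fun y => l (f y))) ->
  morph_at M (aff V) f x.
Proof.
move=> rl; split=> // u [n [d [pn pd dx e]]].
have rp h : polyfun (@linear_forms K V) h -> regat M x (fun y => h (f y)).
  elim=> [_ [l ->]|c|g h' _ rg _ rh|g h' _ rg _ rh].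
  - exact: rl.
  - exact: regat_cst.
  - exact: regat_add.
  - exact: regat_mul.
apply: (regat_div rM Mx (rp n pn) (rp d pd) dx) => y _ dy /=.
exact: e.
Qed.

Lemma morph_at_aff_linear (V : vectType K) (f : T -> V) (l : 'Hom(V, K^o)) :
  morph_at M (aff V) f x -> regat M x (fun y => l (f y)).
Proof. by move=> [_ rf]; apply: rf; exact: regat_aff_linear. Qed.

Lemma morph_at_aff_pair (V W : vectType K) (f : T -> V) (g : T -> W) :
  morph_at M (aff V) f x -> morph_at M (aff W) g x ->
  morph_at M (aff (V * W)%type) (fun y => (f y, g y)) x.
Proof.
move=> mf mg; apply: morph_at_aff => l.
have e y : l (f y, g y) = (l \o linfun (@pair_inl K V W))%VF (f y) +
                          (l \o linfun (@pair_inr K V W))%VF (g y).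
  rewrite !comp_lfunE !lfunE /= -linearD; congr (l _).
  by congr (_, _); rewrite /= ?addr0 ?add0r.
apply: (@regat_ext _ _ _ rM x _ _ Mx _ (fun y _ => e y)).
by apply: (regat_add rM Mx); apply: morph_at_aff_linear.
Qed.

Lemma morph_at_aff_ffun (I : finType) (V : vectType K) (f : T -> {ffun I -> V}) :
  (forall i, morph_at M (aff V) (fun y => f y i) x) ->
  morph_at M (aff {ffun I -> V}) f x.
Proof.
move=> mf; apply: morph_at_aff => l.
have e y : l (f y) = \sum_i (l \o linfun (@ffun_single K I V i))%VF (f y i).
  transitivity (\sum_i l (ffun_single i (f y i))); last first.
    by apply: eq_bigr => i _; rewrite comp_lfunE lfunE.
  rewrite -linear_sum; congr (l _); apply/ffunP => j.
  rewrite sum_ffunE (bigD1 j) //= ffunE eqxx big1 ?addr0 // => i ij.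
  by rewrite ffunE eq_sym (negbTE ij).
apply: (@regat_ext _ _ _ rM x _ _ Mx _ (fun y _ => e y)).
by apply: regat_sum => // i; exact: morph_at_aff_linear.
Qed.

Lemma morph_at_linear (V W : vectType K) (f : T -> V) (L : {linear V -> W}) :
  morph_at M (aff V) f x -> morph_at M (aff W) (fun y => L (f y)) x.
Proof.
move=> mf; apply: morph_at_aff => l.
have e y : l (L (f y)) = (l \o linfun L)%VF (f y) by rewrite comp_lfunE lfunE.
apply: (@regat_ext _ _ _ rM x _ _ Mx _ (fun y _ => e y)).
exact: morph_at_aff_linear.
Qed.

Lemma morph_at_scalar (f : T -> K) : regat M x f -> morph_at M (aff K^o) f x.
Proof.
move=> rf; apply: morph_at_aff => l.
have e y : l (f y) = f y * l 1.
  transitivity (l (f y *: (1 : K^o))); last exact: linearZ.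
  by congr (l _); rewrite /GRing.scale /= mulr1.
apply: (@regat_ext _ _ _ rM x _ _ Mx _ (fun y _ => e y)).
by apply: (regat_mul rM Mx) => //; exact: regat_cst.
Qed.

Lemma regat_scalar (f : T -> K) : morph_at M (aff K^o) f x -> regat M x f.
Proof.
move=> mf; apply: (@regat_ext _ _ _ rM x _ f Mx
  (@morph_at_aff_linear K^o f (linfun (@idfun K^o)) mf)) => y _.
by rewrite lfunE.
Qed.

End ToAffine.
End AffineMorphisms.

Section Matrices.
Variables (K : fieldType) (T : Type) (M : cspace K T) (x : T).
Hypotheses (rM : ringed M) (Mx : dom M x).

Definition mxreg m n (F : T -> 'M[K]_(m, n)) : Prop :=
  forall i j, regat M x (fun y => F y i j).

Lemma mxregP m n (F : T -> 'M[K]_(m, n)) :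
  mxreg F <-> morph_at M (aff 'M[K]_(m, n)) F x.
Proof.
split=> [rF|mF i j].
  apply: (morph_at_aff rM Mx) => l.
  have e y : l (F y) = \sum_i \sum_j F y i j * l (delta_mx i j).
    rewrite {1}[F y]matrix_sum_delta linear_sum; apply: eq_bigr => i _.
    by rewrite linear_sum; apply: eq_bigr => j _; rewrite linearZ.
  apply: (@regat_ext _ _ _ rM x _ _ Mx _ (fun y _ => e y)).
  apply: regat_sum => // i; apply: regat_sum => // j.
  by apply: (regat_mul rM Mx) => //; exact: regat_cst.
pose c (A : 'M[K]_(m, n)) : K^o := A i j.
have cl : linear c by move=> a u v; rewrite /c !mxE.
pose cL : {linear 'M[K]_(m, n) -> K^o} := HB.pack c (GRing.isLinear.Build _ _ _ _ c cl).
exact: (regat_scalar rM Mx (morph_at_linear rM Mx cL mF)).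
Qed.

Lemma mxreg_cst m n (A : 'M[K]_(m, n)) : mxreg (fun=> A).
Proof. by move=> i j; exact: regat_cst. Qed.

Lemma mxreg_add m n (F G : T -> 'M[K]_(m, n)) :
  mxreg F -> mxreg G -> mxreg (fun y => F y + G y).
Proof.
move=> rF rG i j; apply: (regat_ext rM Mx (regat_add rM Mx (rF i j) (rG i j))).
by move=> y _; rewrite mxE.
Qed.

Lemma mxreg_opp m n (F : T -> 'M[K]_(m, n)) : mxreg F -> mxreg (fun y => - F y).
Proof.
move=> rF i j; apply: (regat_ext rM Mx (regat_opp rM Mx (rF i j))).
by move=> y _; rewrite mxE.
Qed.

Lemma mxreg_scale m n a (F : T -> 'M[K]_(m, n)) :
  regat M x a -> mxreg F -> mxreg (fun y => a y *: F y).
Proof.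
move=> ra rF i j; apply: (regat_ext rM Mx (regat_mul rM Mx ra (rF i j))).
by move=> y _; rewrite mxE.
Qed.

Lemma mxreg_mul m n p (F : T -> 'M[K]_(m, n)) (G : T -> 'M[K]_(n, p)) :
  mxreg F -> mxreg G -> mxreg (fun y => F y *m G y).
Proof.
move=> rF rG i j.
have /(regat_ext rM Mx) : regat M x (fun y => \sum_k F y i k * G y k j).
  by apply: regat_sum => // k; exact: (regat_mul rM Mx).
by apply=> y _; rewrite mxE.
Qed.

Lemma mxreg_block m1 m2 n1 n2 (A : T -> 'M[K]_(m1, n1)) (B : T -> 'M[K]_(m1, n2))
    (C : T -> 'M[K]_(m2, n1)) (D : T -> 'M[K]_(m2, n2)) :
  mxreg A -> mxreg B -> mxreg C -> mxreg D ->
  mxreg (fun y => block_mx (A y) (B y) (C y) (D y)).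
Proof.
move=> rA rB rC rD i j; rewrite -(splitK i) -(splitK j).
case: (fintype.split i) => i'; case: (fintype.split j) => j' /=.
- by apply: (regat_ext rM Mx (rA i' j')) => y _; rewrite block_mxEul.
- by apply: (regat_ext rM Mx (rB i' j')) => y _; rewrite block_mxEur.
- by apply: (regat_ext rM Mx (rC i' j')) => y _; rewrite block_mxEdl.
- by apply: (regat_ext rM Mx (rD i' j')) => y _; rewrite block_mxEdr.
Qed.

Lemma mxreg_row m n1 n2 (A : T -> 'M[K]_(m, n1)) (B : T -> 'M[K]_(m, n2)) :
  mxreg A -> mxreg B -> mxreg (fun y => row_mx (A y) (B y)).
Proof.
move=> rA rB i j; rewrite -(splitK j); case: (fintype.split j) => j' /=.
- by apply: (regat_ext rM Mx (rA i j')) => y _; rewrite row_mxEl.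
- by apply: (regat_ext rM Mx (rB i j')) => y _; rewrite row_mxEr.
Qed.

Lemma mxreg_ulsub m1 m2 n1 n2 (F : T -> 'M[K]_(m1 + m2, n1 + n2)) :
  mxreg F -> mxreg (fun y => ulsubmx (F y)).
Proof. by move=> rF i j; apply: (regat_ext rM Mx (rF (lshift _ i) (lshift _ j))) => y _; rewrite !mxE. Qed.

Lemma mxreg_ursub m1 m2 n1 n2 (F : T -> 'M[K]_(m1 + m2, n1 + n2)) :
  mxreg F -> mxreg (fun y => ursubmx (F y)).
Proof. by move=> rF i j; apply: (regat_ext rM Mx (rF (lshift _ i) (rshift _ j))) => y _; rewrite !mxE. Qed.

Lemma mxreg_dlsub m1 m2 n1 n2 (F : T -> 'M[K]_(m1 + m2, n1 + n2)) :
  mxreg F -> mxreg (fun y => dlsubmx (F y)).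
Proof. by move=> rF i j; apply: (regat_ext rM Mx (rF (rshift _ i) (lshift _ j))) => y _; rewrite !mxE. Qed.

Lemma mxreg_drsub m1 m2 n1 n2 (F : T -> 'M[K]_(m1 + m2, n1 + n2)) :
  mxreg F -> mxreg (fun y => drsubmx (F y)).
Proof. by move=> rF i j; apply: (regat_ext rM Mx (rF (rshift _ i) (rshift _ j))) => y _; rewrite !mxE. Qed.

Lemma mxreg_tr m n (F : T -> 'M[K]_(m, n)) : mxreg F -> mxreg (fun y => (F y)^T).
Proof. by move=> rF i j; apply: (regat_ext rM Mx (rF j i)) => y _; rewrite mxE. Qed.

Lemma mxreg_mxvec m n (F : T -> 'M[K]_(m, n)) : mxreg F -> mxreg (fun y => mxvec (F y)).
Proof.
by move=> /mxregP mF; apply/mxregP; exact: (morph_at_linear rM Mx (@mxvec K m n) mF).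
Qed.

Lemma mxreg_vec_mx m n (F : T -> 'rV[K]_(m * n)) : mxreg F -> mxreg (fun y => vec_mx (F y)).
Proof.
by move=> /mxregP mF; apply/mxregP; exact: (morph_at_linear rM Mx (@vec_mx K m n) mF).
Qed.

End Matrices.

Section Determinant.
Variables (K : fieldType) (T : Type) (M : cspace K T) (x : T).
Hypotheses (rM : ringed M) (Mx : dom M x).

Lemma regat_det n (F : T -> 'M[K]_n) : mxreg M x F -> regat M x (fun y => \det (F y)).
Proof.
move=> rF; apply: regat_sum => // s; apply: (regat_mul rM Mx).
  exact: regat_cst.
by apply: regat_prod => // i.
Qed.

(** Cramer's rule. Where the determinant vanishes [invmx] takes a default value, on which
    [regat_div] imposes no condition. *)
Lemma mxreg_inv n (F : T -> 'M[K]_n) : mxreg M x F -> F x \in unitmx ->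
  mxreg M x (fun y => invmx (F y)).
Proof.
move=> rF ux i j.
have rd : regat M x (fun y => \det (F y)) by exact: regat_det.
have dx : \det (F x) != 0 by move: ux; rewrite unitmxE unitfE.
have ra : regat M x (fun y => (\adj (F y)) i j).
  have : regat M x (fun y => cofactor (F y) j i).
    apply: (regat_mul rM Mx); first exact: regat_cst.
    apply: regat_det => k l; apply: (regat_ext rM Mx (rF (lift j k) (lift i l))).
    by move=> y _; rewrite !mxE.
  by move/(regat_ext rM Mx); apply=> y _; rewrite mxE.
apply: (regat_div rM Mx ra rd dx) => y My dy.
by rewrite /invmx unitmxE unitfE dy !mxE mulrC.
Qed.

End Determinant.

(** * Underlying real spaces and conjugate spaces *)

Section RealSpaces.
Variable R : rcfType.
Local Notation C := R[i].

(* Morphisms to [realify N] are morphisms from [cplx M], and antimorphisms are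
   morphisms from [conjsp M]. *)
Definition cplx T (M : cspace R T) : cspace C T :=
  CSpace (dom M) (fun x f => regat M x (fun y => complex.Re (f y)) /\
                             regat M x (fun y => complex.Im (f y))).

Definition conjsp T (M : cspace C T) : cspace C T :=
  CSpace (dom M) (fun x f => regat M x (fun y => (f y)^*)).

Lemma ReM (a b : C) :
  complex.Re (a * b) = complex.Re a * complex.Re b - complex.Im a * complex.Im b.
Proof. by case: a => ? ?; case: b. Qed.
Lemma ImM (a b : C) :
  complex.Im (a * b) = complex.Re a * complex.Im b + complex.Im a * complex.Re b.
Proof. by case: a => ? ?; case: b. Qed.
Lemma ReD (a b : C) : complex.Re (a + b) = complex.Re a + complex.Re b.
Proof. by case: a => ? ?; case: b. Qed.
Lemma ImD (a b : C) : complex.Im (a + b) = complex.Im a + complex.Im b.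
Proof. by case: a => ? ?; case: b. Qed.
Lemma ReV (a : C) :
  complex.Re a^-1 = complex.Re a / (complex.Re a ^+ 2 + complex.Im a ^+ 2).
Proof. by case: a. Qed.
Lemma ImV (a : C) :
  complex.Im a^-1 = - complex.Im a / (complex.Re a ^+ 2 + complex.Im a ^+ 2).
Proof. by case: a => a b; rewrite /= mulNr. Qed.

Lemma sqnorm_eq0 (a : C) : (complex.Re a ^+ 2 + complex.Im a ^+ 2 == 0) = (a == 0).
Proof.
case: a => a b /=; rewrite paddr_eq0 ?sqr_ge0 // !expf_eq0 /= eq_complex /=.
by [].
Qed.

Lemma ringed_cplx T (M : cspace R T) : ringed M -> ringed (cplx M).
Proof.
move=> rM; split=> /=.
- by move=> x c Mx; split; exact: regat_cst.
- move=> x f g Mx [rf if_] [rg ig]; split.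
    by apply: (regat_ext rM Mx (regat_add rM Mx rf rg)) => y _; rewrite ReD.
  by apply: (regat_ext rM Mx (regat_add rM Mx if_ ig)) => y _; rewrite ImD.
- move=> x f g Mx [rf if_] [rg ig]; split.
    apply: (regat_ext rM Mx (regat_sub rM Mx (regat_mul rM Mx rf rg)
       (regat_mul rM Mx if_ ig))) => y _; exact: ReM.
  apply: (regat_ext rM Mx (regat_add rM Mx (regat_mul rM Mx rf ig)
    (regat_mul rM Mx if_ rg))) => y _; exact: ImM.
- move=> x f g u Mx [rf if_] [rg ig] gx e.
  (* The squared modulus of [g]: a real denominator for f / g, which vanishes exactly where [g]
     does. *)
  pose s y := complex.Re (g y) * complex.Re (g y) + complex.Im (g y) * complex.Im (g y).
  have sE y : s y = complex.Re (g y) ^+ 2 + complex.Im (g y) ^+ 2 by [].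
  have rs : regat M x s.
    by apply: (regat_add rM Mx); exact: (regat_mul rM Mx).
  have sx : s x != 0 by rewrite sE sqnorm_eq0.
  split.
    apply: (regat_div rM Mx (regat_add rM Mx (regat_mul rM Mx rf rg)
       (regat_mul rM Mx if_ ig)) rs sx) => y My sy.
    have gy : g y != 0 by rewrite -sqnorm_eq0.
    by rewrite e // ReM ReV ImV -sE; field.
  apply: (regat_div rM Mx (regat_sub rM Mx (regat_mul rM Mx if_ rg)
     (regat_mul rM Mx rf ig)) rs sx) => y My sy.
  have gy : g y != 0 by rewrite -sqnorm_eq0.
  by rewrite e // ImM ReV ImV -sE; field.
Qed.

Lemma ringed_conjsp T (M : cspace C T) : ringed M -> ringed (conjsp M).
Proof.
move=> rM; split=> /=.
- by move=> x c Mx; exact: (regat_cst rM).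
- move=> x f g Mx rf rg; apply: (regat_ext rM Mx (regat_add rM Mx rf rg)) => y _.
  exact: rmorphD.
- move=> x f g Mx rf rg; apply: (regat_ext rM Mx (regat_mul rM Mx rf rg)) => y _.
  exact: rmorphM.
- move=> x f g u Mx rf rg gx e.
  apply: (regat_div rM Mx rf rg); first by rewrite conjc_eq0.
  move=> y My; rewrite conjc_eq0 => gy; rewrite e //.
  by rewrite -conjc_inv; exact: rmorphM.
Qed.

Lemma ringed_realify T (M : cspace C T) : ringed M -> ringed (realify M).
Proof.
move=> rM; apply: ringed_quotient => x Mx.
(* The indicator of the domain is regular, as only values on the domain matter, and it provides the
   function vanishing off the domain that [ringed_quotient] asks for. *)
pose w (y : T) : C := (y \in dom M)%:R.
exists (fun y => complex.Re (w y)); split.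
- apply: polyfun_gen; exists w; last by left.
  by apply: (regat_ext rM Mx (regat_cst rM 1 Mx)) => y My; rewrite /w mem_set.
- by rewrite /w mem_set //= oner_neq0.
- by move=> y; rewrite /w; case: (boolP (y \in dom M)) => [/set_mem // | _]; rewrite eqxx.
Qed.

Lemma regat_realify T (M : cspace C T) x f : regat M x f ->
  regat (realify M) x (fun y => complex.Re (f y)) /\
  regat (realify M) x (fun y => complex.Im (f y)).
Proof.
move=> rf; split.
  exists (fun y => complex.Re (f y)), (fun=> 1); split.
  - by apply: polyfun_gen; exists f => //; left.
  - exact: polyfun_cst.
  - exact: oner_neq0.
  - by move=> y _; rewrite divr1.
exists (fun y => complex.Im (f y)), (fun=> 1); split.
- by apply: polyfun_gen; exists f => //; right.
- exact: polyfun_cst.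
- exact: oner_neq0.
- by move=> y _; rewrite divr1.
Qed.

Lemma morph_at_realify T S (M : cspace R T) (N : cspace C S) f x :
  ringed M -> dom M x -> morph_at (cplx M) N f x -> morph_at M (realify N) f x.
Proof.
move=> rM Mx [Nf rf]; split=> // u [n [d [pn pd dx e]]].
have rp h : polyfun [set u | exists2 f0, regat N (f x) f0 &
      u = (fun y => complex.Re (f0 y)) \/ u = (fun y => complex.Im (f0 y))] h ->
    regat M x (fun y => h (f y)).
  elim=> [g [v rv vE]|c|g h' _ rg _ rh|g h' _ rg _ rh].
  - by have [re im] := rf v rv; case: vE => ->.
  - exact: regat_cst.
  - exact: regat_add.
  - exact: regat_mul.
apply: (regat_div rM Mx (rp n pn) (rp d pd) dx) => y _ dy /=.
exact: e.
Qed.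

Lemma morph_at_cplx_realify T S (M : cspace R T) (N : cspace C S) f x :
  morph_at M (realify N) f x -> morph_at (cplx M) N f x.
Proof.
move=> [Nf rf]; split=> // u ru; have [re im] := regat_realify ru.
by split; [exact: (rf _ re)|exact: (rf _ im)].
Qed.

Lemma morph_at_cplx T S (M : cspace R T) (N : cspace R S) f x :
  morph_at M N f x -> morph_at (cplx M) (cplx N) f x.
Proof. by move=> [Nf rf]; split=> // u [re im]; split; [exact: (rf _ re)|exact: (rf _ im)]. Qed.

Lemma morph_at_conjsp T S (M : cspace C T) (N : cspace C S) f x :
  morph_at M N f x -> morph_at (conjsp M) (conjsp N) f x.
Proof. by move=> [Nf rf]; split=> // u ru; exact: (rf _ ru). Qed.

Lemma cplx_sub_realify_id T (M : cspace C T) A x : dom M x ->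
  morph_at (cplx (subsp (realify M) A)) M id x.
Proof. by move=> Mx; apply: morph_at_cplx_realify; exact: morph_at_incl. Qed.

Lemma antimorphismP T S (M : cspace C T) (N : cspace C S) f :
  antimorphism M N f <-> morphism (conjsp M) N f.
Proof. by []. Qed.

Lemma regat_conjsp_conj T (M : cspace C T) x f : regat M x f ->
  regat (conjsp M) x (fun y => (f y)^*).
Proof.
by move=> rf; rewrite /=; have -> : (fun y => ((f y)^*)^*) = f by apply/funext => y; exact: conjcK.
Qed.

Lemma mxreg_conjsp T (M : cspace C T) x m n (F : T -> 'M[C]_(m, n)) :
  mxreg M x F -> mxreg (conjsp M) x (fun y => map_mx Num.conj (F y)).
Proof.
move=> rF i j; have := regat_conjsp_conj (rF i j).
by congr regat; apply/funext => y; rewrite mxE.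
Qed.

End RealSpaces.

(** * Grassmannians and projective spaces *)

Section Frames.
Variables (K : fieldType) (V : vectType K) (d : nat).
Implicit Type B : {ffun 'I_d -> V}.

Lemma codom_mktuple B : codom B = [tuple B i | i < d] :> seq V.
Proof. by rewrite /= codomE; congr map; rewrite val_ord_tuple. Qed.

Lemma free_frameP B :
  free (codom B) <-> forall k : 'I_d -> K, \sum_i k i *: B i = 0 -> forall i, k i = 0.
Proof.
rewrite codom_mktuple; split=> [/freeP fB k k0|h].
  by apply: fB; rewrite -[RHS]k0; apply: eq_bigr => i _; rewrite -tnth_nth tnth_mktuple.
apply/freeP => k k0; apply: h; rewrite -[RHS]k0.
by apply: eq_bigr => i _; rewrite -tnth_nth tnth_mktuple.
Qed.

Lemma span_frameP B v :
  v \in <<codom B>>%VS <-> exists k : 'I_d -> K, v = \sum_i k i *: B i.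
Proof.
rewrite codom_mktuple; split=> [/coord_span e|[k ->]].
  exists (fun i => coord [tuple B i | i < d] i v); rewrite {1}e.
  by apply: eq_bigr => i _; rewrite -tnth_nth tnth_mktuple.
apply: memv_suml => i _; apply: memvZ; apply: memv_span.
by apply/mapP; exists i => //; rewrite mem_ord_enum || rewrite mem_enum.
Qed.

Lemma mem_frame B i : B i \in <<codom B>>%VS.
Proof.
apply/span_frameP; exists (fun j => (j == i)%:R).
by rewrite (bigD1 i) //= eqxx scale1r big1 ?addr0 // => j /negbTE->; rewrite scale0r.
Qed.

Lemma dim_frame B : free (codom B) -> \dim <<codom B>> = d.
Proof. by rewrite /free => /eqP->; rewrite size_codom card_ord. Qed.

Lemma dom_grassP W : dom (grass d V) W <-> \dim W = d.
Proof.
split=> [[B [_ fB] <-]|dW]; first exact: dim_frame.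
pose B := [ffun i : 'I_d => (vbasis W)`_i].
have e : codom B = vbasis W.
  apply: (@eq_from_nth _ 0); first by rewrite size_codom card_ord size_tuple dW.
  move=> i; rewrite size_codom card_ord => id.
  have -> : i = Ordinal id by [].
  rewrite codom_mktuple -tnth_nth tnth_mktuple ffunE //.
exists B; last by rewrite e; apply: span_basis; exact: vbasisP.
by split=> //=; rewrite e; apply: basis_free; exact: vbasisP.
Qed.

Lemma ringed_frames : ringed (frames d V).
Proof. by apply: ringed_subsp; exact: ringed_aff. Qed.

Lemma ringed_grass : ringed (grass d V).
Proof. by apply: ringed_quotsp; exact: ringed_frames. Qed.

Lemma morph_at_grass T (M : cspace K T) (B : T -> {ffun 'I_d -> V}) x :
  ringed M -> dom M x -> (forall y, dom M y -> free (codom (B y))) ->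
  (forall i, morph_at M (aff V) (fun y => B y i) x) ->
  morph_at M (grass d V) (fun y => <<codom (B y)>>%VS) x.
Proof.
move=> rM Mx fB mB; apply: morph_at_quot; apply: morph_at_subcod => //.
  by move=> y My; split=> //; exact: fB.
exact: morph_at_aff_ffun.
Qed.

Lemma frame_coord_regat B i : morph_at (frames d V) (aff V) (fun B => B i) B.
Proof.
apply: morph_at_subdom.
by apply: (morph_at_linear (ringed_aff _) (x := B) I (@ffun_eval K 'I_d V i));
  exact: morph_at_id.
Qed.

End Frames.

Section ProjectiveSpace.
Variables (K : fieldType) (N : nat).
Local Notation E := 'rV[K]_N.+1.

Lemma span_singleton (v : E) : <<codom [ffun i : 'I_1 => v]>>%VS = <[v]>%VS.
Proof.
apply/vspaceP => w; apply/idP/vlineP => [/span_frameP[k ->]|[a ->]].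
  by exists (k 0); rewrite big_ord1 ffunE.
by apply/span_frameP; exists (fun=> a); rewrite big_ord1 ffunE.
Qed.

Lemma free_singleton (v : E) : v != 0 -> free (codom [ffun i : 'I_1 => v]).
Proof.
move=> v0; apply/free_frameP => k; rewrite big_ord1 ffunE => /eqP.
by rewrite scaler_eq0 (negbTE v0) orbF => /eqP k0 i; rewrite ord1.
Qed.

Lemma ringed_proj : ringed (proj_space K N).
Proof. exact: ringed_grass. Qed.

Lemma dom_projP L : dom (proj_space K N) L <-> exists2 v : E, v != 0 & L = <[v]>%VS.
Proof.
rewrite dom_grassP; split=> [dL|[v v0 ->]]; last by rewrite dim_vline v0.
exists (vpick L); first by rewrite vpick0 -dimv_eq0 dL.
apply/esym/eqP; rewrite eqEdim -memvE memv_pick dL dim_vline.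
by rewrite vpick0 -dimv_eq0 dL.
Qed.

Lemma dom_proj_line (v : E) : v != 0 -> dom (proj_space K N) <[v]>%VS.
Proof. by move=> v0; apply/dom_projP; exists v. Qed.

Lemma morph_at_proj T (M : cspace K T) (v : T -> E) x :
  ringed M -> dom M x -> (forall y, dom M y -> v y != 0) -> mxreg M x v ->
  morph_at M (proj_space K N) (fun y => <[v y]>%VS) x.
Proof.
move=> rM Mx v0 /(mxregP rM Mx) mv.
apply: (morph_at_ext rM Mx (f' := fun y => <<codom [ffun i : 'I_1 => v y]>>%VS)).
  by move=> y _; rewrite span_singleton.
apply: morph_at_grass => //.
  by move=> y My; apply: free_singleton; exact: v0.
move=> i; apply: (morph_at_ext rM Mx _ mv).
by move=> y _; rewrite ffunE.
Qed.

Definition nonzero_vectors : cspace K E := subsp (aff E) [set v | v != 0].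

Lemma ringed_nonzero : ringed nonzero_vectors.
Proof. by apply: ringed_subsp; exact: ringed_aff. Qed.

Lemma mxreg_nonzero v : mxreg nonzero_vectors v id.
Proof.
have [_ h] : morph_at nonzero_vectors (aff E) id v by exact: morph_at_incl.
move=> i j; apply: (h (fun w : E => w i j)).
exact: ((mxregP (@ringed_aff K E) (x := v) I id).2 (@morph_at_id _ _ (aff E) v I)).
Qed.

(** A frame of length one is a nonzero vector, so maps out of projective space are tested on the
    punctured vector space. *)
Lemma morph_at_from_proj T (M : cspace K T) g L :
  dom (proj_space K N) L ->
  (forall v : E, v != 0 -> <[v]>%VS = L ->
     morph_at nonzero_vectors M (fun v => g <[v]>%VS) v) ->
  morph_at (proj_space K N) M g L.
Proof.
move=> /dom_projP[v0 v0n0 L0] h; apply: morph_at_from_quot.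
  exists [ffun=> v0]; last by rewrite span_singleton.
  by split=> //; exact: free_singleton.
have spanB (B : {ffun 'I_1 -> E}) : <<codom B>>%VS = <[B ord0]>%VS.
  have eB : [ffun i : 'I_1 => B ord0] = B by apply/ffunP => i; rewrite ffunE (ord1 i).
  by rewrite -span_singleton eB.
have freeB (B : {ffun 'I_1 -> E}) : free (codom B) -> B ord0 != 0.
  move/dim_frame; rewrite spanB dim_vline => e; apply/eqP => B0.
  by move: e; rewrite B0 eqxx.
move=> B [_ fB]; rewrite spanB => BL.
have rf : ringed (frames 1 E) by exact: ringed_frames.
apply: (morph_at_ext rf _ (f' := fun B : {ffun 'I_1 -> E} => g <[B ord0]>%VS)) => //.
  by move=> y _; rewrite spanB.
apply: (@morph_at_comp _ _ _ _ _ nonzero_vectors _ (fun B : {ffun 'I_1 -> E} => B ord0) (fun v => g <[v]>%VS)).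
  apply: morph_at_subcod => //; last exact: frame_coord_regat.
  by move=> y [_ fy]; split=> //; exact: freeB.
exact: (h _ (freeB _ fB) BL).
Qed.

End ProjectiveSpace.

(** * Non-vanishing of polynomials over an infinite field *)

Definition infinite_field (K : fieldType) : Prop :=
  forall P : {poly K}, P != 0 -> exists s, P.[s] != 0.

(** In characteristic zero the integers below [size P] are distinct, and they are too many to be all
    roots of [P]. *)
Lemma numField_infinite (K : numFieldType) : infinite_field K.
Proof.
move=> P P0; apply/not_existsP => h.
pose s : seq K := [seq n%:R | n <- iota 0 (size P)].
have us : uniq s by rewrite map_inj_uniq ?iota_uniq // => m n /eqP; rewrite eqr_nat => /eqP.
have rs : all (root P) s.
  by apply/allP => x _; rewrite rootE; apply/negP => /negP /(h x).
by have := max_poly_roots P0 rs us; rewrite size_map size_iota ltnn.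
Qed.

Section Density.
Variable K : fieldType.

Lemma polyfun_line (V : vectType K) (f : V -> K) (x v : V) :
  polyfun (@linear_forms K V) f -> exists P : {poly K}, forall s, f (x + s *: v) = P.[s].
Proof.
elim=> [_ [l ->]|c|g h _ [P eP] _ [Q eQ]|g h _ [P eP] _ [Q eQ]].
- exists ((l x : K)%:P + (l v : K) *: 'X) => s.
  by rewrite hornerE hornerZ hornerX hornerC linearD linearZ [in RHS]mulrC.
- by exists c%:P => s; rewrite hornerC.
- by exists (P + Q) => s; rewrite hornerD eP eQ.
- by exists (P * Q) => s; rewrite hornerM eP eQ.
Qed.

(** Irreducibility of affine space: on the line through [x] and [y] both functions become nonzero
    polynomials in one variable, and a non-root of their product gives the point. *)
Lemma polyfun_common_nonzero (V : vectType K) (f g : V -> K) x y :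
  infinite_field K -> polyfun (@linear_forms K V) f -> polyfun (@linear_forms K V) g ->
  f x != 0 -> g y != 0 -> exists z, f z != 0 /\ g z != 0.
Proof.
move=> infK pf pg fx gy.
have [P eP] := polyfun_line x (y - x) pf.
have [Q eQ] := polyfun_line x (y - x) pg.
have P0 : P != 0.
  by apply: contraNneq fx => P0; have := eP 0; rewrite P0 horner0 scale0r addr0 => ->.
have Q0 : Q != 0.
  apply: contraNneq gy => Q0; have := eQ 1; rewrite Q0 horner0 scale1r.
  by rewrite addrC subrK => ->.
have [s] := infK _ (mulf_neq0 P0 Q0).
by rewrite hornerM mulf_eq0 negb_or -eP -eQ => /andP[? ?]; exists (x + s *: (y - x)).
Qed.

End Density.

(** * The subspaces W_c and the twisted product *)

Section FamilyAlgebra.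
Variables (K : fieldType) (p q : nat).
Local Notation g := 'M[K]_(q + p).
Local Notation h := ('M[K]_(q + p) * 'M[K]_(q + p))%type.
Implicit Types (c : K * K) (X Y : g) (w : h).

(* [Tab c X] parametrizes the subspace Ad_zeta[g] for [c.1 : c.2] =
   [mu^2 : nu^2]; unlike Ad_zeta it makes sense for all c <> 0. *)
Definition Tab c X : h :=
  (block_mx (ulsubmx X) (c.1 *: ursubmx X) (c.2 *: dlsubmx X) (drsubmx X),
   block_mx (ulsubmx X) (c.2 *: ursubmx X) (c.1 *: dlsubmx X) (drsubmx X)).

Lemma TabE c (A : 'M[K]_q) B D (E : 'M[K]_p) : Tab c (block_mx A B D E) =
  (block_mx A (c.1 *: B) (c.2 *: D) E, block_mx A (c.2 *: B) (c.1 *: D) E).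
Proof. by rewrite /Tab block_mxKul block_mxKur block_mxKdl block_mxKdr. Qed.

Fact Tab_linear c : linear (Tab c).
Proof.
move=> a X Y; rewrite -[X]submxK -[Y]submxK scale_block_mx add_block_mx !TabE.
congr (_, _); rewrite /= scale_block_mx add_block_mx !scalerDr !scalerA;
by rewrite ![_ * a]mulrC.
Qed.
HB.instance Definition _ c := GRing.isLinear.Build K g h _ (Tab c) (Tab_linear c).

Definition Wab c : {vspace h} := limg (linfun (Tab c)).

Lemma mem_WabP c w : w \in Wab c <-> exists X, w = Tab c X.
Proof.
split=> [/memv_imgP[X _ ->]|[X ->]]; first by exists X; rewrite lfunE.
by apply/memv_imgP; exists X; rewrite ?memvf ?lfunE.
Qed.

Lemma mem_Tab c X : Tab c X \in Wab c.
Proof. by apply/mem_WabP; exists X. Qed.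

Lemma Wab_scale a c : a != 0 -> Wab (a * c.1, a * c.2) = Wab c.
Proof.
move=> a0; apply/vspaceP => w; apply/idP/idP => /mem_WabP[X ->]; apply/mem_WabP.
  exists (block_mx (ulsubmx X) (a *: ursubmx X) (a *: dlsubmx X) (drsubmx X)).
  by rewrite TabE /Tab /= !scalerA ![_ * a]mulrC.
exists (block_mx (ulsubmx X) (a^-1 *: ursubmx X) (a^-1 *: dlsubmx X) (drsubmx X)).
by rewrite TabE /Tab /= !scalerA !(mulrC _ a^-1) !mulKf.
Qed.

(** The two standard charts of the projective line: [cab false 0] is the point 0 and [cab true 0]
    the point at infinity. In both charts the product of the two coordinates is t. *)
Definition cab (e : bool) (t : K) : K * K := if e then (1, t) else (t, 1).

Lemma cab_neq0 e t : cab e t != 0.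
Proof. by case: e; apply/eqP => -[]; try move=> /eqP; rewrite ?oner_eq0 // => _ /eqP; rewrite oner_eq0. Qed.

Lemma Wab_chart c : c != 0 -> exists e t, Wab c = Wab (cab e t) /\
  exists2 a : K, a != 0 & c = (a * (cab e t).1, a * (cab e t).2).
Proof.
case: c => a b; case: (eqVneq b 0) => [-> ab|b0 _].
  have a0 : a != 0 by apply: contraNneq ab => ->.
  exists true, 0.
  have e : (a, 0) = (a * (cab true 0).1, a * (cab true 0).2).
    by rewrite /= mulr1 mulr0.
  by rewrite {1}e Wab_scale //; split=> //; exists a.
exists false, (a / b).
have e : (a, b) = (b * (cab false (a / b)).1, b * (cab false (a / b)).2).
  by rewrite /= mulr1 mulrC divfK.
by rewrite {1}e Wab_scale //; split=> //; exists b.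
Qed.

(** A linear left inverse of [Tab (cab e t)] that does not depend on t: each off-diagonal block is
    read in the component where its coefficient is 1. *)
Definition Lam (e : bool) w : g :=
  if e then block_mx (ulsubmx w.1) (ursubmx w.1) (dlsubmx w.2) (drsubmx w.1)
  else block_mx (ulsubmx w.1) (ursubmx w.2) (dlsubmx w.1) (drsubmx w.1).

Fact Lam_linear e : linear (Lam e).
Proof.
move=> a [w1 w2] [u1 u2]; rewrite -[w1]submxK -[w2]submxK -[u1]submxK -[u2]submxK.
by case: e; rewrite /Lam /= !(scale_block_mx, add_block_mx, block_mxKul, block_mxKur,
  block_mxKdl, block_mxKdr).
Qed.
HB.instance Definition _ e := GRing.isLinear.Build K h g _ (Lam e) (Lam_linear e).

Lemma Tab0 c : Tab c 0 = 0. Proof. exact: raddf0. Qed.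
Lemma Tab_sum c (I : finType) (F : I -> g) : Tab c (\sum_i F i) = \sum_i Tab c (F i).
Proof. exact: raddf_sum. Qed.
Lemma TabD c X Y : Tab c (X + Y) = Tab c X + Tab c Y. Proof. exact: raddfD. Qed.
Lemma TabZ c a X : Tab c (a *: X) = a *: Tab c X. Proof. exact: linearZ. Qed.
Lemma Lam_sum e (I : finType) (F : I -> h) : Lam e (\sum_i F i) = \sum_i Lam e (F i).
Proof. exact: raddf_sum. Qed.
Lemma LamB e w w' : Lam e (w - w') = Lam e w - Lam e w'. Proof. exact: raddfB. Qed.
Lemma LamZ e a w : Lam e (a *: w) = a *: Lam e w. Proof. exact: linearZ. Qed.

Lemma LamK e t : cancel (Tab (cab e t)) (Lam e).
Proof.
by case: e => X; rewrite /Lam /Tab /= !(block_mxKul, block_mxKur, block_mxKdl, block_mxKdr)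
  !scale1r submxK.
Qed.

Lemma TabK e t w : w \in Wab (cab e t) -> Tab (cab e t) (Lam e w) = w.
Proof. by move=> /mem_WabP[X ->]; rewrite LamK. Qed.

Lemma Tab_inj c : c != 0 -> injective (Tab c).
Proof.
move=> /Wab_chart[e [t [_ [a a0 ->]]]] X Y.
rewrite -[X]submxK -[Y]submxK !TabE /= => -[/eq_block_mx[-> /eqP]].
rewrite -?scalerA (inj_eq (scalerI a0)) => /eqP eB /eqP.
rewrite -?scalerA (inj_eq (scalerI a0)) => /eqP eC -> /eq_block_mx[_ /eqP].
rewrite -?scalerA (inj_eq (scalerI a0)) => /eqP eB' /eqP.
rewrite -?scalerA (inj_eq (scalerI a0)) => /eqP eC' _.
by case: e eB eC eB' eC' => /=; rewrite !scale1r => *; congr block_mx.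
Qed.

Lemma dim_Wab c : c != 0 -> \dim (Wab c) = \dim {: g}.
Proof.
move=> c0; rewrite limg_dim_eq //; apply/eqP; rewrite -subv0; apply/subvP => X.
rewrite memv_cap memv_ker lfunE memv0 => /andP[_ /eqP TX].
by apply/eqP; apply: (Tab_inj c0); rewrite TX Tab0.
Qed.

(** Linear equations of W_c whose coefficients are polynomial in c, with no choice of chart. *)
Lemma mem_Wab_eqs c w : c != 0 ->
  w \in Wab c <-> [/\ ulsubmx w.1 = ulsubmx w.2, drsubmx w.1 = drsubmx w.2,
     c.2 *: ursubmx w.1 = c.1 *: ursubmx w.2 &
     c.2 *: dlsubmx w.2 = c.1 *: dlsubmx w.1].
Proof.
move=> c0; split.
  move=> /mem_WabP[X ->]; rewrite /Tab /= !(block_mxKul, block_mxKur, block_mxKdl, block_mxKdr).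
  by rewrite !scalerA [c.2 * c.1]mulrC.
have [e [t [-> [a a0 ->]]]] := Wab_chart c0; move=> [e1 e2 /eqP].
rewrite /= -!scalerA (inj_eq (scalerI a0)) => /eqP e3 /eqP.
rewrite -?scalerA (inj_eq (scalerI a0)) => /eqP e4; apply/mem_WabP; exists (Lam e w).
case: w e1 e2 e3 e4 => w1 w2 /= e1 e2 e3 e4.
rewrite -[w1 in LHS]submxK -[w2 in LHS]submxK -e1 -e2.
by case: e e3 e4 => /=; rewrite /Lam TabE !scale1r /= => e3 e4; rewrite ?e3 ?e4 // -e3 -e4.
Qed.

(** [pmul], [pinv] and [punit] are [mulh], [invh] and [Hset] over an arbitrary field; over the
    complex numbers they are convertible to them. *)
Definition pmul (a b : h) : h := (a.1 *m b.1, a.2 *m b.2).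
Definition pinv (a : h) : h := (invmx a.1, invmx a.2).
Definition punit : set h := [set x | x.1 \in unitmx /\ x.2 \in unitmx].

Definition twist (s : K) X Y : g :=
  block_mx (ulsubmx X *m ulsubmx Y + s *: (ursubmx X *m dlsubmx Y))
           (ulsubmx X *m ursubmx Y + ursubmx X *m drsubmx Y)
           (dlsubmx X *m ulsubmx Y + drsubmx X *m dlsubmx Y)
           (s *: (dlsubmx X *m ursubmx Y) + drsubmx X *m drsubmx Y).

Lemma pmul_Tab c X Y : pmul (Tab c X) (Tab c Y) = Tab c (twist (c.1 * c.2) X Y).
Proof.
rewrite /pmul /Tab /twist /= !mulmx_block !(block_mxKul, block_mxKur, block_mxKdl, block_mxKdr).
rewrite -!(scalemxAl, scalemxAr) !scalerDr !scalerA.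
by rewrite [c.2 * c.1]mulrC.
Qed.

Definition pone : h := (1%:M, 1%:M).

Lemma Tab1 c : Tab c 1%:M = pone.
Proof. by rewrite scalar_mx_block TabE !scaler0 -scalar_mx_block. Qed.

Lemma mem_pone c : pone \in Wab c.
Proof. by rewrite -(Tab1 c) mem_Tab. Qed.

Lemma mem_pmul c w w' : w \in Wab c -> w' \in Wab c -> pmul w w' \in Wab c.
Proof. by move=> /mem_WabP[X ->] /mem_WabP[Y ->]; rewrite pmul_Tab mem_Tab. Qed.

Lemma pmulA w1 w2 w3 : pmul w1 (pmul w2 w3) = pmul (pmul w1 w2) w3.
Proof. by rewrite /pmul /= !mulmxA. Qed.
Lemma pmul1l w : pmul pone w = w.
Proof. by case: w => a b; rewrite /pmul /= !mul1mx. Qed.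
Lemma pmul1r w : pmul w pone = w.
Proof. by case: w => a b; rewrite /pmul /= !mulmx1. Qed.
Lemma pmulVr w : punit w -> pmul w (pinv w) = pone.
Proof. by case: w => a b [/= ua ub]; rewrite /pmul /= !mulmxV. Qed.
Lemma pmulVl w : punit w -> pmul (pinv w) w = pone.
Proof. by case: w => a b [/= ua ub]; rewrite /pmul /= !mulVmx. Qed.
Lemma punit_mul w w' : punit w -> punit w' -> punit (pmul w w').
Proof. by move=> [? ?] [? ?]; split; rewrite /= unitmx_mul; apply/andP. Qed.
Lemma punit_inv w : punit w -> punit (pinv w).
Proof. by move=> [? ?]; split; rewrite /= unitmx_inv. Qed.
Lemma punit1 : punit pone.
Proof. by split; rewrite /= unitmx1. Qed.

Fact pmul_linear w : linear (pmul w).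
Proof. by move=> a u v; congr (_, _); rewrite /= mulmxDr -scalemxAr. Qed.

(* Left multiplication by an invertible element of the finite-dimensional
   algebra [Wab c] is injective, hence onto. *)
Lemma mem_pinv c w : w \in Wab c -> punit w -> pinv w \in Wab c.
Proof.
move=> wW Hw.
pose L : {linear h -> h} := HB.pack (pmul w) (GRing.isLinear.Build _ _ _ _ (pmul w) (pmul_linear w)).
have LE : linfun (pmul w) =1 pmul w := lfunE L.
have sub : (linfun (pmul w) @: Wab c <= Wab c)%VS.
  by apply/subvP => v /memv_imgP[u uW ->]; rewrite LE mem_pmul.
have dm : \dim (linfun (pmul w) @: Wab c) = \dim (Wab c).
  apply: limg_dim_eq; apply/eqP; rewrite -subv0; apply/subvP => u.
  rewrite memv_cap memv_ker LE memv0 => /andP[_ /eqP wu0].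
  by rewrite -(pmul1l u) -(pmulVl Hw) -pmulA wu0 /pmul /= !mulmx0.
have /eqP e : (linfun (pmul w) @: Wab c == Wab c)%VS by rewrite eqEdim sub dm leqnn.
have := mem_pone c; rewrite -e => /memv_imgP[u uW]; rewrite LE => wu1.
by rewrite -(pmul1r (pinv w)) wu1 pmulA pmulVl // pmul1l e.
Qed.

End FamilyAlgebra.

Section FamilyMembers.
Variables (R : realType) (p q : nat).
Local Notation C := R[i].
Local Notation g := 'M[C]_(q + p).
Local Notation h := ('M[C]_(q + p) * 'M[C]_(q + p))%type.
Implicit Types (X : g) (w z : h).

Lemma mem_diag_g w : w \in diag_g R p q <-> exists X : g, w = (X, X).
Proof.
have dl : linear (fun X : g => (X, X) : h) by [].
(* [diag_g] applies [linfun] to a bare function; packing it as a linear map makes [lfunE]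
   applicable. *)
pose L : {linear g -> h} := HB.pack (fun X : g => (X, X) : h)
  (GRing.isLinear.Build _ _ _ _ (fun X : g => (X, X) : h) dl).
have LE : linfun (fun X : g => (X, X) : h) =1 (fun X => (X, X)) := lfunE L.
split=> [/memv_imgP[X _ ->]|[X ->]]; first by exists X; rewrite LE.
by apply/memv_imgP; exists X; rewrite ?memvf // LE.
Qed.

Lemma mem_Ad_g z w : w \in Ad_g z <-> exists X : g, w = Ad z (X, X).
Proof.
have Al : linear (@Ad R p q z).
  move=> a u v; rewrite /Ad /mulh; congr (_, _); rewrite /=;
  by rewrite mulmxDr -scalemxAr mulmxDl -scalemxAl.
pose L : {linear h -> h} := HB.pack (Ad z) (GRing.isLinear.Build _ _ _ _ (Ad z) Al).
have LE : linfun (Ad z) =1 Ad z := lfunE L.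
split=> [/memv_imgP[u /mem_diag_g[X ->] ->]|[X ->]]; first by exists X; rewrite LE.
by apply/memv_imgP; exists (X, X); rewrite ?LE //; apply/mem_diag_g; exists X.
Qed.

Lemma unit_diag (mu nu : C) : mu != 0 -> nu != 0 ->
  (block_mx mu%:M 0 0 nu%:M : g) \in unitmx.
Proof. by move=> m0 n0; rewrite block_diag_mx_unit !unitmxE !det_scalar !unitfE !expf_neq0. Qed.

Lemma inv_diag (mu nu : C) : mu != 0 -> nu != 0 ->
  invmx (block_mx mu%:M 0 0 nu%:M : g) = block_mx mu^-1%:M 0 0 nu^-1%:M.
Proof. by move=> m0 n0; rewrite invmx_block_diag ?unit_diag // !invmx_scalar. Qed.

Lemma Ad_zeta (mu nu : C) X : mu != 0 -> nu != 0 ->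
  Ad (zeta p q mu nu) (X, X) = Tab (mu ^+ 2, nu ^+ 2)
    (block_mx (ulsubmx X) ((mu * nu)^-1 *: ursubmx X) ((mu * nu)^-1 *: dlsubmx X) (drsubmx X)).
Proof.
move=> m0 n0.
have e1 : mu ^+ 2 * (mu * nu)^-1 = nu^-1 * mu by rewrite expr2 invfM mulrA mulfK // mulrC.
have e2 : nu ^+ 2 * (mu * nu)^-1 = mu^-1 * nu by rewrite expr2 invfM mulrCA mulfK.
rewrite -{1 2}[X]submxK TabE /Ad /zeta /mulh /invh /= invmxK inv_diag //.
rewrite !mulmx_block !(mulmx0, mul0mx, addr0, add0r) !mul_scalar_mx !mul_mx_scalar.
rewrite !scalerA e1 e2 [nu * mu^-1]mulrC [mu * nu^-1]mulrC.
by rewrite !mulVf // !mulfV // !scale1r.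
Qed.

Lemma Ad_g_zeta (mu nu : C) : mu != 0 -> nu != 0 ->
  Ad_g (zeta p q mu nu) = Wab p q (mu ^+ 2, nu ^+ 2).
Proof.
move=> m0 n0; apply/vspaceP => w; apply/idP/idP => [/mem_Ad_g[X ->]|/mem_WabP[X ->]].
  by rewrite Ad_zeta // mem_Tab.
apply/mem_Ad_g.
exists (block_mx (ulsubmx X) ((mu * nu) *: ursubmx X) ((mu * nu) *: dlsubmx X) (drsubmx X)).
rewrite Ad_zeta // !(block_mxKul, block_mxKur, block_mxKdl, block_mxKdr) !scalerA.
by rewrite mulVf ?mulf_neq0 // !scale1r submxK.
Qed.

Lemma zeta_unit (mu nu : C) : mu != 0 -> nu != 0 -> Hset (zeta p q mu nu).
Proof. by move=> m0 n0; split; rewrite /= ?unitmx_inv unit_diag. Qed.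

End FamilyMembers.

Lemma zopen_of_subsp (K : fieldType) T (M : cspace K T) (A U : set T) :
  ringed M -> zopen M A -> zopen (subsp M A) U -> zopen M (A `&` U).
Proof.
move=> rM oA oU; apply: zopen_nonvanishing => // x Mx [Ax Ux].
have [a [ra ax aA]] := regat_indicator oA Mx Ax.
have [f rf ef] := oU x (conj Mx Ax) Ux.
exists (fun y => a y * f y); split; first exact: (regat_mul rM).
  by rewrite mulf_neq0 // -ef // mem_set // oner_neq0.
move=> y My; rewrite mulf_eq0 negb_or => /andP[/aA Ay fy]; split=> //.
by move: fy; rewrite -ef //; case: (boolP (y \in U)) => [/set_mem // | _]; rewrite eqxx.
Qed.

Lemma zclosure_morphism (K : fieldType) T S (M : cspace K T) (N : cspace K S) f
    (A : set T) (B : set S) x :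
  morphism M N f -> (forall a, dom M a -> A a -> B (f a)) -> zclosure M A x ->
  zclosure N B (f x).
Proof.
move=> mf AB [Mx cx]; split; first by have [] := mf x Mx.
move=> U oU Ux; have [a [Ma Aa Ua]] := cx _ (zopen_preimage mf oU) Ux.
by exists (f a); split=> //; [have [] := mf a Ma|exact: AB].
Qed.

(** * The base and total spaces of the family *)

Section FamilyGeometry.
Variables (K : fieldType) (p q : nat).
Local Notation g := 'M[K]_(q + p).
Local Notation h := ('M[K]_(q + p) * 'M[K]_(q + p))%type.
Local Notation d := (\dim {: g}).
Local Notation Gr := (grass d h).
Implicit Types (c : K * K) (X Y : g) (w : h) (W : {vspace h}) (B : {ffun 'I_d -> h}).

Section Regularity.
Variables (T : Type) (M : cspace K T) (x : T).
Hypotheses (rM : ringed M) (Mx : dom M x).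

Lemma morph_at_h (f : T -> h) :
  mxreg M x (fun y => (f y).1) -> mxreg M x (fun y => (f y).2) ->
  morph_at M (aff h) f x.
Proof.
move=> /(mxregP rM Mx) r1 /(mxregP rM Mx) r2.
apply: (morph_at_ext rM Mx _ (morph_at_aff_pair rM Mx r1 r2)) => y _.
by case: (f y).
Qed.

Lemma mxreg_h (f : T -> h) : morph_at M (aff h) f x ->
  mxreg M x (fun y => (f y).1) /\ mxreg M x (fun y => (f y).2).
Proof.
move=> mf; split; apply/(mxregP rM Mx).
  exact: (morph_at_linear rM Mx (fst : {linear h -> g}) mf).
exact: (morph_at_linear rM Mx (snd : {linear h -> g}) mf).
Qed.

Lemma morph_at_Tab (c : T -> K * K) (X : T -> g) :
  regat M x (fun y => (c y).1) -> regat M x (fun y => (c y).2) -> mxreg M x X ->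
  morph_at M (aff h) (fun y => Tab (c y) (X y)) x.
Proof.
move=> r1 r2 rX; apply: morph_at_h => /=; apply: mxreg_block => //;
  by [exact: mxreg_ulsub | exact: mxreg_drsub | apply: mxreg_scale => //; exact: mxreg_ursub
     | apply: mxreg_scale => //; exact: mxreg_dlsub].
Qed.

Lemma morph_at_Lam e (f : T -> h) : morph_at M (aff h) f x ->
  mxreg M x (fun y => Lam e (f y)).
Proof.
move=> mf; apply/(mxregP rM Mx).
exact: (morph_at_linear rM Mx (@Lam K p q e : {linear h -> g}) mf).
Qed.

Lemma regat_cab e (t : T -> K) : regat M x t ->
  regat M x (fun y => (cab e (t y)).1) /\ regat M x (fun y => (cab e (t y)).2).
Proof. by move=> rt; case: e; split=> //; exact: (regat_cst rM). Qed.

End Regularity.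

(** A fixed basis of g transported by [Tab c]. This frame of W_c is polynomial in c, which makes c
    |-> W_c a morphism to the Grassmannian. *)
Definition frame_of c : {ffun 'I_d -> h} :=
  [ffun i : 'I_d => Tab c (vbasis {: g})`_i].

Lemma span_frame_of c : <<codom (frame_of c)>>%VS = Wab p q c.
Proof.
apply/vspaceP => w; apply/idP/idP => [/span_frameP[k ->]|/mem_WabP[X ->]].
  by apply: memv_suml => i _; rewrite ffunE memvZ // mem_Tab.
apply/span_frameP; exists (fun i => coord (vbasis {: g}) i X).
rewrite {1}(coord_vbasis (memvf X)) Tab_sum; apply: eq_bigr => i _.
by rewrite TabZ ffunE.
Qed.

Lemma free_frame_of c : c != 0 -> free (codom (frame_of c)).
Proof.
move=> c0; rewrite /free size_codom card_ord span_frame_of.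
by rewrite dim_Wab.
Qed.

Lemma dom_Gr_Wab c : c != 0 -> dom Gr (Wab p q c).
Proof. by move=> c0; apply/dom_grassP; exact: dim_Wab. Qed.

Lemma ringed_Gr : ringed Gr.
Proof. exact: ringed_grass. Qed.

Lemma morph_at_Wab T (M : cspace K T) (c : T -> K * K) x :
  ringed M -> dom M x -> (forall y, dom M y -> c y != 0) ->
  regat M x (fun y => (c y).1) -> regat M x (fun y => (c y).2) ->
  morph_at M Gr (fun y => Wab p q (c y)) x.
Proof.
move=> rM Mx c0 r1 r2.
apply: (morph_at_ext rM Mx (f' := fun y => <<codom (frame_of (c y))>>%VS)).
  by move=> y _; rewrite span_frame_of.
apply: (morph_at_grass rM Mx).
  by move=> y /c0; exact: free_frame_of.
move=> i; apply: (morph_at_ext rM Mx (f' := fun y => Tab (c y) (vbasis {: g})`_i)).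
  by move=> y _; rewrite ffunE.
by apply: morph_at_Tab => //; exact: mxreg_cst.
Qed.

Section Chart.
Variables (i0 : 'I_q) (j0 : 'I_p).

(** An off-diagonal matrix unit: the two components of [Tab c E0] carry the scalars c.1 and c.2 at
    the entry (i0, j0), so that c can be recovered from W_c. Its existence is where p, q >= 1
    enters. *)
Definition E0 : g := block_mx 0 (delta_mx i0 j0) 0 0.

Lemma E0_neq0 : E0 != 0.
Proof.
apply/eqP => /(congr1 (fun A : g => ursubmx A i0 j0)) /eqP.
by rewrite block_mxKur !mxE !eqxx oner_eq0.
Qed.

Definition tau (e : bool) w : K^o := if e then ursubmx w.2 i0 j0 else ursubmx w.1 i0 j0.

Fact tau_linear e : linear (tau e).
Proof. by case: e => a u v; rewrite /tau /= !mxE. Qed.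
HB.instance Definition _ e := GRing.isLinear.Build K h K^o _ (tau e) (tau_linear e).

(* The coordinate t of the point W_(t : 1) or W_(1 : t), extended to an open
   subset [Vset e] of the Grassmannian. *)
Definition Tco (e : bool) W : K := tau e (xget 0 [set w : h | w \in W /\ Lam e w = E0]).

(** The subspaces that meet the kernel of [Lam e] trivially, that is, a standard affine chart of the
    Grassmannian. *)
Definition Vset (e : bool) : set {vspace h} :=
  [set W : {vspace h} | forall w : h, w \in W -> Lam e w = 0 -> w = 0].

Lemma Vset_Wab e t : Vset e (Wab p q (cab e t)).
Proof. by move=> w /mem_WabP[X ->]; rewrite LamK => ->; rewrite Tab0. Qed.

Lemma Tco_eq e W w : Vset e W -> w \in W -> Lam e w = E0 -> Tco e W = tau e w.
Proof.
move=> VW wW wE; rewrite /Tco; congr tau; apply: xget_unique => // u [uW uE].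
apply/eqP; rewrite -subr_eq0; apply/eqP; apply: VW; first exact: rpredB.
by rewrite LamB uE wE subrr.
Qed.

Lemma Tco_Wab e t : Tco e (Wab p q (cab e t)) = t.
Proof.
rewrite (@Tco_eq e _ (Tab (cab e t) E0) (@Vset_Wab e t) (mem_Tab _ _)) ?LamK //.
by case: e; rewrite /tau /Tab /= block_mxKur block_mxKur !mxE !eqxx mulr1.
Qed.

(** The matrix of [Lam e] in the frame [B]; its determinant cuts out the complement of [Vset e] on
    frames. *)
Definition Mco (e : bool) (B : {ffun 'I_d -> h}) : 'M[K]_d :=
  \matrix_(i, j) coord (vbasis {: g}) j (Lam e (B i)).

Lemma mul_Mco e B (k : 'rV[K]_d) j :
  (k *m Mco e B) 0 j = coord (vbasis {: g}) j (Lam e (\sum_i k 0 i *: B i)).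
Proof.
rewrite Lam_sum linear_sum mxE; apply: eq_bigr => i _.
by rewrite LamZ linearZ mxE.
Qed.

Lemma coord_g_inj X Y :
  (forall j, coord (vbasis {: g}) j X = coord (vbasis {: g}) j Y) -> X = Y.
Proof.
move=> e; rewrite (coord_vbasis (memvf X)) (coord_vbasis (memvf Y)).
by apply: eq_bigr => i _; rewrite e.
Qed.

Lemma Mco_unit e B : free (codom B) -> Mco e B \in unitmx <-> Vset e <<codom B>>%VS.
Proof.
move=> /free_frameP fB; split=> [uM w /span_frameP[k ->] L0|VB].
  pose k' : 'rV[K]_d := \row_i k i.
  have k'0 : k' *m Mco e B = 0.
    apply/rowP => j; rewrite mul_Mco [RHS]mxE -[RHS](linear0 (coord (vbasis {: g}) j)).
    by rewrite -L0; congr (coord _ _ (Lam _ _)); apply: eq_bigr => i _; rewrite mxE.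
  have k0 : k' = 0 by rewrite -[k'](mulmxK uM) k'0 mul0mx.
  rewrite big1 // => i _; suff -> : k i = 0 by rewrite scale0r.
  by have := congr1 (fun A : 'rV_d => A 0 i) k0; rewrite !mxE.
rewrite -row_free_unit; apply: inj_row_free => k k0; apply/rowP => i.
rewrite [RHS]mxE; apply: (fB (fun i => k 0 i)); apply: VB.
  by apply/span_frameP; exists (fun i => k 0 i).
apply: coord_g_inj => j; rewrite -mul_Mco k0 linear0 [LHS]mxE //.
Qed.

Lemma mxreg_Mco e B : free (codom B) -> mxreg (frames d h) B (Mco e).
Proof.
move=> fB i j; have rf : ringed (frames d h) by exact: ringed_frames.
have Bf : dom (frames d h) B by split.
have m1 := morph_at_linear rf Bf (@Lam K p q e : {linear h -> g}) (frame_coord_regat B i).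
have := regat_scalar rf Bf (morph_at_linear rf Bf (coord (vbasis {: g}) j : {linear g -> K^o}) m1).
by move/(regat_ext rf Bf); apply=> y _; rewrite mxE.
Qed.

Lemma zopen_Vset e : zopen Gr (Vset e).
Proof.
move=> W _ VW B [_ fB] BW; have rf : ringed (frames d h) by exact: ringed_frames.
have Bf : dom (frames d h) B by split.
apply: (regat_near rf Bf (regat_det rf Bf (mxreg_Mco e fB)) _ (regat_cst rf 1 Bf)).
  by have := (Mco_unit e fB).2; rewrite BW unitmxE unitfE; apply.
move=> B' [_ fB'] dB' /=; rewrite mem_set //; apply/(Mco_unit e fB').
by rewrite unitmxE unitfE.
Qed.

Lemma regat_Tco e W : dom Gr W -> Vset e W -> regat Gr W (Tco e).
Proof.
move=> _ VW B [_ fB] BW; have rf : ringed (frames d h) by exact: ringed_frames.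
have Bf : dom (frames d h) B by split.
have uM : Mco e B \in unitmx by apply/(Mco_unit e fB); rewrite BW.
(* [k] solves the linear system for the vector of W that [Lam e] maps to [E0], in the frame;
   applying [tau] to that vector gives the coordinate. *)
pose r : 'rV[K]_d := \row_j coord (vbasis {: g}) j E0.
pose k B := r *m invmx (Mco e B).
have rk : mxreg (frames d h) B k.
  by apply: mxreg_mul => //; [exact: mxreg_cst|apply: mxreg_inv => //; exact: mxreg_Mco].
have rt i : regat (frames d h) B (fun B' => tau e (B' i)).
  exact: (regat_scalar rf Bf (morph_at_linear rf Bf (tau e : {linear h -> K^o})
    (frame_coord_regat B i))).
have rs : regat (frames d h) B (fun B' => \sum_i k B' 0 i * tau e (B' i)).
  by apply: regat_sum => // i; exact: (regat_mul rf Bf).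
apply: (regat_near rf Bf (regat_det rf Bf (mxreg_Mco e fB)) _ rs).
  by move: uM; rewrite unitmxE unitfE.
move=> B' [_ fB'] dB' /=.
have uM' : Mco e B' \in unitmx by rewrite unitmxE unitfE.
rewrite (@Tco_eq e _ (\sum_i k B' 0 i *: B' i)).
- by rewrite linear_sum; apply: eq_bigr => i _; rewrite linearZ.
- exact/(Mco_unit e fB').
- by apply/span_frameP; exists (fun i => k B' 0 i).
- by apply: coord_g_inj => j; rewrite -mul_Mco /k mulmxKV // mxE.
Qed.

(** If the coordinate of c that is normalized to 1 in the chart [e] were zero, [Lam e] would kill
    the nonzero vector [Tab c E0]. *)
Lemma Vset_chart e c : c != 0 -> Vset e (Wab p q c) ->
  exists t, Wab p q c = Wab p q (cab e t).
Proof.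
case: c => a b c0 Vc.
have nz : (if e then a else b) != 0.
  apply/eqP => z; have /eqP := E0_neq0; apply.
  apply: (Tab_inj c0); rewrite Tab0; apply: Vc; first exact: mem_Tab.
  rewrite /E0 TabE; case: e z => /= ->; rewrite /Lam /= !(block_mxKul, block_mxKur, block_mxKdl, block_mxKdr);
  by rewrite scale0r scaler0 block_mx0.
case: e {Vc} nz => nz.
  exists (b / a); rewrite -(Wab_scale p q (cab true (b / a)) nz) /=; congr (Wab _ _ (_, _)).
    by rewrite mulr1.
  by rewrite mulrC divfK.
exists (a / b); rewrite -(Wab_scale p q (cab false (a / b)) nz) /=; congr (Wab _ _ (_, _)).
  by rewrite mulrC divfK.
by rewrite mulr1.
Qed.

End Chart.

(** The equations of [mem_Wab_eqs] gathered in one matrix, polynomial in c and w jointly: membership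
    in W_c is a closed condition on pairs. *)
Definition defect c w : g :=
  block_mx (ulsubmx w.1 - ulsubmx w.2) (c.2 *: ursubmx w.1 - c.1 *: ursubmx w.2)
           (c.2 *: dlsubmx w.2 - c.1 *: dlsubmx w.1) (drsubmx w.1 - drsubmx w.2).

Lemma mem_Wab_defect c w : c != 0 -> (w \in Wab p q c) = (defect c w == 0).
Proof.
move=> c0; apply/idP/idP => [/(mem_Wab_eqs _ c0)[e1 e2 e3 e4]|].
  by rewrite /defect e1 e2 e3 e4 !subrr block_mx0.
rewrite block_mx_eq0 !subr_eq0 => /and4P[/eqP e1 /eqP e3 /eqP e4 /eqP e2].
by apply/mem_Wab_eqs.
Qed.

Lemma mxreg_defect T (M : cspace K T) x (c : T -> K * K) (f : T -> h) :
  ringed M -> dom M x ->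
  regat M x (fun y => (c y).1) -> regat M x (fun y => (c y).2) ->
  morph_at M (aff h) f x -> mxreg M x (fun y => defect (c y) (f y)).
Proof.
move=> rM Mx r1 r2 /(mxreg_h rM Mx)[f1 f2].
apply: mxreg_block => //; apply: mxreg_add => //; try apply: mxreg_opp => //;
  try (apply: mxreg_scale => //);
  by [exact: mxreg_ulsub|exact: mxreg_ursub|exact: mxreg_dlsub|exact: mxreg_drsub].
Qed.

(** On W_c, [offdiag1] is c.1 times, and [offdiag2] is c.2 times, the off-diagonal part of the
    coordinate matrix, while [diagdiff] vanishes. *)
Definition offdiag1 w : g := block_mx 0 (ursubmx w.1) (dlsubmx w.2) 0.
Definition offdiag2 w : g := block_mx 0 (ursubmx w.2) (dlsubmx w.1) 0.
Definition diagdiff w : g := block_mx (ulsubmx w.1 - ulsubmx w.2) 0 0 (drsubmx w.1 - drsubmx w.2).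

Fact offdiag1_linear : linear offdiag1.
Proof.
move=> a [w1 w2] [u1 u2]; rewrite -[w1]submxK -[w2]submxK -[u1]submxK -[u2]submxK.
by rewrite /offdiag1 /= !(scale_block_mx, add_block_mx, block_mxKul, block_mxKur,
  block_mxKdl, block_mxKdr, scaler0, addr0).
Qed.
Fact offdiag2_linear : linear offdiag2.
Proof.
move=> a [w1 w2] [u1 u2]; rewrite -[w1]submxK -[w2]submxK -[u1]submxK -[u2]submxK.
by rewrite /offdiag2 /= !(scale_block_mx, add_block_mx, block_mxKul, block_mxKur,
  block_mxKdl, block_mxKdr, scaler0, addr0).
Qed.
Fact diagdiff_linear : linear diagdiff.
Proof.
move=> a [w1 w2] [u1 u2]; rewrite -[w1]submxK -[w2]submxK -[u1]submxK -[u2]submxK.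
rewrite /diagdiff /= !(scale_block_mx, add_block_mx, block_mxKul, block_mxKur,
  block_mxKdl, block_mxKdr, scaler0, addr0) !scalerBr !opprD.
by congr block_mx; exact: addrACA.
Qed.

(* Equations, quadratic in a basis of W, for W to be contained in some [Wab c]. *)
Definition pencil : set {vspace h} := [set W : {vspace h} |
  (forall w : h, w \in W -> diagdiff w = 0) /\
  (forall (w w' : h) i j k l, w \in W -> w' \in W ->
     offdiag1 w i j * offdiag2 w' k l = offdiag2 w i j * offdiag1 w' k l)].

Lemma offdiag1_Tab c X : offdiag1 (Tab c X) = c.1 *: block_mx 0 (ursubmx X) (dlsubmx X) 0.
Proof.
by rewrite /offdiag1 /Tab /= !(block_mxKul, block_mxKur, block_mxKdl, block_mxKdr) scale_block_mx !scaler0.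
Qed.

Lemma offdiag2_Tab c X : offdiag2 (Tab c X) = c.2 *: block_mx 0 (ursubmx X) (dlsubmx X) 0.
Proof.
by rewrite /offdiag2 /Tab /= !(block_mxKul, block_mxKur, block_mxKdl, block_mxKdr) scale_block_mx !scaler0.
Qed.

Lemma pencil_Wab c : pencil (Wab p q c).
Proof.
split=> [w /mem_WabP[X ->]|w w' i j k l /mem_WabP[X ->] /mem_WabP[Y ->]].
  by rewrite /diagdiff /Tab /= !(block_mxKul, block_mxKur, block_mxKdl, block_mxKdr) !subrr block_mx0.
by rewrite !offdiag1_Tab !offdiag2_Tab !(mxE _ _ i j) !(mxE _ _ k l); ring.
Qed.

(** The quadratic equations say that all pairs (entry of [offdiag1], entry of [offdiag2]) are
    proportional, so any nonzero such pair serves as c. *)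
Lemma pencil_sub W : pencil W -> exists2 c, c != 0 & (W <= Wab p q c)%VS.
Proof.
move=> [dW oW].
case: (pselect (exists w i j, w \in W /\ (offdiag1 w i j, offdiag2 w i j) != 0)).
  move=> [w0 [i [j [w0W c0]]]].
  exists (offdiag1 w0 i j, offdiag2 w0 i j) => //; apply/subvP => w wW.
  apply/(mem_Wab_eqs _ c0) => /=.
  have /eqP := dW w wW; rewrite block_mx_eq0 !subr_eq0 => /and4P[/eqP-> _ _ /eqP->].
  have e : offdiag2 w0 i j *: offdiag1 w = offdiag1 w0 i j *: offdiag2 w.
    by apply/matrixP => k l; rewrite [LHS]mxE [RHS]mxE oW.
  split=> //; first by have := congr1 ursubmx e; rewrite !scale_block_mx !block_mxKur.
  by have := congr1 dlsubmx e; rewrite !scale_block_mx !block_mxKdl.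
move=> n; have z w i j : w \in W -> offdiag1 w i j = 0 /\ offdiag2 w i j = 0.
  move=> wW; case: (eqVneq (offdiag1 w i j, offdiag2 w i j) 0) => [[]//|c0].
  by exfalso; apply: n; exists w, i, j.
(* Here all off-diagonal blocks vanish on W, so W lies in every W_c. *)
exists (1, 0); first by apply/eqP => -[/eqP]; rewrite oner_eq0.
apply/subvP => w wW; apply/mem_Wab_eqs => /=.
  by apply/eqP => -[/eqP]; rewrite oner_eq0.
have /eqP := dW w wW; rewrite block_mx_eq0 !subr_eq0 => /and4P[/eqP-> _ _ /eqP->].
have e1 : offdiag1 w = 0 by apply/matrixP => i j; rewrite (z w i j wW).1 mxE.
have e2 : offdiag2 w = 0 by apply/matrixP => i j; rewrite (z w i j wW).2 mxE.
rewrite !scale0r !scale1r; split=> //; apply/esym.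
  by have := congr1 ursubmx e2; rewrite block_mxKur -(block_mx0 _ _ _ _) block_mxKur.
by have := congr1 dlsubmx e2; rewrite block_mxKdl -(block_mx0 _ _ _ _) block_mxKdl.
Qed.

Lemma zclosed_pencil : zclosed Gr pencil.
Proof.
move=> W _ nW B [_ fB] BW; have rf : ringed (frames d h) by exact: ringed_frames.
have Bf : dom (frames d h) B by split.
suff [u [ru uB uP]] : exists u, [/\ regat (frames d h) B u, u B != 0 &
    forall B', u B' != 0 -> ~ pencil <<codom B'>>%VS].
  apply: (regat_near rf Bf ru uB (regat_cst rf 1 Bf)) => B' _ uB' /=.
  by rewrite mem_set //; exact: uP.
have hB i : mxreg (frames d h) B (fun B' => (B' i).1) /\
            mxreg (frames d h) B (fun B' => (B' i).2).
  exact: (mxreg_h rf Bf (frame_coord_regat B i)).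
have r0 m n : mxreg (frames d h) B (fun=> 0 : 'M[K]_(m, n)) by exact: mxreg_cst.
have o1 i : mxreg (frames d h) B (fun B' => offdiag1 (B' i)).
  have [h1 h2] := hB i; apply: mxreg_block => //; [exact: mxreg_ursub|exact: mxreg_dlsub].
have o2 i : mxreg (frames d h) B (fun B' => offdiag2 (B' i)).
  have [h1 h2] := hB i; apply: mxreg_block => //; [exact: mxreg_ursub|exact: mxreg_dlsub].
have dd i : mxreg (frames d h) B (fun B' => diagdiff (B' i)).
  have [h1 h2] := hB i; apply: mxreg_block => //; apply: mxreg_add => //;
  by [exact: mxreg_ulsub|exact: mxreg_drsub|apply: mxreg_opp => //; exact: mxreg_ulsub
     |apply: mxreg_opp => //; exact: mxreg_drsub].
(* If no regular function separated [B] from the pencil, all the equations would hold on the vectors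
   of the frame, hence on their span by linearity in each argument. *)
apply: contrapT => nu; apply: nW; rewrite -BW.
have dB i : diagdiff (B i) = 0.
  apply/matrixP => k l; rewrite [RHS]mxE.
  case: (eqVneq (diagdiff (B i) k l) 0) => // z; exfalso; apply: nu.
  exists (fun B' => diagdiff (B' i) k l); split=> //; first exact: dd.
  by move=> B' + [dP _]; rewrite dP ?mem_frame // mxE eqxx.
pose D i1 i2 i j k l (B' : {ffun 'I_d -> h}) :=
  offdiag1 (B' i1) i j * offdiag2 (B' i2) k l - offdiag2 (B' i1) i j * offdiag1 (B' i2) k l.
have oB i1 i2 i j k l : D i1 i2 i j k l B = 0.
  case: (eqVneq (D i1 i2 i j k l B) 0) => // z; exfalso; apply: nu.
  exists (D i1 i2 i j k l); split=> //.
    exact: (regat_sub rf Bf (regat_mul rf Bf (o1 i1 i j) (o2 i2 k l))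
      (regat_mul rf Bf (o2 i1 i j) (o1 i2 k l))).
  by move=> B' + [_ oP]; rewrite /D oP ?mem_frame // subrr eqxx.
have sum1 (k : 'I_d -> K) : offdiag1 (\sum_i k i *: B i) = \sum_i k i *: offdiag1 (B i).
  pose L : {linear h -> g} := HB.pack offdiag1 (GRing.isLinear.Build _ _ _ _ offdiag1 offdiag1_linear).
  by rewrite -[offdiag1]/(L : h -> g) linear_sum; apply: eq_bigr => i _; rewrite linearZ.
have sum2 (k : 'I_d -> K) : offdiag2 (\sum_i k i *: B i) = \sum_i k i *: offdiag2 (B i).
  pose L : {linear h -> g} := HB.pack offdiag2 (GRing.isLinear.Build _ _ _ _ offdiag2 offdiag2_linear).
  by rewrite -[offdiag2]/(L : h -> g) linear_sum; apply: eq_bigr => i _; rewrite linearZ.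
have sumd (k : 'I_d -> K) : diagdiff (\sum_i k i *: B i) = \sum_i k i *: diagdiff (B i).
  pose L : {linear h -> g} := HB.pack diagdiff (GRing.isLinear.Build _ _ _ _ diagdiff diagdiff_linear).
  by rewrite -[diagdiff]/(L : h -> g) linear_sum; apply: eq_bigr => i _; rewrite linearZ.
split=> [w /span_frameP[k ->]|w w' i j k l /span_frameP[a ->] /span_frameP[b ->]].
  by rewrite sumd big1 // => i _; rewrite dB scaler0.
rewrite !sum1 !sum2 !summxE !big_distrlr /=; apply: eq_bigr => i1 _; apply: eq_bigr => i2 _.
have sc (u : K) (A : g) r s : (u *: A) r s = u * A r s by rewrite mxE.
have mm (u v x y z t : K) : x * y = z * t -> (u * x) * (v * y) = (u * z) * (v * t).
  by move=> e; rewrite mulrACA e mulrACA.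
rewrite [X in X * _ = _]sc [X in _ * X = _]sc [X in _ = X * _]sc [X in _ = _ * X]sc.
apply: mm; by have /eqP := oB i1 i2 i j k l; rewrite subr_eq0 => /eqP.
Qed.

End FamilyGeometry.

Lemma morph_regat (K : fieldType) T S (M : cspace K T) (N : cspace K S) f x u :
  morph_at M N f x -> regat N (f x) u -> regat M x (fun y => u (f y)).
Proof. by move=> [_ rf] /rf. Qed.

Section FamilySpace.
Variables (K : fieldType) (p q : nat).
Local Notation g := 'M[K]_(q + p).
Local Notation h := ('M[K]_(q + p) * 'M[K]_(q + p))%type.
Local Notation d := (\dim {: g}).
Local Notation Gr := (grass d h).
Implicit Types (c : K * K) (X Y : g) (w : h) (W : {vspace h}).

Definition base_points : set {vspace h} :=
  [set W | exists c, c != 0 /\ W = Wab p q c].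
Definition open_base_points : set {vspace h} :=
  [set W | exists c, [/\ c.1 != 0, c.2 != 0 & W = Wab p q c]].
Definition Hsp : cspace K h := subsp (aff h) (@punit K p q).
Definition GrHsp : cspace K ({vspace h} * h)%type := prodsp Gr Hsp.
Definition total_points : set ({vspace h} * h) :=
  [set y | base_points y.1 /\ (y.2 \in y.1 /\ punit y.2)].
Definition open_total_points : set ({vspace h} * h) :=
  [set y | exists c, [/\ c.1 != 0, c.2 != 0, y.1 = Wab p q c, y.2 \in Wab p q c & punit y.2]].
Definition base_space : cspace K {vspace h} := subsp Gr base_points.
Definition total_space : cspace K ({vspace h} * h)%type := subsp GrHsp total_points.

Lemma base_chart W : base_points W -> exists e t, W = Wab p q (cab e t).
Proof. by move=> [c [/(Wab_chart p q)[e [t [-> _]]] ->]]; exists e, t. Qed.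

Lemma base_points_chart e t : base_points (Wab p q (cab e t)).
Proof. by exists (cab e t); rewrite cab_neq0. Qed.

Lemma ringed_Hsp : ringed Hsp. Proof. by apply: ringed_subsp; exact: ringed_aff. Qed.
Lemma ringed_GrHsp : ringed GrHsp.
Proof. by apply: ringed_prodsp; [exact: ringed_Gr|exact: ringed_Hsp]. Qed.
Lemma ringed_base : ringed base_space.
Proof. by apply: ringed_subsp; exact: ringed_Gr. Qed.
Lemma ringed_total : ringed total_space.
Proof. by apply: ringed_subsp; exact: ringed_GrHsp. Qed.

Lemma base_points_Gr W : base_points W -> dom Gr W.
Proof. by move=> [c [c0 ->]]; exact: dom_Gr_Wab. Qed.

Lemma dom_base W : base_points W -> dom base_space W.
Proof. by move=> bW; split=> //; exact: base_points_Gr. Qed.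

Lemma dom_total y : total_points y -> dom total_space y.
Proof. by move=> ty; case: (ty) => by1 [_ uy]; split=> //; split=> //; exact: base_points_Gr. Qed.

Lemma to_base T (M : cspace K T) f x : ringed M -> dom M x ->
  (forall y, dom M y -> base_points (f y)) -> morph_at M Gr f x ->
  morph_at M base_space f x.
Proof.
by move=> rM Mx bf mf; apply: (morph_at_subcod rM Mx) => // y My; apply: dom_base; exact: bf.
Qed.

Lemma to_total T (M : cspace K T) (f : T -> {vspace h} * h) x : ringed M -> dom M x ->
  (forall y, dom M y -> total_points (f y)) ->
  morph_at M Gr (fun y => (f y).1) x -> morph_at M (aff h) (fun y => (f y).2) x ->
  morph_at M total_space f x.
Proof.
move=> rM Mx tf m1 m2; apply: (morph_at_subcod rM Mx).
  by move=> y My; apply: dom_total; exact: tf.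
apply: (morph_at_ext rM Mx (f' := fun y => ((f y).1, (f y).2))).
  by move=> y _; case: (f y).
apply: (morph_at_pair rM Mx) => //.
  by move=> y /tf /dom_total[[]].
by apply: (morph_at_subcod rM Mx) => // y /tf /dom_total[[]].
Qed.

Lemma total_fst_Gr y : dom total_space y -> morph_at total_space Gr fst y.
Proof.
move=> [[Gy Hy] _]; apply: morph_at_subdom; apply: morph_at_fst => //; [exact: ringed_Gr|exact: ringed_Hsp].
Qed.

Lemma total_snd y : dom total_space y -> morph_at total_space (aff h) snd y.
Proof.
move=> [[Gy Hy] _]; apply: morph_at_subdom; apply: (@morph_at_subcodW _ _ _ _ _ (@punit K p q)).
by apply: morph_at_snd => //; [exact: ringed_Gr|exact: ringed_Hsp].
Qed.

Lemma total_fst : morphism total_space base_space fst.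
Proof.
move=> y Ey; apply: to_base => //; first exact: ringed_total.
  by move=> y' [_ []].
exact: total_fst_Gr.
Qed.

Lemma base_to_Gr W : dom base_space W -> morph_at base_space Gr id W.
Proof. by move=> [GW _]; exact: morph_at_incl. Qed.

Lemma zopen_Vset_base e : zopen base_space (@Vset K p q e).
Proof. by apply: zopen_subsp; exact: zopen_Vset. Qed.

Lemma zopen_Vset_total e : zopen total_space [set y | @Vset K p q e y.1].
Proof. exact: (zopen_preimage total_fst (@zopen_Vset_base e)). Qed.

Section WithEntry.
Variables (i0 : 'I_q) (j0 : 'I_p).
Local Notation Tco := (Tco i0 j0).

Lemma Vset_base_chart e W : base_points W -> Vset e W ->
  W = Wab p q (cab e (Tco e W)).
Proof.
move=> [c [c0 ->]] /(Vset_chart i0 j0 c0)[t ->].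
by rewrite Tco_Wab.
Qed.

Lemma regat_Tco_base e W : dom base_space W -> Vset e W -> regat base_space W (Tco e).
Proof.
move=> dW VW; have r : regat Gr (id W) (Tco e) by apply: regat_Tco => //; case: dW.
exact: (morph_regat (base_to_Gr dW) r).
Qed.

Lemma regat_Tco_total e y : dom total_space y -> Vset e y.1 ->
  regat total_space y (fun y => Tco e y.1).
Proof.
move=> dy Vy; have m := total_fst dy.
have r : regat base_space y.1 (Tco e) by apply: regat_Tco_base => //; case: m.
exact: (morph_regat m r).
Qed.

(** The pencil is closed and contains the open part, and a subspace of the right dimension contained
    in some W_c equals it. Conversely every W_c lies on a line s |-> W_(cab e s), where each
    neighbourhood contains some s <> 0. *)
Lemma closure_base : infinite_field K -> zclosure Gr open_base_points = base_points.
Proof.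
move=> infK; apply/seteqP; split=> W.
  move=> [GW cW]; have pW : pencil W.
    apply: contrapT => nW.
    have [a [_ [c [_ _ ->]]]] := cW _ (@zclosed_pencil K p q) nW.
    by apply; exact: pencil_Wab.
  have [c c0 sW] := pencil_sub pW; exists c; split=> //.
  by apply/eqP; rewrite eqEdim sW dim_Wab // ((dom_grassP _ _).1 GW) leqnn.
move=> bW; split; first exact: base_points_Gr.
move=> U oU UW; have [e [t Wt]] := base_chart bW.
have m : morphism (aff K^o) Gr (fun s : K => Wab p q (cab e s)).
  move=> s _; have ra := @ringed_aff K K^o.
  have rs : regat (aff K^o) s (fun s : K => s).
    by apply: (regat_scalar ra) => //; exact: morph_at_id.
  have [r1 r2] := regat_cab ra (x := s) I e rs.
  by apply: morph_at_Wab => // y _; exact: cab_neq0.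
have Ut : ((fun s : K => Wab p q (cab e s)) @^-1` U) t by rewrite /preimage /= -Wt.
have [f [pf ft fU]] := (zopen_affE _).1 (zopen_preimage m oU) t Ut.
have pid : polyfun (@linear_forms K K^o) (fun s : K => s).
  by apply: polyfun_gen; exists (linfun (@idfun K^o)); apply/funext => s; rewrite lfunE.
have [s [fs s0]] := polyfun_common_nonzero infK pf pid ft (oner_neq0 K).
exists (Wab p q (cab e (s : K))); split; last exact: fU.
  by apply: dom_Gr_Wab; exact: cab_neq0.
by exists (cab e (s : K)); split=> //; case: (e) => //=; rewrite ?oner_neq0.
Qed.

Local Notation A := (K^o * g)%type.
Definition chart_dom e : set A := [set z : A | punit (Tab (cab e (z.1 : K)) z.2)].
Definition chart_sp e : cspace K A := subsp (aff A) (chart_dom e).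
Definition chart_map e (z : A) : {vspace h} * h :=
  (Wab p q (cab e (z.1 : K)), Tab (cab e (z.1 : K)) z.2).
Definition chart_inv e (y : {vspace h} * h) : A := (Tco e y.1, Lam e y.2).

Lemma ringed_chart e : ringed (chart_sp e).
Proof. by apply: ringed_subsp; exact: ringed_aff. Qed.

Lemma regat_A1 (z : A) : regat (aff A) z (fun z => z.1).
Proof.
have ra := @ringed_aff K A.
apply: (regat_scalar ra) => //.
exact: (morph_at_linear ra (x := z) I (fst : {linear A -> K^o}) (@morph_at_id _ _ (aff A) z I)).
Qed.

Lemma mxreg_A2 (z : A) : mxreg (aff A) z (fun z => z.2).
Proof.
have ra := @ringed_aff K A; apply/(mxregP ra) => //.
exact: (morph_at_linear ra (x := z) I (snd : {linear A -> g}) (@morph_at_id _ _ (aff A) z I)).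
Qed.

Lemma morph_at_chart_Tab e z : morph_at (aff A) (aff h) (fun z => Tab (cab e (z.1 : K)) z.2) z.
Proof.
have ra := @ringed_aff K A.
have [r1 r2] := regat_cab ra (x := z) I e (regat_A1 z).
by apply: morph_at_Tab => //; exact: mxreg_A2.
Qed.

Lemma zopen_punit T (M : cspace K T) (f : T -> h) : ringed M -> morphism M (aff h) f ->
  zopen M [set y | punit (f y)].
Proof.
move=> rM mf; apply: zopen_nonvanishing => // x Mx [u1 u2].
have [r1 r2] := mxreg_h rM Mx (mf x Mx).
exists (fun y => \det (f y).1 * \det (f y).2); split.
- by apply: (regat_mul rM Mx); exact: regat_det.
- by rewrite mulf_neq0 // -unitfE -unitmxE.
- by move=> y _; rewrite mulf_eq0 negb_or -!unitfE -!unitmxE => /andP[].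
Qed.

Lemma zopen_chart e : zopen (aff A) (chart_dom e).
Proof.
apply: zopen_punit; first exact: ringed_aff.
by move=> z _; exact: morph_at_chart_Tab.
Qed.

Lemma chart_mapE e z : chart_dom e z -> total_points (chart_map e z).
Proof. by move=> uz; split; [exact: base_points_chart|split=> //=; exact: mem_Tab]. Qed.

Lemma chart_map_morph e : morphism (chart_sp e) total_space (chart_map e).
Proof.
move=> z [_ uz]; have rc := ringed_chart e.
apply: to_total => //.
- by move=> y [_ uy]; exact: chart_mapE.
- apply: morph_at_subdom; have ra := @ringed_aff K A.
  have [r1 r2] := regat_cab ra (x := z) I e (regat_A1 z).
  by apply: morph_at_Wab => // y _; exact: cab_neq0.
- by apply: morph_at_subdom; exact: morph_at_chart_Tab.
Qed.

Lemma chart_mapK e z : chart_inv e (chart_map e z) = z.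
Proof. by case: z => t X; rewrite /chart_inv /= Tco_Wab LamK. Qed.

Lemma chart_invK e y : total_points y -> Vset e y.1 -> chart_map e (chart_inv e y) = y.
Proof.
case: y => W w [/= bW [wW _]] VW; have eW := Vset_base_chart bW VW.
by rewrite /chart_map /= -eW; congr (_, _); apply: TabK; rewrite -eW.
Qed.

Lemma chart_inv_dom e y : total_points y -> Vset e y.1 -> chart_dom e (chart_inv e y).
Proof.
move=> ty Vy; rewrite /chart_dom /=; have /(congr1 snd) /= -> := chart_invK ty Vy.
by case: ty => _ [].
Qed.

Lemma chart_iso e :
  space_iso (chart_sp e) (subsp total_space [set y | Vset e y.1]) (chart_map e) (chart_inv e).
Proof.
have rt := ringed_total; have rtV : ringed (subsp total_space [set y | Vset e y.1]) by exact: ringed_subsp.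
split.
- move=> z Cz; apply: (morph_at_subcod (ringed_chart e) Cz); last exact: chart_map_morph.
  move=> y Cy; split; last exact: Vset_Wab.
  by have [] := chart_map_morph Cy.
- move=> y [Ey Vy]; apply: (morph_at_subcod rtV) => //.
    by move=> z [[_ tz] Vz]; split=> //; exact: chart_inv_dom.
  apply: morph_at_subdom; apply: (morph_at_aff_pair rt Ey).
    by apply: (morph_at_scalar rt Ey); exact: regat_Tco_total.
  apply/(mxregP rt Ey); apply: (morph_at_Lam rt Ey); exact: total_snd.
- by move=> z _; exact: chart_mapK.
- by move=> y [[_ ty] Vy]; exact: chart_invK.
Qed.

Lemma total_point_chart y : total_points y -> exists e z, chart_dom e z /\ y = chart_map e z.
Proof.
move=> ty; case: (ty) => [/base_chart[e [t e1]] [_ uy]].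
have Vy : Vset e y.1 by rewrite e1; exact: Vset_Wab.
by exists e, (chart_inv e y); rewrite chart_invK //; split=> //; exact: chart_inv_dom.
Qed.

Lemma zopen_chart_pullback e U : zopen total_space U ->
  zopen (aff A) (chart_dom e `&` chart_map e @^-1` U).
Proof.
move=> oU; apply: zopen_of_subsp; [exact: ringed_aff|exact: zopen_chart|].
exact: (zopen_preimage (@chart_map_morph e) oU).
Qed.

(** In a chart the open part is given by t <> 0, and a nonempty open subset of an affine space is
    not contained in t = 0. *)
Lemma open_total_dense U y : infinite_field K -> zopen total_space U ->
  total_points y -> U y ->
  exists2 y', U y' & open_total_points y'.
Proof.
move=> infK oU ty Uy; have [e [z [cz ez]]] := total_point_chart ty; subst y.
have [f [pf fz fU]] := (zopen_affE _).1 (zopen_chart_pullback (e := e) oU) z (conj cz Uy).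
have p1 : polyfun (@linear_forms K A) (fun z => z.1).
  apply: polyfun_gen; exists (linfun (fst : {linear A -> K^o})).
  by apply/funext => s; rewrite lfunE.
have [s [fs s0]] := polyfun_common_nonzero infK pf p1 fz (oner_neq0 K : (fun z : A => z.1) (1, 0) != 0).
have [cs Us] := fU s fs; exists (chart_map e s) => //.
exists (cab e (s.1 : K)); split=> //; try exact: mem_Tab;
by case: (e) => //=; rewrite oner_neq0.
Qed.

(** The open part lies in both charts, so its points can all be compared in one of them. *)
Lemma open_total_chart e y : open_total_points y -> exists2 z, chart_dom e z & y = chart_map e z.
Proof.
move=> [c [c1 c2 e1 yW uy]].
have c0 : c != 0 by apply: contraNneq c1 => ->.
have ty : total_points y by split; [exists c|rewrite e1].
have Vy : Vset e y.1.
  have -> : y.1 = Wab p q (cab e (if e then c.2 / c.1 else c.1 / c.2)).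
    rewrite e1; case: (c) c1 c2 => a b /= a0 b0; case: e.
      rewrite -(Wab_scale p q (cab true (b / a)) a0) /= mulr1.
      by congr (Wab _ _ (_, _)); rewrite mulrC divfK.
    rewrite -(Wab_scale p q (cab false (a / b)) b0) /= mulr1.
    by congr (Wab _ _ (_, _)); rewrite mulrC divfK.
  exact: Vset_Wab.
by exists (chart_inv e y); [exact: chart_inv_dom|rewrite chart_invK].
Qed.

(** By density of the open part, two nonempty open sets both meet the chart [false], which is an
    open subset of an affine space. *)
Lemma total_irreducible : infinite_field K -> irreducible_space total_space.
Proof.
move=> infK; split.
  exists (Wab p q (cab false 0), pone K p q); apply: dom_total; split; first exact: base_points_chart.
  by split; [exact: mem_pone|exact: punit1].
have key U : zopen total_space U -> (exists x, dom total_space x /\ U x) ->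
    exists z, (chart_dom false `&` chart_map false @^-1` U) z.
  move=> oU [y [[_ ty] Uy]].
  have [y' Uy' oy'] := open_total_dense infK oU ty Uy.
  have [z cz ez] := open_total_chart false oy'.
  by exists z; split=> //; rewrite /preimage /= -ez.
move=> U V oU oV /(key U oU)[z1 z1U] /(key V oV)[z2 z2V].
have [f [pf f1 fU]] := (zopen_affE _).1 (zopen_chart_pullback (e := false) oU) z1 z1U.
have [k [pk k1 kV]] := (zopen_affE _).1 (zopen_chart_pullback (e := false) oV) z2 z2V.
have [z [fz kz]] := polyfun_common_nonzero infK pf pk f1 k1.
have [cz Uz] := fU z fz; have [_ Vz] := kV z kz.
exists (chart_map false z); split=> //.
by apply: dom_total; exact: chart_mapE.
Qed.

(** A limit point lies over the base by projection, and its second component is invertible by the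
    choice of ambient space. Membership in W is obtained by contradiction, from an entry of [defect]
    that is nonzero near the point but vanishes on the open part. *)
Lemma closure_total : infinite_field K -> zclosure GrHsp open_total_points = total_points.
Proof.
move=> infK; apply/seteqP; split=> y; last first.
  move=> ty; split; first by case: (dom_total ty).
  move=> U oU Uy.
  have oU' : zopen total_space U by exact: zopen_subsp.
  have [y' Uy' oy'] := open_total_dense infK oU' ty Uy.
  have [z cz ez] := open_total_chart false oy'.
  exists y'; split=> //.
  by rewrite ez; case: (dom_total (chart_mapE cz)).
move=> cy; have [[Gy Hy] cU] := cy.
have rG := ringed_Gr K p q; have rH := ringed_Hsp; have rGH := ringed_GrHsp.
have by1 : base_points y.1.
  rewrite -(closure_base infK).
  apply: (@zclosure_morphism _ _ _ GrHsp Gr fst open_total_points open_base_points y _ _ cy).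
    by move=> z [z1 z2]; exact: morph_at_fst.
  by move=> a _ [c [c1 c2 e1 _ _]]; exists c.
split=> //; split; last by case: Hy.
have [e [t e1]] := base_chart by1.
have Vy : Vset e y.1 by rewrite e1; exact: Vset_Wab.
have ey := Vset_base_chart by1 Vy.
apply: contrapT => /negP; rewrite ey mem_Wab_defect ?cab_neq0 // => /eqP nd.
have [i [j nij]] : exists i j, defect (cab e (Tco e y.1)) y.2 i j != 0.
  apply: contrapT => n; apply: nd; apply/matrixP => i j; rewrite [RHS]mxE.
  by case: (eqVneq (defect (cab e (Tco e y.1)) y.2 i j) 0) => // nz; exfalso; apply: n; exists i, j.
pose D (z : {vspace h} * h) := defect (cab e (Tco e z.1)) z.2 i j.
have rV z : dom GrHsp z -> Vset e z.1 -> regat GrHsp z D.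
  move=> [Gz Hz] Vz; have Mz : dom GrHsp z by [].
  have rT : regat GrHsp z (fun z => Tco e z.1).
    have r : regat Gr z.1 (Tco e) by exact: regat_Tco.
    exact: (morph_regat (morph_at_fst rG rH Gz Hz) r).
  have [r1 r2] := regat_cab rGH Mz e rT.
  apply: (mxreg_defect rGH Mz r1 r2).
  by apply: (@morph_at_subcodW _ _ _ _ _ (@punit K p q)); exact: morph_at_snd.
have oU : zopen GrHsp [set z | Vset e z.1 /\ D z != 0].
  apply: zopen_nonvanishing => // z Mz [Vz Dz]; case: (Mz) => Gz Hz.
  have oV : zopen GrHsp [set z | Vset e z.1].
    apply: (zopen_preimage (f := fst) (N := Gr)); last exact: zopen_Vset.
    by move=> z' [? ?]; exact: morph_at_fst.
  have [w [rw wz wV]] := regat_indicator oV Mz Vz.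
  exists (fun z => w z * D z); split; first by apply: (regat_mul rGH Mz) => //; exact: rV.
    by rewrite mulf_neq0.
  by move=> z' _; rewrite mulf_eq0 negb_or => /andP[/wV ? ?].
have [a [_ [c [c1 c2 a1 a2 ua]] [Va Da]]] := cU _ oU (conj Vy nij).
have c0 : c != 0 by apply: contraNneq c1 => ->.
have ba : base_points a.1 by exists c.
have ea := Vset_base_chart ba Va.
have : a.2 \in Wab p q (cab e (Tco e a.1)) by rewrite -ea a1.
rewrite mem_Wab_defect ?cab_neq0 // => /eqP z.
by move: Da; rewrite /D z mxE eqxx.
Qed.

End WithEntry.
End FamilySpace.

(** * The base as a projective line *)

Section ProjectiveCoordinate.
Variables (K : fieldType) (p q : nat) (i0 : 'I_q) (j0 : 'I_p).
Local Notation g := 'M[K]_(q + p).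
Local Notation h := ('M[K]_(q + p) * 'M[K]_(q + p))%type.
Local Notation d := (\dim {: g}).
Local Notation Tco := (Tco i0 j0).
Local Notation base_points := (@base_points K p q).
Local Notation base_space := (base_space K p q).
Implicit Types (c : K * K) (X Y : g) (w : h) (W : {vspace h}) (v : 'rV[K]_2).

Definition rowc c : 'rV[K]_2 := \row_(j < 2) (if j == 0 then c.1 else c.2).
Definition colc v : K * K := (v 0 0, v 0 1).

Lemma rowcK : cancel rowc colc.
Proof. by case=> a b; rewrite /colc !mxE. Qed.
Lemma colcK : cancel colc rowc.
Proof.
move=> v; apply/rowP => j; rewrite mxE; case: eqP => [->//|/eqP j0'] /=.
by congr (v _ _); apply/val_inj; case: j j0' => -[|[|]].
Qed.
Lemma rowc_neq0 c : (rowc c != 0) = (c != 0).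
Proof.
have e : rowc 0 = 0 by apply/rowP => j; rewrite !mxE; case: ifP.
by rewrite -e (inj_eq (can_inj rowcK)).
Qed.
Lemma colc_neq0 v : (colc v != 0) = (v != 0).
Proof. by rewrite -rowc_neq0 colcK. Qed.
Lemma colcZ a v : colc (a *: v) = (a * (colc v).1, a * (colc v).2).
Proof. by rewrite /colc !mxE. Qed.

Lemma vpick_line n (v : 'rV[K]_n) : v != 0 -> exists2 a, a != 0 & vpick <[v]>%VS = a *: v.
Proof.
move=> v0; have /vlineP[a e] : vpick <[v]>%VS \in <[v]>%VS by exact: memv_pick.
exists a => //; apply/eqP => a0; have : vpick <[v]>%VS != 0.
  by rewrite vpick0 -dimv_eq0 dim_vline v0.
by rewrite e a0 scale0r eqxx.
Qed.

Lemma line_scale (V : vectType K) a (v : V) : a != 0 -> <[a *: v]>%VS = <[v]>%VS.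
Proof.
move=> a0; apply/vspaceP => w; apply/vlineP/vlineP => -[b ->].
  by exists (b * a); rewrite scalerA.
by exists (b / a); rewrite scalerA divfK.
Qed.

Definition point_of_line (L : {vspace 'rV[K]_2}) : {vspace h} := Wab p q (colc (vpick L)).

Lemma point_of_lineE v : v != 0 -> point_of_line <[v]>%VS = Wab p q (colc v).
Proof.
move=> v0; have [a a0 e] := vpick_line v0.
by rewrite /point_of_line e colcZ Wab_scale.
Qed.

(** On W_c this map has rank one with image the line of c, so the homogeneous coordinate of a point
    of the base is a linear image of the subspace. *)
Definition projh w : 'rV[K]_2 := rowc (ursubmx w.1 i0 j0, ursubmx w.2 i0 j0).
Fact projh_linear : linear projh.
Proof.
move=> a [w1 w2] [u1 u2]; apply/rowP => j; rewrite !mxE /=.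
by case: ifP.
Qed.
HB.instance Definition _ := GRing.isLinear.Build K h 'rV[K]_2 _ projh projh_linear.

Definition line_of_point W : {vspace 'rV[K]_2} := (linfun projh @: W)%VS.

Lemma projh_Tab c X : projh (Tab c X) = ursubmx X i0 j0 *: rowc c.
Proof.
rewrite /projh /Tab /= !block_mxKur; apply/rowP => j; rewrite !mxE /=.
by case: ifP => _; rewrite mulrC.
Qed.

Lemma line_of_pointE c : line_of_point (Wab p q c) = <[rowc c]>%VS.
Proof.
apply/vspaceP => v; apply/idP/vlineP => [/memv_imgP[w /mem_WabP[X ->] ->]|[a ->]].
  by exists (ursubmx X i0 j0); rewrite lfunE; exact: projh_Tab.
apply/memv_imgP; exists (Tab c (a *: E0 K i0 j0)); first exact: mem_Tab.
rewrite lfunE [RHS]projh_Tab; congr (_ *: _).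
by rewrite /E0 scale_block_mx block_mxKur !mxE !eqxx mulr1.
Qed.

Lemma ringed_base_proj : ringed (proj_space K 1). Proof. exact: ringed_proj. Qed.

Lemma point_of_line_morph : morphism (proj_space K 1) base_space point_of_line.
Proof.
move=> L dL; apply: to_base => //; first exact: ringed_base_proj.
  move=> L' /dom_projP[v v0 ->]; exists (colc v); rewrite colc_neq0; split=> //.
  exact: point_of_lineE.
apply: morph_at_from_proj => // v v0 _; have rn := @ringed_nonzero K 1.
have dv : dom (nonzero_vectors K 1) v by split.
apply: (morph_at_ext rn dv (f' := fun v => Wab p q (colc v))).
  by move=> y [_ y0]; exact: point_of_lineE.
apply: morph_at_Wab => //.
- by move=> y [_ y0]; rewrite colc_neq0.
- exact: mxreg_nonzero.
- exact: mxreg_nonzero.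
Qed.

Lemma mxreg_rowc T (M : cspace K T) x (c : T -> K * K) :
  regat M x (fun y => (c y).1) -> regat M x (fun y => (c y).2) -> ringed M -> dom M x ->
  mxreg M x (fun y => rowc (c y)).
Proof.
move=> r1 r2 rM Mx i j; case: (eqVneq j 0) => j0'.
  by apply: (regat_ext rM Mx r1) => y _; rewrite mxE j0'.
by apply: (regat_ext rM Mx r2) => y _; rewrite mxE (negbTE j0').
Qed.

Lemma line_of_point_chart e W : base_points W -> Vset e W ->
  line_of_point W = <[rowc (cab e (Tco e W))]>%VS.
Proof. by move=> bW VW; rewrite {1}(Vset_base_chart i0 j0 bW VW) line_of_pointE. Qed.

Lemma line_of_point_morph : morphism base_space (proj_space K 1) line_of_point.
Proof.
move=> W dW; have rb := ringed_base K p q; have bW : base_points W by case: dW.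
have [e [t Wt]] := base_chart bW.
have VW : Vset e W by rewrite Wt; exact: Vset_Wab.
apply: (morph_at_near rb dW (@zopen_Vset_base K p q e) VW
  (f' := fun W => <[rowc (cab e (Tco e W))]>%VS)).
  by move=> W' [_ bW'] VW'; exact: line_of_point_chart.
have rT := regat_Tco_base i0 j0 dW VW; have [r1 r2] := regat_cab rb dW e rT.
apply: (morph_at_proj rb dW); last exact: mxreg_rowc.
by move=> y _; rewrite rowc_neq0 cab_neq0.
Qed.

Lemma point_of_lineK L : dom (proj_space K 1) L -> line_of_point (point_of_line L) = L.
Proof.
by move=> /dom_projP[v v0 ->]; rewrite point_of_lineE // line_of_pointE colcK.
Qed.

Lemma line_of_pointK W : base_points W -> point_of_line (line_of_point W) = W.
Proof.
move=> [c [c0 ->]]; rewrite line_of_pointE point_of_lineE ?rowc_neq0 //.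
by rewrite rowcK.
Qed.

Lemma base_iso : space_iso (proj_space K 1) base_space point_of_line line_of_point.
Proof.
split; [exact: point_of_line_morph|exact: line_of_point_morph|exact: point_of_lineK|].
by move=> W [_ bW]; exact: line_of_pointK.
Qed.

Lemma base_quasi_projective : quasi_projective base_space.
Proof.
exists 1%N, setT, setT, line_of_point, point_of_line; split.
- exact: zopenT ringed_base_proj.
- by move=> x _ /(_ I).
have rp := ringed_base_proj; have [m1 m2 k1 k2] := base_iso; split=> //.
- move=> W dW; apply: (morph_at_subcod (ringed_base K p q) dW); last exact: m2.
  by move=> y dy; split=> //; have [] := m2 y dy.
- by move=> L [dL _]; apply: morph_at_subdom; exact: m1.
- by move=> L [dL _]; exact: k1.
Qed.

End ProjectiveCoordinate.

Import VectorInternalTheory.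

(** * Group operations, smoothness and irreducibility *)

Section GroupFamily.
Variables (K : fieldType) (p q : nat) (i0 : 'I_q) (j0 : 'I_p).
Local Notation h := ('M[K]_(q + p) * 'M[K]_(q + p))%type.
Local Notation base_points := (@base_points K p q).
Local Notation base_space := (base_space K p q).
Local Notation total_points := (@total_points K p q).
Local Notation total_space := (total_space K p q).
Local Notation Tco := (Tco i0 j0).

Definition total_mul (a b : {vspace h} * h) : {vspace h} * h := (a.1, pmul a.2 b.2).
Definition total_one (W : {vspace h}) : {vspace h} * h := (W, pone K p q).
Definition total_inv (a : {vspace h} * h) : {vspace h} * h := (a.1, pinv a.2).

Lemma total_points_mul a b : total_points a -> total_points b -> a.1 = b.1 ->
  total_points (total_mul a b).
Proof.
move=> [ba [a2 ua]] [_ [b2 ub]] e; split=> //; split; last exact: punit_mul.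
by case: ba => c [_ ac]; rewrite /= ac; apply: mem_pmul; rewrite -ac // e.
Qed.

Lemma total_points_one W : base_points W -> total_points (total_one W).
Proof.
move=> bW; split=> //; split; last exact: punit1.
by case: bW => c [_ ->]; exact: mem_pone.
Qed.

Lemma total_points_inv a : total_points a -> total_points (total_inv a).
Proof.
move=> [ba [a2 ua]]; split=> //; split; last exact: punit_inv.
by case: ba => c [_ ac]; rewrite /= ac; apply: mem_pinv => //; rewrite -ac.
Qed.

Lemma morph_at_pmul T (M : cspace K T) (u v : T -> h) x : ringed M -> dom M x ->
  morph_at M (aff h) u x -> morph_at M (aff h) v x ->
  morph_at M (aff h) (fun y => pmul (u y) (v y)) x.
Proof.
move=> rM Mx /(mxreg_h rM Mx)[u1 u2] /(mxreg_h rM Mx)[v1 v2].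
by apply: (morph_at_h rM Mx); exact: mxreg_mul.
Qed.

Lemma total_mul_morph :
  morphism (subsp (prodsp total_space total_space) [set z | z.1.1 = z.2.1]) total_space
    (fun z => total_mul z.1 z.2).
Proof.
have rt := ringed_total K p q.
have rpp : ringed (prodsp total_space total_space) by exact: ringed_prodsp.
move=> z [[z1 z2] ez]; have Mz : dom (prodsp total_space total_space) z by split.
have r12 : ringed (subsp (prodsp total_space total_space) [set z | z.1.1 = z.2.1]).
  exact: ringed_subsp.
have Mz12 : dom (subsp (prodsp total_space total_space) [set z | z.1.1 = z.2.1]) z by split.
apply: (to_total (f := fun z : ({vspace h} * h) * ({vspace h} * h) => total_mul z.1 z.2) r12 Mz12).
- by move=> y [[[_ y1] [_ y2]] ey]; exact: total_points_mul.
- apply: morph_at_subdom.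
  exact: (morph_at_comp (morph_at_fst rt rt z1 z2) (total_fst_Gr z1)).
- apply: morph_at_subdom; apply: morph_at_pmul => //.
    exact: (morph_at_comp (morph_at_fst rt rt z1 z2) (total_snd z1)).
  exact: (morph_at_comp (morph_at_snd rt rt z1 z2) (total_snd z2)).
Qed.

Lemma total_one_morph : morphism base_space total_space total_one.
Proof.
move=> W dW; have rb := ringed_base K p q; apply: to_total => //.
- by move=> y [_ by_]; exact: total_points_one.
- exact: base_to_Gr.
- exact: morph_at_cst.
Qed.

Lemma total_inv_morph : morphism total_space total_space total_inv.
Proof.
move=> y dy; have rt := ringed_total K p q; apply: to_total => //.
- by move=> z [_ tz]; exact: total_points_inv.
- exact: total_fst_Gr.
- have [r1 r2] := mxreg_h rt dy (total_snd dy).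
  have [_ [_ [_ [u1 u2]]]] := dy.
  by apply: (morph_at_h rt dy) => /=; apply: (mxreg_inv rt dy).
Qed.

(* Locally the total space is an open subset of X x A^n, so no equation is needed. *)
Lemma total_smooth : smooth_morphism total_space base_space fst.
Proof.
split; first exact: total_fst.
move=> y dy; have rt := ringed_total K p q; have rb := ringed_base K p q.
have ty : total_points y by case: dy.
have [e [t y1]] := base_chart ty.1.
have Vy : Vset e y.1 by rewrite y1; exact: Vset_Wab.
pose n := ((q + p) * (q + p))%N.
pose P (z : {vspace h} * 'rV[K]_n) := Tab (cab e (Tco e z.1)) (vec_mx z.2).
pose XA := prodsp base_space (aff 'rV[K]_n).
pose V : set ({vspace h} * 'rV[K]_n) := [set z | Vset e z.1].
pose W : set ({vspace h} * 'rV[K]_n) := V `&` [set z | punit (P z)].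
have ra := @ringed_aff K 'rV[K]_n.
have rXA : ringed XA by exact: ringed_prodsp.
have oV : zopen XA V.
  apply: (zopen_preimage (f := fst) (N := base_space)); last exact: zopen_Vset_base.
  by move=> z [z1 z2]; exact: morph_at_fst.
have mP : morphism (subsp XA V) (aff h) P.
  move=> z [[z1 z2] Vz]; have Mz : dom XA z by split.
  apply: morph_at_subdom.
  have r : regat base_space z.1 (Tco e) by exact: regat_Tco_base.
  have [r1 r2] := regat_cab rXA Mz e (morph_regat (morph_at_fst rb ra z1 z2) r).
  apply: (morph_at_Tab rXA Mz r1 r2); apply: mxreg_vec_mx => //.
  by apply/mxregP => //; exact: morph_at_snd.
have oW : zopen XA W.
  by apply: zopen_of_subsp => //; apply: zopen_punit => //; exact: ringed_subsp.
exists n, 0%N, (fun _ _ => 0), [set y | Vset e y.1], W,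
  (fun y => (y.1, mxvec (Lam e y.2))), (fun z => (z.1, P z)), (fun _ _ => 0).
have rU : ringed (subsp total_space [set y | Vset e y.1]) by exact: ringed_subsp.
have rW : ringed (subsp XA (W `&` [set w | forall i : 'I_0, (fun _ _ => 0) i w = 0 :> K])).
  exact: ringed_subsp.
have PE z : total_points z -> Vset e z.1 -> P (z.1, mxvec (Lam e z.2)) = z.2.
  by move=> tz Vz; rewrite /P /= mxvecK; have /(congr1 snd) /= := chart_invK i0 j0 tz Vz.
have tP z : dom XA z -> W z -> total_points (z.1, P z).
  move=> [[_ bz] _] [Vz uz]; split=> //=; split=> //.
  by rewrite (Vset_base_chart i0 j0 bz Vz); exact: mem_Tab.
split=> //.
- by split=> //; exact: zopen_Vset_total.
- by split=> // w [].
- split.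
  + move=> z Mz; apply: (morph_at_subcod rU Mz).
      move=> y' [[_ ty'] Vy']; split; last first.
        by split=> [|[]] //; split=> //=; rewrite PE //; case: ty' => _ [].
      by split=> //=; apply: dom_base; case: ty'.
    case: Mz => dz Vz; apply: morph_at_subdom; apply: (morph_at_pair rt dz).
    * by move=> y' [_ [by' _]]; split=> //; exact: dom_base.
    * exact: total_fst.
    * apply/mxregP => //; apply: mxreg_mxvec => //; apply: morph_at_Lam => //.
      exact: total_snd.
  + move=> z Mz; apply: (morph_at_subcod rW Mz).
      move=> z' [dz' [Wz' _]]; split; last by case: Wz'.
      by apply: dom_total; exact: tP.
    apply: (to_total rW Mz).
    * by move=> z' [dz' [Wz' _]]; exact: tP.
    * apply: morph_at_subdom; case: Mz => -[z1 z2] _.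
      exact: (morph_at_comp (morph_at_fst rb ra z1 z2) (base_to_Gr z1)).
    * case: Mz => dz [[Vz uz] _].
      have [dP rP] := mP z (conj dz Vz); split=> // u /rP [u' ru' eu'].
      by exists u' => // y' My' [[Vy' _] _]; exact: eu'.
  + by move=> z [[_ tz] Vz]; rewrite PE //; case: (z).
  + move=> z [[[_ bz] _] [[Vz _] _]]; case: z bz Vz => z1 z2 /= bz Vz.
    by rewrite /P /= LamK vec_mxK.
- by split=> [[]|] //; rewrite det_mx00 oner_neq0.
Qed.

(** An open subset of an affine space satisfies the Jacobian criterion with no equations; [v2r] and
    [r2v] bring the space to the row vectors used by [smooth_at]. *)
Lemma smooth_over_point T (E : cspace K T) (V : vectType K) (y : T) U B f f' :
  ringed E -> zopen E U -> U y -> zopen (aff V) B ->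
  space_iso (subsp E U) (subsp (aff V) B) f f' ->
  smooth_at E pt_space (fun=> tt) y.
Proof.
move=> rE oU Uy oB [mf mf' fK f'K].
pose back : 'rV[K]_(dim V) -> V := @r2v _ V.
pose XA := prodsp (@pt_space K) (aff 'rV[K]_(dim V)).
have rp := @ringed_pt K; have ra := @ringed_aff K 'rV[K]_(dim V).
have rV := @ringed_aff K V; have rXA : ringed XA by exact: ringed_prodsp.
have mr z : dom XA z -> morph_at XA (aff V) (fun z => back z.2) z.
  move=> Mz; have ms : morph_at XA (aff 'rV[K]_(dim V)) snd z by exact: morph_at_snd.
  exact: (morph_at_linear rXA Mz (@r2v _ V : {linear 'rV[K]_(dim V) -> V}) ms).
pose W : set (unit * 'rV[K]_(dim V)) := [set z | B (back z.2)].
have oW : zopen XA W by apply: (zopen_preimage (f := fun z => back z.2) (N := aff V)).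
exists (dim V), 0%N, (fun _ _ => 0), U, W, (fun y => (tt, v2r (f y))), (fun z => f' (back z.2)), (fun _ _ => 0).
have rU : ringed (subsp E U) by exact: ringed_subsp.
split=> //.
- by split=> // w [].
- split.
  + move=> z Mz; apply: (morph_at_subcod rU Mz).
      by move=> z' Mz'; split=> //; split=> [|[]] //; rewrite /W /back /= v2rK; have [[]] := mf z' Mz'.
    apply: (morph_at_pair rU Mz) => //; first exact: morph_at_cst.
    apply: (morph_at_linear rU Mz (@v2r _ V : {linear V -> 'rV[K]_(dim V)})).
    exact: (morph_at_subcodW (mf z Mz)).
  + move=> z [Mz [Wz _]].
    have m : morph_at (subsp XA (W `&` [set w | forall i : 'I_0, (fun _ _ => 0) i w = 0 :> K]))
        (subsp (aff V) B) (fun z => back z.2) z.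
      apply: morph_at_subcod => //; first exact: ringed_subsp.
        by move=> z' [_ [Bz' _]].
      by apply: morph_at_subdom; exact: mr.
    exact: (morph_at_comp m (mf' _ (conj I Wz))).
  + by move=> z Mz; rewrite /back /= v2rK fK.
  + by move=> [[] z] [_ [Bz _]]; rewrite f'K //= /back r2vK.
- by split=> [[]|] //; rewrite det_mx00 oner_neq0.
Qed.

Lemma to_point T (M : cspace K T) : ringed M -> morphism M pt_space (fun=> tt).
Proof. by move=> rM x Mx; exact: morph_at_cst. Qed.

Lemma total_nonsingular : nonsingular total_space.
Proof.
have rt := ringed_total K p q; split; first exact: to_point.
move=> y [_ ty]; have [e [t y1]] := base_chart ty.1.
have Vy : Vset e y.1 by rewrite y1; exact: Vset_Wab.
apply: (smooth_over_point rt (@zopen_Vset_total K p q e) Vy (@zopen_chart K p q e)).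
exact: (space_iso_sym (@chart_iso K p q i0 j0 e)).
Qed.

Lemma base_chart_iso e : space_iso (subsp base_space (Vset e)) (subsp (aff K^o) setT)
  (Tco e) (fun t : K => Wab p q (cab e t)).
Proof.
have rb := ringed_base K p q; have rbV : ringed (subsp base_space (Vset e)) by exact: ringed_subsp.
have ra := @ringed_aff K K^o.
split.
- move=> W dW; apply: (morph_at_subcod rbV dW) => //; case: dW => dW VW.
  by apply: morph_at_subdom; apply: morph_at_scalar => //; exact: regat_Tco_base.
- move=> t dt; have raT : ringed (subsp (aff K^o) (setT : set K^o)) by exact: ringed_subsp.
  apply: (morph_at_subcod raT dt).
    by move=> s _; split; [apply: dom_base; exact: base_points_chart|exact: Vset_Wab].
  apply: to_base => //; first by move=> s _; exact: base_points_chart.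
  apply: morph_at_subdom.
  have rs : regat (aff K^o) t (fun s : K => s).
    by apply: (regat_scalar ra) => //; exact: morph_at_id.
  have [r1 r2] := regat_cab ra (x := t) I e rs.
  by apply: morph_at_Wab => // s _; exact: cab_neq0.
- by move=> W [[_ bW] VW]; rewrite -(Vset_base_chart i0 j0 bW VW).
- by move=> t _; rewrite Tco_Wab.
Qed.

Lemma base_nonsingular : nonsingular base_space.
Proof.
have rb := ringed_base K p q; split; first exact: to_point.
move=> W [_ bW]; have [e [t eW]] := base_chart bW.
have VW : Vset e W by rewrite eW; exact: Vset_Wab.
apply: (smooth_over_point rb (@zopen_Vset_base K p q e) VW _ (base_chart_iso e)).
exact: zopenT (@ringed_aff K K^o).
Qed.

(** The base is the image of the irreducible total space: nonempty open sets pull back to nonempty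
    ones because of the identity section. *)
Lemma base_irreducible : infinite_field K -> irreducible_space base_space.
Proof.
move=> infK; have [_ irr] := total_irreducible i0 j0 infK; split.
  by exists (Wab p q (cab false 0)); apply: dom_base; exact: base_points_chart.
move=> U V oU oV [x [dx Ux]] [y [dy Vy]].
have [z [dz Uz Vz]] := irr _ _ (zopen_preimage (@total_fst K p q) oU)
    (zopen_preimage (@total_fst K p q) oV)
  (ex_intro _ (total_one x) (conj (dom_total (total_points_one dx.2)) Ux))
  (ex_intro _ (total_one y) (conj (dom_total (total_points_one dy.2)) Vy)).
by exists z.1; split=> //; have [] := total_fst dz.
Qed.

End GroupFamily.

(** * Segre embedding of the total space *)

Section ProjectiveSubsets.
Variables (K : fieldType) (N : nat).
Local Notation E := 'rV[K]_N.+1.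
Local Notation PN := (proj_space K N).

Lemma regat_from_proj L (u : {vspace E} -> K) : dom PN L ->
  (forall v : E, v != 0 -> <[v]>%VS = L ->
     regat (nonzero_vectors K N) v (fun v => u <[v]>%VS)) ->
  regat PN L u.
Proof.
move=> dL h; have rP := @ringed_proj K N; apply: (regat_scalar rP dL).
apply: morph_at_from_proj => // v v0 vL; apply: morph_at_scalar; [exact: ringed_nonzero|by []|].
exact: h.
Qed.

(** [A] need not be a cone: if the line of [w] meets it at k w, then k w' is still in [A] for w'
    near w. *)
Lemma zopen_proj_exists (A : set E) : zopen (aff E) A -> A `<=` [set v | v != 0] ->
  zopen PN [set L : {vspace E} | exists2 v : E, v \in L & A v].
Proof.
move=> oA A0 L dL [v vL Av]; apply: regat_from_proj => // w w0 wL.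
move: vL; rewrite -wL => /vlineP[k vk].
have rn := @ringed_nonzero K N; have dw : dom (nonzero_vectors K N) w by split.
have m : morphism (nonzero_vectors K N) (aff E) (fun w => k *: w).
  move=> w' [Iw' w0']; have dw' : dom (nonzero_vectors K N) w' by split.
  by apply/(mxregP rn dw'); apply: mxreg_scale => //; [exact: regat_cst|exact: mxreg_nonzero].
have Akw : (fun w => k *: w) @^-1` A `<=` setT by [].
have kA : A (k *: w) by rewrite -vk.
have [u [ru uw uA]] := regat_indicator (zopen_preimage m oA) dw kA.
apply: (regat_near rn dw ru uw (regat_cst rn 1 dw)) => y _ /uA Ay.
rewrite mem_set //; exists (k *: y) => //.
by apply/vlineP; exists k.
Qed.

Lemma zopen_mx_neq0 T (M : cspace K T) m n (F : T -> 'M[K]_(m, n)) : ringed M ->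
  (forall x, dom M x -> mxreg M x F) -> zopen M [set x | F x != 0].
Proof.
move=> rM rF; apply: zopen_nonvanishing => // x Mx Fx.
have [i [j nij]] : exists i j, F x i j != 0.
  apply: contrapT => n'; move/eqP: Fx; apply; apply/matrixP => i j; rewrite mxE.
  by case: (eqVneq (F x i j) 0) => // nz; exfalso; apply: n'; exists i, j.
exists (fun y => F y i j); split=> //; first exact: rF.
by move=> y _; apply: contra_neqT; rewrite negbK => /eqP->; rewrite mxE.
Qed.

(** The vector of the line with [l]-th coordinate 1. Unlike [vpick], whose choice is arbitrary, it
    varies regularly with the line where that coordinate is nonzero. *)
Definition normalized (l : 'I_N.+1) (L : {vspace E}) : E :=
  (vpick L 0 l)^-1 *: vpick L.

Lemma normalized_line l (v : E) : v != 0 -> normalized l <[v]>%VS = (v 0 l)^-1 *: v.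
Proof.
move=> v0; rewrite /normalized; have [a a0 ->] := vpick_line v0.
rewrite mxE scalerA; case: (eqVneq (v 0 l) 0) => [->|vl0].
  by rewrite mulr0 invr0 mul0r.
by rewrite invfM mulrAC mulVf // mul1r.
Qed.

Lemma mxreg_normalized l L : dom PN L -> vpick L 0 l != 0 -> mxreg PN L (normalized l).
Proof.
move=> dL Ll i j; apply: regat_from_proj => // v v0 vL.
have rn := @ringed_nonzero K N; have dv : dom (nonzero_vectors K N) v by split.
have vl : v 0 l != 0.
  move: Ll; rewrite -vL; have [a a0 ->] := vpick_line v0.
  by rewrite mxE mulf_eq0 negb_or => /andP[].
have rv := @mxreg_nonzero K N v.
have rs : mxreg (nonzero_vectors K N) v (fun v : E => (v 0 l)^-1 *: v).
  by apply: mxreg_scale => //; apply: (regat_inv rn dv).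
apply: (regat_ext rn dv (rs i j)) => w [_ w0] /=.
by rewrite normalized_line.
Qed.

Lemma zopen_coord_neq0 l : zopen PN [set L : {vspace E} | vpick L 0 l != 0].
Proof.
move=> L dL Ll; apply: regat_from_proj => // v v0 vL.
have rn := @ringed_nonzero K N; have dv : dom (nonzero_vectors K N) v by split.
have vl : v 0 l != 0.
  move: Ll; rewrite /= -vL; have [a a0 ->] := vpick_line v0.
  by rewrite mxE mulf_eq0 negb_or => /andP[].
apply: (regat_near rn dv (@mxreg_nonzero K N v 0 l) vl (regat_cst rn 1 dv)) => w [_ w0] wl.
rewrite mem_set //=; have [a a0 ->] := vpick_line w0.
by rewrite mxE mulf_neq0.
Qed.

End ProjectiveSubsets.

Section Segre.
Variables (K : fieldType) (p q : nat) (i0 : 'I_q) (j0 : 'I_p).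
Local Notation g := 'M[K]_(q + p).
Local Notation h := ('M[K]_(q + p) * 'M[K]_(q + p))%type.
Local Notation total_points := (@total_points K p q).
Local Notation total_space := (total_space K p q).
Local Notation Tco := (Tco i0 j0).
Local Notation m := ((q + p) * (q + p))%N.
Local Notation M := (1 + (m + m))%N.
Local Notation N := ((m + m) + M)%N.
Local Notation E := 'rV[K]_N.+1.
Implicit Types (c : K * K) (w : h) (W : {vspace h}) (v : 'rV[K]_(M + M)) (u : 'rV[K]_M).

(* Segre embedding: the point ([a : b], w) goes to the line of
   (a (1, w), b (1, w)). *)
Definition aff_vec w : 'rV[K]_M := row_mx 1%:M (row_mx (mxvec w.1) (mxvec w.2)).
Definition segre c w : E := row_mx (c.1 *: aff_vec w) (c.2 *: aff_vec w).
Definition vhead u : K := lsubmx u 0 0.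
Definition vtail u : h := (vec_mx (lsubmx (rsubmx u)), vec_mx (rsubmx (rsubmx u))).
Definition vcoord (e : bool) v : 'rV[K]_M := if e then lsubmx v else rsubmx v.

Lemma vheadZ a u : vhead (a *: u) = a * vhead u.
Proof. by rewrite /vhead linearZ mxE. Qed.
Lemma vtailZ a u : vtail (a *: u) = a *: vtail u.
Proof. by rewrite /vtail !linearZ. Qed.
Lemma vcoordZ e a v : vcoord e (a *: v) = a *: vcoord e v.
Proof. by case: e; rewrite /vcoord linearZ. Qed.
Lemma vcoordZ_lines e a (v : E) : vcoord e (a *: v) = a *: vcoord e v.
Proof. exact: vcoordZ. Qed.
Lemma vhead_aff w : vhead (aff_vec w) = 1.
Proof. by rewrite /vhead /aff_vec row_mxKl mxE. Qed.
Lemma vtail_aff w : vtail (aff_vec w) = w.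
Proof. by case: w => a b; rewrite /vtail /aff_vec row_mxKr row_mxKl row_mxKr !mxvecK. Qed.
Lemma aff_vecE u : vhead u = 1 -> aff_vec (vtail u) = u.
Proof.
move=> u1; rewrite /aff_vec /vtail /= !vec_mxK !hsubmxK -[RHS]hsubmxK; congr row_mx.
by apply/rowP => i; rewrite !ord1 !mxE -u1 /vhead mxE.
Qed.
Lemma vcoord_segre e c w : vcoord e (segre c w) = (if e then c.1 else c.2) *: aff_vec w.
Proof. by case: e; rewrite /vcoord /segre ?row_mxKl ?row_mxKr. Qed.
Lemma vcoord_inj v v' : (forall e, vcoord e v = vcoord e v') -> v = v'.
Proof. by move=> e; rewrite -[v]hsubmxK -[v']hsubmxK; congr row_mx; [exact: (e true)|exact: (e false)]. Qed.

Lemma segre_neq0 c w : c != 0 -> segre c w != 0.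
Proof.
apply: contra_neq => s0.
have hz e : (if e then c.1 else c.2) = 0.
  rewrite -[LHS]mulr1 -(vhead_aff w) -vheadZ -vcoord_segre s0 /vcoord.
  by case: e; rewrite linear0 /vhead linear0 mxE.
by case: (c) hz => a b /= hz; rewrite (hz true) (hz false).
Qed.

Lemma punitZ a w : a != 0 -> punit (a *: w) <-> punit w.
Proof. by move=> a0; rewrite /punit /= !unitmxZ ?unitfE. Qed.

Definition segre_open : set E :=
  [set v | exists e, vhead (vcoord e v) != 0 /\ punit (vtail (vcoord e v))].

Definition heads v : K * K := (vhead (vcoord true v), vhead (vcoord false v)).

(** The first block says that the two halves of v are proportional, in the ratio of their heads; the
    others put the tail of each half in W_c, for c the pair of heads. Both tails are tested because
    either head may be zero. *)
Definition segre_eqs v : 'rV[K]_(M + (m + m)) :=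
  row_mx (vhead (vcoord true v) *: vcoord false v - vhead (vcoord false v) *: vcoord true v)
    (row_mx (mxvec (defect (heads v) (vtail (vcoord true v))))
            (mxvec (defect (heads v) (vtail (vcoord false v))))).

Definition segre_closed : set {vspace E} :=
  [set L : {vspace E} | forall v : E, v \in L -> segre_eqs v = 0].

Lemma mxreg_vcoord T (S : cspace K T) x e (f : T -> 'rV[K]_(M + M)) : ringed S -> dom S x ->
  mxreg S x f -> mxreg S x (fun y => vcoord e (f y)).
Proof.
move=> rS Sx rf; case: e => i j.
  by apply: (regat_ext rS Sx (rf i (lshift _ j))) => y _; rewrite mxE.
by apply: (regat_ext rS Sx (rf i (rshift _ j))) => y _; rewrite mxE.
Qed.

Lemma regat_vhead T (S : cspace K T) x (f : T -> 'rV[K]_M) : ringed S -> dom S x ->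
  mxreg S x f -> regat S x (fun y => vhead (f y)).
Proof.
by move=> rS Sx rf; apply: (regat_ext rS Sx (rf 0 (lshift _ 0))) => y _; rewrite /vhead mxE.
Qed.

Lemma morph_at_vtail T (S : cspace K T) x (f : T -> 'rV[K]_M) : ringed S -> dom S x ->
  mxreg S x f -> morph_at S (aff h) (fun y => vtail (f y)) x.
Proof.
move=> rS Sx rf; apply: morph_at_h => //= ; apply: mxreg_vec_mx => // i j.
  by apply: (regat_ext rS Sx (rf i (rshift _ (lshift _ j)))) => y _; rewrite !mxE.
by apply: (regat_ext rS Sx (rf i (rshift _ (rshift _ j)))) => y _; rewrite !mxE.
Qed.

Lemma mxreg_id (v : E) : mxreg (aff E) v (fun v : E => v : 'rV[K]_(M + M)).
Proof. exact: ((mxregP (@ringed_aff K E) (x := v) I id).2 (@morph_at_id _ _ (aff E) v I)). Qed.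

Lemma zopen_segre_open : zopen (aff E) segre_open.
Proof.
have ra := @ringed_aff K E.
have oe e : zopen (aff E) [set v : E | vhead (vcoord e v) != 0 /\ punit (vtail (vcoord e v))].
  apply: (zopenI ra (U := [set v : E | vhead (vcoord e v) != 0])
                 (V := [set v : E | punit (vtail (vcoord e v))])) => //.
    apply: zopen_nonvanishing => // v _ hv; exists (fun v : E => vhead (vcoord e v)).
    split=> //; apply: regat_vhead => //; apply: mxreg_vcoord => //; exact: mxreg_id.
  apply: zopen_punit => // v _; apply: morph_at_vtail => //; apply: mxreg_vcoord => //.
  exact: mxreg_id.
apply: (zopen_eqdom ra _ (zopenU ra (oe true) (oe false))) => v _; split.
  by case=> ?; [exists true|exists false].
by case=> -[] ?; [left|right].
Qed.

Lemma mxreg_segre_eqs v : mxreg (aff E) v (segre_eqs : E -> _).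
Proof.
have ra := @ringed_aff K E; have Iv : dom (aff E) v by [].
have rc e : mxreg (aff E) v (fun v : E => vcoord e v).
  by apply: mxreg_vcoord => //; exact: mxreg_id.
have rh e : regat (aff E) v (fun v : E => vhead (vcoord e v)) by exact: regat_vhead.
have rt e : morph_at (aff E) (aff h) (fun v : E => vtail (vcoord e v)) v.
  exact: morph_at_vtail.
apply: mxreg_row => //.
  by apply: mxreg_add => //; [|apply: mxreg_opp => //]; apply: mxreg_scale.
by apply: mxreg_row => //; apply: mxreg_mxvec => //; exact: (mxreg_defect (c := fun v : E => heads v) ra Iv (rh true) (rh false)).
Qed.

Lemma segre_eqs0 : segre_eqs 0 = 0.
Proof.
have c0 e : vcoord e 0 = 0 by case: e; rewrite /vcoord linear0.
have t0 : vtail 0 = 0 by rewrite /vtail !linear0.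
rewrite /segre_eqs !c0 !scaler0 subr0 t0.
have -> : defect (heads 0) (0 : h) = 0.
  have [f0 s0] : (0 : h).1 = 0 :> g /\ (0 : h).2 = 0 :> g by [].
  rewrite /defect f0 s0 -[0 : g](block_mx0 _ q p q p).
  by rewrite !(block_mxKul, block_mxKur, block_mxKdl, block_mxKdr) !scaler0 !subr0.
by rewrite linear0 !row_mx0.
Qed.

Lemma zclosed_segre : zclosed (proj_space K N) segre_closed.
Proof.
have oA : zopen (aff E) [set v : E | segre_eqs v != 0].
  by apply: zopen_mx_neq0 => [|v _]; [exact: ringed_aff|exact: mxreg_segre_eqs].
have A0 : [set v : E | segre_eqs v != 0] `<=` [set v | v != 0].
  by move=> v /=; apply: contra_neq => ->; exact: segre_eqs0.
apply: (zopen_eqdom (@ringed_proj K N) _ (zopen_proj_exists oA A0)) => L _; split.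
  by move=> [v vL /eqP sv] /(_ v vL).
move=> nL; apply: contrapT => n; apply: nL => v vL.
by case: (eqVneq (segre_eqs v) 0) => // sv; exfalso; apply: n; exists v.
Qed.

Definition segre_open_lines : set {vspace E} :=
  [set L : {vspace E} | exists2 v : E, v \in L & segre_open v].

Lemma zopen_segre_lines : zopen (proj_space K N) segre_open_lines.
Proof.
apply: zopen_proj_exists; first exact: zopen_segre_open.
move=> v [e [hv _]] /=; apply: contra_neq hv => ->.
by case: e; rewrite /vcoord linear0 /vhead linear0 mxE.
Qed.

Definition segre_map (y : {vspace h} * h) : {vspace E} :=
  <[segre (colc (vpick (line_of_point i0 j0 y.1))) y.2]>%VS.

Lemma segre_scale a c w : segre (a * c.1, a * c.2) w = a *: segre c w.
Proof. by rewrite /segre /= -!scalerA -scale_row_mx. Qed.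

Lemma segre_mapE c w : c != 0 -> segre_map (Wab p q c, w) = <[segre c w]>%VS.
Proof.
move=> c0; rewrite /segre_map /= line_of_pointE.
have rc0 : rowc c != 0 by rewrite rowc_neq0.
have [a a0 ->] := vpick_line rc0.
by rewrite colcZ rowcK segre_scale line_scale.
Qed.

Definition seg_index (e : bool) : 'I_N.+1 :=
  if e then lshift M (lshift (m + m) (0 : 'I_1)) else rshift M (lshift (m + m) (0 : 'I_1)).

Lemma seg_indexE e (v : E) : v 0 (seg_index e) = vhead (vcoord e v).
Proof. by case: e; rewrite /vhead !mxE. Qed.

Definition segre_inv0 v : {vspace h} * h :=
  (Wab p q (heads v),
   if vhead (vcoord true v) != 0 then (vhead (vcoord true v))^-1 *: vtail (vcoord true v)
   else (vhead (vcoord false v))^-1 *: vtail (vcoord false v)).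

Definition segre_inv (L : {vspace E}) : {vspace h} * h := segre_inv0 (vpick L).

Lemma segre_inv0_scale a v : a != 0 -> segre_inv0 (a *: v) = segre_inv0 v.
Proof.
move=> a0; rewrite /segre_inv0 /heads !vcoordZ !vheadZ !vtailZ.
rewrite -(Wab_scale p q (heads v) a0) mulf_eq0 (negbTE a0) /=; congr (_, _).
have e x w : (a * x)^-1 *: (a *: w) = x^-1 *: w by rewrite scalerA invfM mulrAC mulVf // mul1r.
by case: ifP => _; rewrite e.
Qed.

Lemma segre_inv_line (v : E) : v != 0 -> segre_inv <[v]>%VS = segre_inv0 v.
Proof. by move=> v0; rewrite /segre_inv; have [a a0 ->] := vpick_line v0; exact: segre_inv0_scale. Qed.

Lemma segre_inv0_segre c w : c != 0 -> segre_inv0 (segre c w) = (Wab p q c, w).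
Proof.
move=> c0; rewrite /segre_inv0 /heads !vcoord_segre !vheadZ !vtailZ vhead_aff vtail_aff !mulr1.
congr (_, _).
case: (eqVneq c.1 0) => [c10|c10] /=; last by rewrite scalerA mulVf // scale1r.
rewrite scalerA mulVf ?scale1r //; apply: contra_neq c0 => c20.
by case: (c) c10 c20 => a b /= -> ->.
Qed.

Lemma segre_mapK y : total_points y -> segre_inv (segre_map y) = y.
Proof.
case: y => W w [/= [c [c0 ->]] _]; rewrite segre_mapE // segre_inv_line ?segre_neq0 //.
exact: segre_inv0_segre.
Qed.

Lemma segre_eqs_segre c w : c != 0 -> w \in Wab p q c -> segre_eqs (segre c w) = 0.
Proof.
move=> c0 wW; rewrite /segre_eqs /heads !vcoord_segre !vheadZ !vtailZ vhead_aff vtail_aff !mulr1.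
rewrite !scalerA [c.2 * c.1]mulrC subrr.
have z a : defect (c.1, c.2) (a *: w) = 0.
  have -> : (c.1, c.2) = c by case: (c).
  by apply/eqP; rewrite -mem_Wab_defect // memvZ.
by rewrite !z linear0 !row_mx0.
Qed.

Lemma segre_map_image y : total_points y ->
  segre_open_lines (segre_map y) /\ segre_closed (segre_map y).
Proof.
case: y => W w [/= [c [c0 ->]] [wW uw]]; rewrite segre_mapE //; split.
  exists (segre c w); first exact: memv_line.
  have [e ce] : exists e : bool, (if e then c.1 else c.2) != 0.
    case: (c) c0 => a b; case: (eqVneq a 0) => [->|a0]; last by exists true.
    by move=> b0; exists false => /=; apply: contra_neq b0 => ->.
  by exists e; rewrite vcoord_segre vheadZ vhead_aff mulr1 vtailZ vtail_aff; split=> //; apply/punitZ.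
move=> v /vlineP[k ->]; rewrite -segre_scale.
case: (eqVneq k 0) => [->|k0].
  by rewrite segre_scale scale0r segre_eqs0.
apply: segre_eqs_segre; last by rewrite Wab_scale.
apply: contra_neq c0 => -[/eqP + /eqP]; rewrite !mulf_eq0 (negbTE k0) /= => /eqP a0 /eqP b0.
by case: (c) a0 b0 => a b /= -> ->.
Qed.

(** Proportionality expresses both halves through the half [e], so the two branches of [segre_inv0]
    agree where both heads are nonzero, and v is recovered from one half. *)
Lemma segre_inv0_half e v : segre_eqs v = 0 -> vhead (vcoord e v) != 0 ->
  segre_inv0 v = (Wab p q (heads v), (vhead (vcoord e v))^-1 *: vtail (vcoord e v)) /\
  segre (heads v) ((vhead (vcoord e v))^-1 *: vtail (vcoord e v)) = v.
Proof.
move=> /eqP; rewrite row_mx_eq0 subr_eq0 => /andP[/eqP prop _] he.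
have half e' : vhead (vcoord e v) *: vcoord e' v = vhead (vcoord e' v) *: vcoord e v.
  by case: e {he} => //; case: e'.
have ve e' : vcoord e' v = (vhead (vcoord e' v) / vhead (vcoord e v)) *: vcoord e v.
  apply: (scalerI he); rewrite half scalerA; congr (_ *: _).
  by rewrite mulrC divfK.
split.
  rewrite /segre_inv0; congr (_, _).
  case: e he half ve => he half ve; first by rewrite he.
  case: ifP => // hf; rewrite (ve true) vheadZ vtailZ divfK //.
  by rewrite scalerA; congr (_ *: _); rewrite mulrA mulVf // mul1r.
apply: vcoord_inj => e'; rewrite vcoord_segre.
rewrite -vtailZ aff_vecE; last by rewrite vheadZ mulVf.
by rewrite scalerA [RHS]ve; case: e'.
Qed.

Lemma segre_inv_image L : dom (proj_space K N) L -> segre_open_lines L -> segre_closed L ->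
  total_points (segre_inv L) /\ segre_map (segre_inv L) = L.
Proof.
move=> /dom_projP[v1 v10 L1] [v vL [e [he ue]]] cL.
have v0 : v != 0.
  by apply: contra_neq he => ->; case: e {ue}; rewrite /vcoord linear0 /vhead linear0 mxE.
have Lv : L = <[v]>%VS.
  by move: vL; rewrite L1 => /vlineP[k vk]; rewrite vk line_scale //;
    apply: contra_neq v0 => k0; rewrite vk k0 scale0r.
have sv := cL v vL; have [e1 e2] := segre_inv0_half sv he.
have h0 : heads v != 0 by apply: contra_neq he; rewrite /heads; case: e {ue e1 e2} => -[].
rewrite Lv segre_inv_line // e1; split; last by rewrite segre_mapE // e2.
split; first by exists (heads v).
split=> /=; last by apply/punitZ; rewrite ?invr_eq0.
apply: memvZ; rewrite mem_Wab_defect //.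
move/eqP: sv; rewrite /segre_eqs !row_mx_eq0 !mxvec_eq0 => /andP[_ /andP[d1 d2]].
by case: (e); apply/eqP; [exact: (eqP d1)|exact: (eqP d2)].
Qed.

Lemma segre_map_morph : morphism total_space (proj_space K N) segre_map.
Proof.
move=> y dy; have rt := ringed_total K p q; have ty : total_points y by case: dy.
have [e [t y1]] := base_chart ty.1.
have Vy : Vset e y.1 by rewrite y1; exact: Vset_Wab.
apply: (morph_at_near rt dy (@zopen_Vset_total K p q e) Vy
  (f' := fun y => <[segre (cab e (Tco e y.1)) y.2]>%VS)).
  move=> [W w] [_ [/= bW _]] /= VW; rewrite {1}(Vset_base_chart i0 j0 bW VW).
  by rewrite segre_mapE ?cab_neq0.
have [r1 r2] := regat_cab rt dy e (regat_Tco_total i0 j0 dy Vy).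
have [w1 w2] := mxreg_h rt dy (total_snd dy).
apply: (morph_at_proj rt dy); first by move=> z _; rewrite segre_neq0 // cab_neq0.
have ra : mxreg total_space y (fun y => aff_vec y.2).
  have rr := mxreg_row rt dy (mxreg_mxvec rt dy w1) (mxreg_mxvec rt dy w2).
  exact: (mxreg_row rt dy (mxreg_cst rt dy 1%:M) rr).
exact: (mxreg_row rt dy (mxreg_scale rt dy r1 ra) (mxreg_scale rt dy r2 ra)).
Qed.

Lemma vhead_normalized e (L : {vspace E}) : vpick L 0 (seg_index e) != 0 ->
  vhead (vcoord e (normalized (seg_index e) L)) = 1.
Proof. by move=> h0; rewrite /normalized vcoordZ_lines vheadZ -seg_indexE mulVf. Qed.

Lemma heads_normalized e (L : {vspace E}) : vpick L 0 (seg_index e) != 0 ->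
  heads (normalized (seg_index e) L) =
    cab e (vhead (vcoord (~~ e) (normalized (seg_index e) L))).
Proof.
by move=> /vhead_normalized h1; rewrite /heads; case: e h1 => h1; rewrite h1.
Qed.

(** Membership in [segre_open_lines] provides a nonzero head [e]; near such a line the normalized
    vector gives both components by regular formulas, with the other head as the coordinate t. *)
Lemma segre_inv_morph :
  morphism (subsp (proj_space K N) (segre_open_lines `&` segre_closed)) total_space segre_inv.
Proof.
set Q := segre_open_lines `&` segre_closed; have rP := @ringed_proj K N.
have rQ : ringed (subsp (proj_space K N) Q) by exact: ringed_subsp.
move=> L dQ; have [dL [oL cL]] := dQ.
suff [m1 m2] :
    morph_at (subsp (proj_space K N) Q) (grass (\dim {: g}) h) (fun L => (segre_inv L).1) L /\
    morph_at (subsp (proj_space K N) Q) (aff h) (fun L => (segre_inv L).2) L.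
  apply: (to_total rQ dQ) => // L' [dL' [oL' cL']].
  by have [] := segre_inv_image dL' oL' cL'.
have [v0 vL] : vpick L != 0 /\ <[vpick L]>%VS = L.
  move/dom_projP: dL => [v v0 ->]; have [a a0 e] := vpick_line v0; rewrite e.
  by rewrite scaler_eq0 negb_or a0 v0 line_scale.
have [e Le] : exists e, vpick L 0 (seg_index e) != 0.
  case: oL => v vinL; have /vlineP[k ->] : v \in <[vpick L]>%VS by rewrite vL.
  move=> [e [+ _]]; by rewrite vcoordZ_lines vheadZ mulf_eq0 negb_or -seg_indexE => /andP[_ ?]; exists e.
have rn : mxreg (proj_space K N) L (normalized (seg_index e)) by exact: mxreg_normalized.
pose U : set {vspace E} := [set L : {vspace E} | vpick L 0 (seg_index e) != 0].
have oU : zopen (subsp (proj_space K N) Q) U.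
  by apply: zopen_subsp; exact: zopen_coord_neq0.
have key L' : dom (subsp (proj_space K N) Q) L' -> U L' ->
    segre_inv L' = (Wab p q (cab e (vhead (vcoord (~~ e) (normalized (seg_index e) L')))),
                    vtail (vcoord e (normalized (seg_index e) L'))).
  move=> [dL' [_ cL']] UL'; rewrite -heads_normalized // /segre_inv.
  rewrite -(segre_inv0_scale (a := (vpick L' 0 (seg_index e))^-1)) ?invr_eq0 //.
  rewrite -/(normalized _ L').
  have sv : segre_eqs (normalized (seg_index e) L') = 0.
    by apply: cL'; apply: memvZ; exact: memv_pick.
  have h1 : vhead (vcoord e (normalized (seg_index e) L')) = 1.
    exact: vhead_normalized.
  have := (@segre_inv0_half e _ sv); rewrite h1 => /(_ (oner_neq0 K))[-> _].
  by rewrite invr1 scale1r.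
have rc e' : mxreg (proj_space K N) L (fun L => vcoord e' (normalized (seg_index e) L)).
  exact: mxreg_vcoord.
split.
  apply: (morph_at_near rQ dQ oU Le (f' := fun L' =>
      Wab p q (cab e (vhead (vcoord (~~ e) (normalized (seg_index e) L')))))).
    by move=> L' dL' UL'; rewrite key.
  apply: morph_at_subdom.
  have [r1 r2] := regat_cab rP dL e (regat_vhead rP dL (rc (~~ e))).
  by apply: morph_at_Wab => // L' _; exact: cab_neq0.
apply: (morph_at_near rQ dQ oU Le (f' := fun L' =>
      vtail (vcoord e (normalized (seg_index e) L')))).
  by move=> L' dL' UL'; rewrite key.
by apply: morph_at_subdom; exact: morph_at_vtail.
Qed.

Lemma total_quasi_projective : quasi_projective total_space.
Proof.
exists N, segre_open_lines, segre_closed, segre_map, segre_inv; split.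
- exact: zopen_segre_lines.
- exact: zclosed_segre.
split.
- move=> y dy; apply: (morph_at_subcod (ringed_total K p q) dy); last exact: segre_map_morph.
  move=> z dz; have [dP _] := segre_map_morph dz; split=> //.
  by apply: segre_map_image; case: dz.
- exact: segre_inv_morph.
- by move=> y [_ ty]; exact: segre_mapK.
- by move=> L [dL [oL cL]]; have [] := segre_inv_image dL oL cL.
Qed.

End Segre.

(** * Tangent spaces and the family of Lie algebras *)

Section RationalDerivative.
Variable K : fieldType.
Hypothesis infK : infinite_field K.

(** The quotient rule at 0 for a function that agrees with P / Q wherever Q is nonzero: a derivative
    without limits, over any infinite field. *)
Definition ratder (phi : K -> K) (c : K) : Prop :=
  exists P Q : {poly K}, [/\ Q.[0] != 0, forall s, Q.[s] != 0 -> phi s = P.[s] / Q.[s] &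
    c = (P^`().[0] * Q.[0] - P.[0] * Q^`().[0]) / Q.[0] ^+ 2].

(** Total, with value 0 when no derivative exists, so that it can be used inside derivations of
    total functions. *)
Definition der (phi : K -> K) : K := xget 0 (ratder phi).

Lemma poly_eq_cofinite (A B Q : {poly K}) : Q != 0 ->
  (forall s, Q.[s] != 0 -> A.[s] = B.[s]) -> A = B.
Proof.
move=> Q0 e; apply/eqP; rewrite -subr_eq0; apply/negPn/negP => AB0.
have [s] := infK (mulf_neq0 AB0 Q0); rewrite hornerM mulf_eq0 negb_or => /andP[+ Qs].
by rewrite hornerD hornerN e // subrr eqxx.
Qed.

Lemma nonroot_neq0 (Q : {poly K}) s : Q.[s] != 0 -> Q != 0.
Proof. by apply: contra_neq => ->; rewrite horner0. Qed.

(** Over an infinite field the two fractions cross-multiply to an identity of polynomials; its value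
    and its derivative at 0 give the claim. *)
Lemma ratder_unique phi c c' : ratder phi c -> ratder phi c' -> c = c'.
Proof.
move=> [P [Q [Q0 e ->]]] [P' [Q' [Q0' e' ->]]].
have eP : P * Q' = P' * Q.
  apply: (poly_eq_cofinite (mulf_neq0 (nonroot_neq0 Q0) (nonroot_neq0 Q0'))) => s.
  rewrite hornerM mulf_eq0 negb_or => /andP[Qs Qs'].
  have := e s Qs; rewrite e' // => /eqP; rewrite eqr_div // => /eqP h.
  by rewrite !hornerM h.
have h1 := congr1 (fun R : {poly K} => R.[0]) eP.
have h2 := congr1 (fun R : {poly K} => R^`().[0]) eP.
rewrite /= !derivM !hornerD !hornerM in h1 h2.
apply/eqP; rewrite eqr_div ?expf_neq0 //; apply/eqP.
set a := P.[0] in h1 h2 *; set a' := P^`().[0] in h1 h2 *.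
set b := Q.[0] in h1 h2 *; set b' := Q^`().[0] in h1 h2 *.
set x := P'.[0] in h1 h2 *; set x' := P'^`().[0] in h1 h2 *.
set y := Q'.[0] in h1 h2 *; set y' := Q'^`().[0] in h1 h2 *.
have {}h2 : a' * y = x' * b + x * b' - a * y' by rewrite -h2 addrK.
have -> : (a' * b - a * b') * y ^+ 2 = (a' * y) * b * y - (a * y) * b' * y by ring.
rewrite h2 h1.
have -> : (x' * b + x * b' - a * y') * b * y - x * b * b' * y =
  x' * b ^+ 2 * y - (a * y) * y' * b by ring.
by rewrite h1; ring.
Qed.

Lemma der_eq phi c : ratder phi c -> der phi = c.
Proof. by move=> h; apply: xget_unique => // c' h'; exact: (ratder_unique h' h). Qed.

Lemma ratder_poly phi (P : {poly K}) : (forall s, phi s = P.[s]) -> ratder phi P^`().[0].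
Proof.
move=> e; exists P, 1; split; rewrite ?hornerC ?oner_neq0 //.
  by move=> s _; rewrite e hornerC divr1.
by rewrite derivC horner0 mulr0 subr0 mulr1 expr1n divr1.
Qed.

Lemma ratder_affine phi a b : (forall s, phi s = a + s * b) -> ratder phi b.
Proof.
move=> e; have -> : b = (a%:P + b *: 'X)^`().[0].
  by rewrite derivD derivC derivZ derivX add0r hornerZ hornerC mulr1.
by apply: ratder_poly => s; rewrite e hornerD hornerC hornerZ hornerX mulrC.
Qed.

Lemma ratder_add phi psi c c' : ratder phi c -> ratder psi c' ->
  ratder (fun s => phi s + psi s) (c + c').
Proof.
move=> [P [Q [Q0 e ->]]] [P' [Q' [Q0' e' ->]]]; exists (P * Q' + P' * Q), (Q * Q'); split.
- by rewrite hornerM mulf_neq0.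
- move=> s; rewrite hornerM mulf_eq0 negb_or => /andP[Qs Qs'].
  by rewrite e // e' // hornerD !hornerM addf_div.
- by rewrite !derivD !derivM !hornerD !hornerM; field; apply/andP.
Qed.

Lemma ratder_mul phi psi c c' : ratder phi c -> ratder psi c' ->
  ratder (fun s => phi s * psi s) (phi 0 * c' + psi 0 * c).
Proof.
move=> [P [Q [Q0 e ->]]] [P' [Q' [Q0' e' ->]]]; exists (P * P'), (Q * Q'); split.
- by rewrite hornerM mulf_neq0.
- move=> s; rewrite hornerM mulf_eq0 negb_or => /andP[Qs Qs'].
  by rewrite e // e' // !hornerM mulf_div.
- by rewrite e // e' // !derivM !hornerD !hornerM; field; apply/andP.
Qed.

Lemma ratder_cst c : ratder (fun=> c) 0.
Proof. by apply: (ratder_affine (a := c)) => s; rewrite mulr0 addr0. Qed.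

Section Directional.
Variable V : vectType K.

(** [dP a b] is the derivative of P at a along b. It is built by induction on P, since its
    regularity in a and b together is needed as well as its value. *)
Lemma polyfun_der (P : V -> K) : polyfun (@linear_forms K V) P ->
  exists dP : V -> V -> K,
    (forall T (M : cspace K T) x (u v : T -> V), ringed M -> dom M x ->
       morph_at M (aff V) u x -> morph_at M (aff V) v x ->
       regat M x (fun y => dP (u y) (v y))) /\
    forall a b, exists p : {poly K},
      (forall s, P (a + s *: b) = p.[s]) /\ p^`().[0] = dP a b.
Proof.
elim=> [_ [l ->]|c|f g pf [df [rf ef]] pg [dg [rg eg]]|f g pf [df [rf ef]] pg [dg [rg eg]]].
- exists (fun _ b => l b); split.
    by move=> T M x u v rM Mx _ mv; exact: morph_at_aff_linear.
  move=> a b; exists ((l a : K)%:P + (l b : K) *: 'X); split.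
    by move=> s; rewrite hornerD hornerC hornerZ hornerX linearD linearZ [in RHS]mulrC.
  by rewrite derivD derivC derivZ derivX add0r hornerZ hornerC mulr1.
- exists (fun _ _ => 0); split.
    by move=> T M x u v rM Mx _ _; exact: regat_cst.
  by move=> a b; exists c%:P; split=> [s|]; rewrite ?derivC ?hornerC.
- exists (fun a b => df a b + dg a b); split.
    by move=> T M x u v rM Mx mu mv; apply: (regat_add rM Mx); [exact: rf|exact: rg].
  move=> a b; have [p1 [e1 d1]] := ef a b; have [p2 [e2 d2]] := eg a b.
  exists (p1 + p2); split=> [s|]; first by rewrite e1 e2 hornerD.
  by rewrite derivD hornerD d1 d2.
- exists (fun a b => df a b * g a + f a * dg a b); split.
    move=> T M x u v rM Mx mu mv.
    have rp k : polyfun (@linear_forms K V) k -> regat M x (fun y => k (u y)).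
      by move=> pk; apply: (morph_regat mu); exact: regat_aff.
    by apply: (regat_add rM Mx); apply: (regat_mul rM Mx); try exact: rp; [exact: rf|exact: rg].
  move=> a b; have [p1 [e1 d1]] := ef a b; have [p2 [e2 d2]] := eg a b.
  exists (p1 * p2); split=> [s|]; first by rewrite e1 e2 hornerM.
  have := e1 0; have := e2 0; rewrite !scale0r !addr0 => -> ->.
  by rewrite derivM hornerD !hornerM d1 d2.
Qed.

(** The derivative is taken at a moving point [u] along a moving vector [v]. The second part says
    that it exists near y and not only at y, as differentiating a derivative requires. *)
Lemma regat_der T (M : cspace K T) y (u v : T -> V) phi : ringed M -> dom M y ->
  regat (aff V) (u y) phi -> morph_at M (aff V) u y -> morph_at M (aff V) v y ->
  regat M y (fun z => der (fun s => phi (u z + s *: v z))) /\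
  exists w, [/\ regat M y w, w y != 0 & forall z, w z != 0 ->
    exists c, ratder (fun s => phi (u z + s *: v z)) c].
Proof.
move=> rM My [P [Q [pP pQ Q0 e]]] mu mv.
have [dP [rP eP]] := polyfun_der pP; have [dQ [rQ eQ]] := polyfun_der pQ.
have rp k : polyfun (@linear_forms K V) k -> regat M y (fun z => k (u z)).
  by move=> pk; apply: (morph_regat mu); exact: regat_aff.
have rd z : Q (u z) != 0 -> ratder (fun s => phi (u z + s *: v z))
    ((dP (u z) (v z) * Q (u z) - P (u z) * dQ (u z) (v z)) / Q (u z) ^+ 2).
  move=> Qz; have [p1 [e1 <-]] := eP (u z) (v z); have [p2 [e2 <-]] := eQ (u z) (v z).
  have z1 := e1 0; have z2 := e2 0; rewrite !scale0r !addr0 in z1 z2.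
  exists p1, p2; split; rewrite -?z2 -?z1 // => s.
  by rewrite -e2 -e1; exact: e.
split; last first.
  exists (fun z => Q (u z)); split=> //; first exact: rp.
  by move=> z /rd; eexists; eassumption.
have dPr := rP _ _ _ _ _ rM My mu mv; have dQr := rQ _ _ _ _ _ rM My mu mv.
apply: (regat_div rM My (f := fun z => dP (u z) (v z) * Q (u z) - P (u z) * dQ (u z) (v z))
   (g := fun z => Q (u z) ^+ 2)).
- apply: (regat_sub rM My); apply: (regat_mul rM My) => //; exact: rp.
- by apply: (regat_mul rM My); exact: rp.
- by rewrite expf_neq0.
- by move=> z _; rewrite expf_eq0 /= => /rd; exact: der_eq.
Qed.

Lemma ratder_regat x v phi : regat (aff V) x phi ->
  exists c, ratder (fun s => phi (x + s *: v)) c.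
Proof.
move=> rphi; have ra := @ringed_aff K V.
have [_ [w [_ wx]]] := regat_der (u := id) (v := fun=> v) (y := x) ra I rphi
  (@morph_at_id _ _ (aff V) x I) (@morph_at_cst _ _ _ (aff V) (aff V) v x ra I I).
by apply.
Qed.

Lemma ratder_der x v phi : regat (aff V) x phi ->
  ratder (fun s => phi (x + s *: v)) (der (fun s => phi (x + s *: v))).
Proof. by move=> /(ratder_regat v)[c hc]; rewrite (der_eq hc). Qed.

Lemma tangent_der x v : tangent (aff V) x (fun phi => der (fun s => phi (x + s *: v))).
Proof.
move=> f rf; split=> [c|k rk].
  apply: der_eq; have := ratder_mul (ratder_cst c) (ratder_der v rf).
  by rewrite mulr0 addr0.
split; first exact: der_eq (ratder_add (ratder_der v rf) (ratder_der v rk)).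
apply: der_eq; have := ratder_mul (ratder_der v rf) (ratder_der v rk).
by rewrite !scale0r !addr0.
Qed.

End Directional.
End RationalDerivative.

Section Tangents.
Variables (K : fieldType) (T : Type) (M : cspace K T) (x : T).
Hypotheses (rM : ringed M) (Mx : dom M x).
Implicit Type D : (T -> K) -> K.

Lemma tangentZ D c f : tangent M x D -> regat M x f -> D (fun y => c * f y) = c * D f.
Proof. by move=> tD /tD[]. Qed.
Lemma tangentD D f g : tangent M x D -> regat M x f -> regat M x g ->
  D (fun y => f y + g y) = D f + D g.
Proof. by move=> tD rf rg; have [_ /(_ g rg)[]] := tD f rf. Qed.
Lemma tangentM D f g : tangent M x D -> regat M x f -> regat M x g ->
  D (fun y => f y * g y) = f x * D g + g x * D f.
Proof. by move=> tD rf rg; have [_ /(_ g rg)[]] := tD f rf. Qed.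

Lemma tangent_cst D c : tangent M x D -> D (fun=> c) = 0.
Proof.
move=> tD; have r1 := regat_cst rM 1 Mx; have := tangentM tD r1 r1.
have -> : (fun y : T => 1 * 1) = (fun=> 1 : K) by apply/funext => y; rewrite mulr1.
rewrite !mul1r => /eqP; rewrite -subr_eq0 opprD addrA subrr add0r oppr_eq0 => /eqP D1.
have -> : (fun _ : T => c) = (fun y => c * (fun=> 1) y) by apply/funext => y; rewrite mulr1.
by rewrite (tangentZ _ tD r1) D1 mulr0.
Qed.

(* Tangent vectors are defined on total functions, but depend only on germs. *)
Lemma tangent_near D f f' w : tangent M x D -> regat M x f -> regat M x f' ->
  regat M x w -> w x != 0 -> (forall y, dom M y -> w y != 0 -> f y = f' y) ->
  D f = D f'.
Proof.
move=> tD rf rf' rw wx e.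
pose u y := f y + (-1) * f' y.
have rN : regat M x (fun y => (-1) * f' y) by apply: (regat_mul rM Mx) => //; exact: regat_cst.
have ru : regat M x u by exact: (regat_add rM Mx).
(* The indicator of the domain makes the product of f - f' with [v] zero as a total function; the
   Leibniz rule at x then leaves w x times the value of D at f - f'. *)
pose v y := w y * (y \in dom M)%:R : K.
have rv : regat M x v.
  by apply: (regat_ext rM Mx rw) => y My; rewrite /v mem_set // mulr1.
have uv0 : (fun y => u y * v y) = (fun=> 0).
  apply/funext => y; rewrite /u /v; case: (boolP (y \in dom M)) => [/set_mem My|_]; last by rewrite !mulr0.
  case: (eqVneq (w y) 0) => [->|wy]; first by rewrite mul0r mulr0.
  by rewrite e // mulN1r subrr mul0r.
have ux : u x = 0 by rewrite /u e // mulN1r subrr.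
have := tangentM tD ru rv; rewrite uv0 (tangent_cst _ tD) ux mul0r add0r.
rewrite /v mem_set // mulr1 => /esym/eqP; rewrite mulf_eq0 (negbTE wx) /= => /eqP Du.
by move: Du; rewrite /u (tangentD tD rf rN) (tangentZ _ tD rf') mulN1r => /eqP; rewrite subr_eq0 => /eqP.
Qed.

Lemma tangent_ext D f f' : tangent M x D -> regat M x f ->
  (forall y, dom M y -> f y = f' y) -> D f = D f'.
Proof.
move=> tD rf e; have rf' : regat M x f'.
  by apply: (regat_ext rM Mx rf) => y My; rewrite e.
apply: (tangent_near tD rf rf' (regat_cst rM 1 Mx)); first exact: oner_neq0.
by move=> y My _; exact: e.
Qed.

End Tangents.

Section AffineTangents.
Variables (K : fieldType) (m n : nat).
Local Notation V := 'M[K]_(m, n).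

Lemma polyfun_sum T (gens : set (T -> K)) (J : Type) (r : seq J) (F : J -> T -> K) :
  (forall i, polyfun gens (F i)) -> polyfun gens (fun x => \sum_(i <- r) F i x).
Proof.
move=> pF; elim: r => [|i r IH].
  have -> : (fun x => \sum_(i <- [::]) F i x) = (fun=> 0) by apply/funext => x; rewrite big_nil.
  exact: polyfun_cst.
have -> : (fun x => \sum_(j <- i :: r) F j x) = (fun x => F i x + \sum_(j <- r) F j x).
  by apply/funext => x; rewrite big_cons.
exact: polyfun_add.
Qed.

Definition mx_entries : set (V -> K) := [set f : V -> K | exists i j, f = (fun X : V => X i j)].

Lemma polyfun_mx_entries f : polyfun (@linear_forms K V) f -> polyfun mx_entries f.
Proof.
elim=> [_ [l ->]|c|? ? _ ? _ ?|? ? _ ? _ ?].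
- have -> : (l : V -> K) = (fun X : V => \sum_i \sum_j X i j * l (delta_mx i j)).
    apply/funext => X; rewrite {1}[X]matrix_sum_delta linear_sum; apply: eq_bigr => i _.
    by rewrite linear_sum; apply: eq_bigr => j _; rewrite linearZ.
  apply: polyfun_sum => i; apply: polyfun_sum => j; apply: polyfun_mul; last exact: polyfun_cst.
  by apply: polyfun_gen; exists i, j.
- exact: polyfun_cst.
- exact: polyfun_add.
- exact: polyfun_mul.
Qed.

Lemma regat_entry (X : V) i j : regat (aff V) X (fun X : V => X i j).
Proof. exact: ((mxregP (@ringed_aff K V) (x := X) I id).2 (@morph_at_id _ _ (aff V) X I)). Qed.

(** Matrix entries generate the polynomials, and the value on a quotient f = P / Q follows from the
    Leibniz rule for Q f = P. *)
Lemma tangent_determined (X : V) D D' : tangent (aff V) X D -> tangent (aff V) X D' ->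
  (forall i j, D (fun X : V => X i j) = D' (fun X : V => X i j)) ->
  forall f, regat (aff V) X f -> D f = D' f.
Proof.
move=> tD tD' e f rf; have [P [Q [pP pQ QX h]]] := rf.
have ra := @ringed_aff K V; have IX : dom (aff V) X by [].
have key k : polyfun (@linear_forms K V) k -> D k = D' k.
  move=> /polyfun_mx_entries pk.
  have rg u : mx_entries u -> regat (aff V) X u by move=> [i [j ->]]; exact: regat_entry.
  elim: pk => [_ [i [j ->]]|c|u v pu IHu pv IHv|u v pu IHu pv IHv].
  - exact: e.
  - by rewrite !(tangent_cst ra IX).
  - by rewrite (tangentD tD) ?(tangentD tD') ?IHu ?IHv //; exact: (regat_polyfun ra IX rg).
  - by rewrite (tangentM tD) ?(tangentM tD') ?IHu ?IHv //; exact: (regat_polyfun ra IX rg).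
have rQ := regat_aff X pQ; have rP := regat_aff X pP.
have eq D0 : tangent (aff V) X D0 -> Q X * D0 f = D0 P - f X * D0 Q.
  move=> t0; have := tangentM t0 rQ rf.
  rewrite (tangent_near ra IX t0 (regat_mul ra IX rQ rf) rP rQ QX); last first.
    by move=> Y _ QY; rewrite h // mulrCA mulfV // mulr1.
  by move=> ->; rewrite addrK.
by apply: (mulfI QX); rewrite !eq // !key.
Qed.

End AffineTangents.

Lemma regat_of_subsp (K : fieldType) T (M : cspace K T) (A : set T) x f :
  ringed M -> zopen M A -> dom M x -> A x -> regat (subsp M A) x f -> regat M x f.
Proof.
move=> rM oA Mx Ax [f' rf e]; have [w [rw wx wA]] := regat_indicator oA Mx Ax.
by apply: (regat_near rM Mx rw wx rf) => y My /wA Ay; exact: e.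
Qed.

(** * The Lie bracket of the twisted product *)

Section TwistedProduct.
Variables (K : fieldType) (p q : nat).
Local Notation g := 'M[K]_(q + p).
Local Notation h := ('M[K]_(q + p) * 'M[K]_(q + p))%type.
Implicit Types (X Y Z : g) (t s : K).

Lemma cab_false_neq0 t : cab false t != 0. Proof. exact: cab_neq0. Qed.

(** The chart [false] realizes the twisted product of any parameter t inside pairs of matrices, so
    its algebraic identities follow from those of matrices by injectivity of [Tab]. *)
Lemma pmul_Tab_false t X Y :
  pmul (Tab (cab false t) X) (Tab (cab false t) Y) = Tab (cab false t) (twist t X Y).
Proof. by rewrite pmul_Tab /= mulr1. Qed.

Lemma twist1r t X : twist t X 1%:M = X.
Proof. by apply: (Tab_inj (cab_false_neq0 t)); rewrite -pmul_Tab_false Tab1 pmul1r. Qed.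

Lemma twist1l t X : twist t 1%:M X = X.
Proof. by apply: (Tab_inj (cab_false_neq0 t)); rewrite -pmul_Tab_false Tab1 pmul1l. Qed.

Lemma pmulDZr (a u v : h) s : pmul a (u + s *: v) = pmul a u + s *: pmul a v.
Proof. by congr (_, _); rewrite /= mulmxDr -scalemxAr. Qed.

Lemma pmulDZl (a u v : h) s : pmul (u + s *: v) a = pmul u a + s *: pmul v a.
Proof. by congr (_, _); rewrite /= mulmxDl -scalemxAl. Qed.

Lemma twistDZr t X Y Z s : twist t X (Y + s *: Z) = twist t X Y + s *: twist t X Z.
Proof.
apply: (Tab_inj (cab_false_neq0 t)).
by rewrite -pmul_Tab_false !TabD !TabZ pmulDZr !pmul_Tab_false.
Qed.

Lemma twistDZl t X Y Z s : twist t (Y + s *: Z) X = twist t Y X + s *: twist t Z X.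
Proof.
apply: (Tab_inj (cab_false_neq0 t)).
by rewrite -pmul_Tab_false !TabD !TabZ pmulDZl !pmul_Tab_false.
Qed.

Lemma morph_at_twist t Y X : morph_at (aff g) (aff g) (fun X => twist t X Y) X.
Proof.
have ra := @ringed_aff K g; apply/mxregP => //.
have rX : mxreg (aff g) X (fun X => X).
  by apply/mxregP => //; exact: morph_at_id.
by apply: mxreg_block => //; apply: mxreg_add => //;
  try (apply: mxreg_scale; rewrite //=; first exact: (regat_cst ra));
  apply: mxreg_mul => //;
  by [exact: mxreg_ulsub|exact: mxreg_ursub|exact: mxreg_dlsub|exact: mxreg_drsub|exact: mxreg_cst].
Qed.

Hypothesis infK : infinite_field K.

Definition der1 X (phi : g -> K) : K := der (fun s => phi (1%:M + s *: X)).

Lemma tangent_der1 X : tangent (aff g) 1%:M (der1 X).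
Proof. exact: tangent_der. Qed.

Lemma der1_entry X i j : der1 X (fun Z => Z i j) = X i j.
Proof.
apply: (der_eq infK); apply: (@ratder_affine K _ ((1%:M : g) i j)) => s.
by rewrite mxE [X in _ + X]mxE.
Qed.

(* X + s (X . Y) = X . (1 + s Y) for the twisted product of parameter t. *)
Definition left_der t Y (phi : g -> K) (X : g) : K :=
  der (fun s => phi (X + s *: twist t X Y)).

Lemma left_der_regat t Y phi : regat (aff g) 1%:M phi ->
  regat (aff g) 1%:M (left_der t Y phi) /\
  exists w, [/\ regat (aff g) 1%:M w, w 1%:M != 0 & forall X, w X != 0 ->
    ratder (fun s => phi (X + s *: twist t X Y)) (left_der t Y phi X)].
Proof.
move=> rphi; have ra := @ringed_aff K g.
have [r [w [rw w1 wd]]] := regat_der infK (u := id) (v := fun X => twist t X Y)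
  (y := 1%:M : g) ra I rphi (@morph_at_id _ _ (aff g) 1%:M I) (@morph_at_twist t Y 1%:M).
split=> //; exists w; split=> // X /wd[c hc].
by rewrite /left_der (der_eq infK hc).
Qed.

Lemma left_der1 t Y phi : left_der t Y phi 1%:M = der1 Y phi.
Proof. by rewrite /left_der /der1; congr der; apply/funext => s; rewrite twist1l. Qed.

Definition bracket_der t X Y (phi : g -> K) : K :=
  der1 X (left_der t Y phi) - der1 Y (left_der t X phi).

(** Each composite of two derivations satisfies the Leibniz rule up to cross terms symmetric in the
    two directions, which cancel in the bracket. The functions [w] and [u] mark where the inner
    derivatives exist. *)
Lemma tangent_bracket t X Y : tangent (aff g) 1%:M (bracket_der t X Y).
Proof.
have ra := @ringed_aff K g; have I1 : dom (aff g) 1%:M by [].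
move=> f rf.
have lin Z Z' c : der1 Z (left_der t Z' (fun y => c * f y)) = c * der1 Z (left_der t Z' f).
  have [rl [w [rw w1 wd]]] := left_der_regat t Z' rf.
  have rc := regat_mul ra I1 (regat_cst ra c I1) rf.
  have [rl' _] := left_der_regat t Z' rc.
  rewrite -(tangentZ c (tangent_der1 Z) rl).
  apply: (tangent_near ra I1 (tangent_der1 Z) rl' (regat_mul ra I1 (regat_cst ra c I1) rl) rw w1).
  move=> A _ /wd hA; apply: (der_eq infK).
  by have := ratder_mul (ratder_cst c) hA; rewrite mulr0 addr0.
split=> [c|k rk]; first by rewrite /bracket_der !lin mulrBr.
have add Z Z' : der1 Z (left_der t Z' (fun y => f y + k y)) =
    der1 Z (left_der t Z' f) + der1 Z (left_der t Z' k).
  have [rl [w [rw w1 wd]]] := left_der_regat t Z' rf.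
  have [rlk [u [ru u1 ud]]] := left_der_regat t Z' rk.
  have [rl' _] := left_der_regat t Z' (regat_add ra I1 rf rk).
  rewrite -(tangentD (tangent_der1 Z) rl rlk).
  apply: (tangent_near ra I1 (tangent_der1 Z) rl' (regat_add ra I1 rl rlk) (regat_mul ra I1 rw ru)).
    by rewrite mulf_neq0.
  move=> A _; rewrite mulf_eq0 negb_or => /andP[/wd hA /ud hA'].
  by apply: (der_eq infK); exact: ratder_add.
have leib Z Z' : der1 Z (left_der t Z' (fun y => f y * k y)) =
    f 1%:M * der1 Z (left_der t Z' k) + der1 Z' k * der1 Z f +
    (k 1%:M * der1 Z (left_der t Z' f) + der1 Z' f * der1 Z k).
  have [rl [w [rw w1 wd]]] := left_der_regat t Z' rf.
  have [rlk [u [ru u1 ud]]] := left_der_regat t Z' rk.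
  have [rl' _] := left_der_regat t Z' (regat_mul ra I1 rf rk).
  have r1 := regat_mul ra I1 rf rlk; have r2 := regat_mul ra I1 rk rl.
  have e := tangentD (tangent_der1 Z) r1 r2.
  rewrite (tangentM (tangent_der1 Z) rf rlk) (tangentM (tangent_der1 Z) rk rl) !left_der1 in e.
  apply: etrans e.
  apply: (tangent_near ra I1 (tangent_der1 Z) rl' (regat_add ra I1 r1 r2) (regat_mul ra I1 rw ru)).
    by rewrite mulf_neq0.
  move=> A _; rewrite mulf_eq0 negb_or => /andP[/wd hA /ud hA'].
  apply: (der_eq infK); have := ratder_mul hA hA'.
  by rewrite !scale0r !addr0.
split; first by rewrite /bracket_der (add X Y) (add Y X) opprD addrACA.
have calc (f1 k1 a b c d e1 e2 e3 e4 : K) :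
  f1 * a + e1 * e2 + (k1 * b + e3 * e4) - (f1 * c + e4 * e3 + (k1 * d + e2 * e1)) =
  f1 * (a - c) + k1 * (b - d) by ring.
by rewrite /bracket_der (leib X Y) (leib Y X); exact: calc.
Qed.

Lemma bracket_der_entry t X Y i j :
  bracket_der t X Y (fun Z => Z i j) = (twist t X Y - twist t Y X) i j.
Proof.
have e Z : left_der t Z (fun A => A i j) = (fun A => (twist t A Z) i j).
  apply/funext => A; apply: (der_eq infK); apply: (@ratder_affine K _ (A i j)) => s.
  by rewrite mxE [X in _ + X]mxE.
have f Z Z' : der1 Z (fun A => (twist t A Z') i j) = (twist t Z Z') i j.
  apply: (der_eq infK); apply: (@ratder_affine K _ (Z' i j)) => s.
  by rewrite twistDZl twist1l mxE [X in _ + X]mxE.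
by rewrite /bracket_der !e !f !mxE.
Qed.

(** Two tangent vectors at 1 with the same values on matrix entries, where the second derivatives
    reduce to the twisted product. *)
Lemma bracket_derE t X Y phi : regat (aff g) 1%:M phi ->
  bracket_der t X Y phi = der1 (twist t X Y - twist t Y X) phi.
Proof.
apply: tangent_determined; [exact: tangent_bracket|exact: tangent_der1|].
by move=> i j; rewrite bracket_der_entry der1_entry.
Qed.

End TwistedProduct.

(** * The family of Lie algebras over the affine line *)

Section LieFamily.
Variables (K : fieldType) (p q : nat) (i0 : 'I_q) (j0 : 'I_p).
Hypothesis infK : infinite_field K.
Local Notation g := 'M[K]_(q + p).
Local Notation h := ('M[K]_(q + p) * 'M[K]_(q + p))%type.
Local Notation base_space := (base_space K p q).
Local Notation total_points := (@total_points K p q).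
Local Notation total_space := (total_space K p q).
Local Notation total_one := (@total_one K p q).
Local Notation Tco := (Tco i0 j0 false).
Local Notation Tabf t := (Tab (cab false t)).

Definition total_ops : fam_ops ({vspace h} * h)%type {vspace h} :=
  FamOps fst (@total_mul K p q) total_one (@total_inv K p q).

Definition affine_point (t : K) : {vspace h} := Wab p q (cab false t).

Definition fiber_sp t := fiber total_space fst (affine_point t).

Lemma ringed_fiber t : ringed (fiber_sp t).
Proof. by apply: ringed_subsp; exact: ringed_total. Qed.

Lemma total_oneE t : total_one (affine_point t) = (affine_point t, Tabf t 1%:M).
Proof. by rewrite Tab1. Qed.

Lemma dom_total_one t : dom total_space (total_one (affine_point t)).
Proof. by apply: dom_total; apply: total_points_one; exact: base_points_chart. Qed.

Lemma dom_fiber_one t : dom (fiber_sp t) (total_one (affine_point t)).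
Proof. by split=> //; exact: dom_total_one. Qed.

Lemma fiber_regat t f : regat (fiber_sp t) (total_one (affine_point t)) f ->
  regat (aff g) 1%:M (fun X => f (affine_point t, Tabf t X)).
Proof.
rewrite total_oneE => rf; have ra := @ringed_aff K g.
have rX (X : g) : mxreg (aff g) X (fun X => X).
  by apply/mxregP => //; exact: morph_at_id.
have mT X : morph_at (aff g) (aff h) (fun X => Tabf t X) X.
  by apply: morph_at_Tab => //; exact: (regat_cst ra).
pose A : set g := [set X : g | punit (Tabf t X)].
have oA : zopen (aff g) A by apply: zopen_punit => // X _; exact: mT.
have A1 : A 1%:M by rewrite /A /= Tab1; exact: punit1.
apply: (regat_of_subsp ra oA I A1).
have rA : ringed (subsp (aff g) A) by exact: ringed_subsp.
have tA X : A X -> total_points (affine_point t, Tabf t X).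
  by move=> AX; split; [exact: base_points_chart|split=> //; exact: mem_Tab].
have m : morph_at (subsp (aff g) A) (fiber_sp t) (fun X => (affine_point t, Tabf t X)) 1%:M.
  apply: morph_at_subcod => //.
    by move=> X [_ AX]; split=> //; apply: dom_total; exact: tA.
  apply: to_total => //; first by move=> X [_ AX]; exact: tA.
    by apply: morph_at_cst => //; apply: dom_Gr_Wab; exact: cab_neq0.
  by apply: morph_at_subdom.
exact: (morph_regat m rf).
Qed.

Lemma morph_at_Lam_total y : dom total_space y ->
  morph_at total_space (aff g) (fun y => Lam false y.2) y.
Proof.
move=> dy; have rt := ringed_total K p q.
by apply/(mxregP rt dy); apply: (morph_at_Lam rt dy); exact: total_snd.
Qed.

Lemma regat_Lam_fiber t phi : regat (aff g) 1%:M phi ->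
  regat (fiber_sp t) (total_one (affine_point t)) (fun y => phi (Lam false y.2)).
Proof.
move=> rphi; have m : morph_at (fiber_sp t) (aff g) (fun y => Lam false y.2) (total_one (affine_point t)).
  by apply: morph_at_subdom; apply: morph_at_Lam_total; exact: dom_total_one.
have e : Lam false (total_one (affine_point t)).2 = 1%:M by rewrite total_oneE LamK.
by apply: (morph_regat m); rewrite e.
Qed.

(** With [tangent_pull], this identifies the tangent space of the fiber at its identity with that of
    the matrix space at 1, through the mutually inverse maps [Tab] and [Lam]. *)
Lemma tangent_push t D : tangent (aff g) 1%:M D ->
  tangent (fiber_sp t) (total_one (affine_point t))
    (fun f => D (fun X => f (affine_point t, Tabf t X))).
Proof.
move=> tD f /fiber_regat rf; have [h1 h2] := tD _ rf; split=> [c|k /fiber_regat rk].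
  exact: h1.
by have [h3 h4] := h2 _ rk; rewrite total_oneE.
Qed.

Lemma tangent_pull t D : tangent (fiber_sp t) (total_one (affine_point t)) D ->
  tangent (aff g) 1%:M (fun phi => D (fun y => phi (Lam false y.2))).
Proof.
move=> tD f /(regat_Lam_fiber t) rf; have [h1 h2] := tD _ rf; split=> [c|k /(regat_Lam_fiber t) rk].
  exact: h1.
have [h3 h4] := h2 _ rk; split; first exact: h3.
by have <- : Lam false (total_one (affine_point t)).2 = 1%:M by rewrite total_oneE LamK.
Qed.

Lemma tangent_fiberE t D f : tangent (fiber_sp t) (total_one (affine_point t)) D ->
  regat (fiber_sp t) (total_one (affine_point t)) f ->
  D f = D (fun y => f (affine_point t, Tabf t (Lam false y.2))).
Proof.
move=> tD rf; apply: (tangent_ext (ringed_fiber t) (dom_fiber_one t) tD rf).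
move=> [W w] [[_ [_ [wW _]]] WE]; have {}WE : W = affine_point t := WE; subst W.
by congr (f (_, _)); apply/esym; exact: TabK.
Qed.

Definition lie_section (s : K^o -> g) (W : {vspace h}) (f : {vspace h} * h -> K) : K :=
  der1 (s (Tco W)) (fun X => f (W, Tabf (Tco W) X)).

Lemma lie_sectionE s t f :
  lie_section s (affine_point t) f = der1 (s t) (fun X => f (affine_point t, Tabf t X)).
Proof. by rewrite /lie_section /affine_point Tco_Wab. Qed.

Lemma tangent_lie_section s t :
  tangent (fiber_sp t) (total_one (affine_point t)) (lie_section s (affine_point t)).
Proof.
have -> : lie_section s (affine_point t) =
    (fun f => der1 (s t) (fun X => f (affine_point t, Tabf t X))).
  by apply/funext => f; exact: lie_sectionE.
exact: (tangent_push (tangent_der1 infK (s t))).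
Qed.

Lemma affine_point_morph : morphism (aff K^o) base_space affine_point.
Proof.
move=> t _; have [_ m _ _] := @base_chart_iso K p q i0 j0 false.
have [_ h1] := m t (conj I I).
have ra := @ringed_aff K K^o.
split; first by apply: dom_base; exact: base_points_chart.
move=> u ru; apply: (regat_of_subsp (A := setT) ra (zopenT ra)) => //.
by apply: h1; exists u.
Qed.

(** In the chart K x g of the total space, the value of the section on f is the derivative at the
    moving point (r, 1) along (0, s r), so [regat_der] applies. *)
Lemma lie_section_regat s V t f : zopen (aff K^o) V -> V t ->
  morphism (subsp (aff K^o) V) (aff g) s -> regat total_space (total_one (affine_point t)) f ->
  regat base_space (affine_point t) (fun W => lie_section s W f).
Proof.
move=> oV Vt ms rf; have rb := ringed_base K p q; have ra := @ringed_aff K K^o.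
have rA := @ringed_aff K (K^o * g)%type.
pose phi (z : K^o * g) := f (chart_map false z).
have rphi : regat (aff (K^o * g)%type) (t, 1%:M) phi.
  have u1 : punit (Tabf (t : K) (1%:M : g)) by rewrite Tab1; exact: punit1.
  have c1 : chart_dom false (t, 1%:M : g) := u1.
  apply: (regat_of_subsp rA (@zopen_chart K p q false) I c1).
  have m := @chart_map_morph K p q false (t, 1%:M) (conj I c1).
  by apply: (morph_regat m); move: rf; rewrite total_oneE.
have rV : ringed (subsp (aff K^o) V) by exact: ringed_subsp.
have dt : dom (subsp (aff K^o) V) t by [].
have mu : morph_at (subsp (aff K^o) V) (aff (K^o * g)%type) (fun r => (r, 1%:M : g)) t.
  apply: (morph_at_aff_pair rV dt); first exact: morph_at_incl.
  exact: morph_at_cst.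
have mv : morph_at (subsp (aff K^o) V) (aff (K^o * g)%type) (fun r => (0 : K^o, s r)) t.
  apply: (morph_at_aff_pair rV dt); first exact: morph_at_cst.
  exact: ms.
have [rd _] := regat_der infK rV dt (rphi : regat _ ((fun r => (r, 1%:M)) t) phi) mu mv.
pose psi (r : K^o) : K := der1 (s r) (fun X => f (affine_point r, Tabf (r : K) X)).
have rpsi : regat (aff K^o) t psi.
  apply: (regat_of_subsp ra oV I Vt).
  move: rd; congr regat; apply/funext => r; rewrite /psi /der1; congr der; apply/funext => x.
  have -> : (r, 1%:M) + x *: (0 : K^o, s r) = (r, 1%:M + x *: s r) :> K^o * g.
    by congr (_, _); rewrite /= scaler0 addr0.
  by [].
have dW : dom base_space (affine_point t) by apply: dom_base; exact: base_points_chart.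
have VW : Vset false (affine_point t) by exact: Vset_Wab.
have rT : regat base_space (affine_point t) (fun W => psi (Tco W)).
  have mT := morph_at_scalar rb dW (regat_Tco_base i0 j0 dW VW).
  by apply: (morph_regat mT); rewrite /affine_point Tco_Wab.
have [w [rw w1 wV]] := regat_indicator (@zopen_Vset_base K p q false) dW VW.
apply: (regat_near rb dW rw w1 rT) => W [_ bW] /wV VW'.
by rewrite {1}(Vset_base_chart i0 j0 bW VW') -/(affine_point _) lie_sectionE.
Qed.

Variables (br : g -> g -> g) (theta : g -> g).
Hypothesis contraction_twist : forall z X Y,
  contraction_bracket br theta z X Y = twist z X Y - twist z Y X.

Lemma lie_section_bracket s u t f : regat (fiber_sp t) (total_one (affine_point t)) f ->
  lie_section (fun z => contraction_bracket br theta z (s z) (u z)) (affine_point t) f =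
  lie_section s (affine_point t)
    (fun a => lie_section u (affine_point t) (fun b => f (total_mul a b))) -
  lie_section u (affine_point t)
    (fun a => lie_section s (affine_point t) (fun b => f (total_mul a b))).
Proof.
move=> /fiber_regat rf.
rewrite lie_sectionE contraction_twist -bracket_derE // /bracket_der.
have e Y : (fun X => lie_section Y (affine_point t)
     (fun b => f (total_mul (affine_point t, Tabf t X) b))) =
   left_der t (Y t) (fun X => f (affine_point t, Tabf t X)).
  apply/funext => X; rewrite lie_sectionE /der1 /left_der; congr der; apply/funext => x.
  by rewrite /total_mul /= pmul_Tab_false twistDZr twist1r.
by rewrite -!e !(lie_sectionE _ _ (fun a => _)).
Qed.

Lemma lie_family_iso : lie_sheaf_iso (aff K^o) base_space affine_point
  (contraction_family br theta) (lie_of_family total_space base_space total_ops).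
Proof.
have rt := ringed_total K p q; have rb := ringed_base K p q; have ra := @ringed_aff K K^o.
exists (fun _ => lie_section) => V oV _ iV.
have entries s t i j :
    lie_section s (affine_point t) (fun y => Lam false y.2 i j) = s t i j.
  rewrite lie_sectionE -[RHS](der1_entry infK); congr der1.
  by apply/funext => X; rewrite LamK.
split.
- move=> s ms W dW [t Vt tW]; subst W; split; first exact: tangent_lie_section.
  move=> f rf; exact: (lie_section_regat oV Vt ms rf).
- move=> s u ms mu; split=> [e W _ [t Vt <-] f _|e t Vt].
    by rewrite !lie_sectionE e.
  apply/matrixP => i j; rewrite -!entries; apply: e.
  + by apply: dom_base; exact: base_points_chart.
  + by exists t.
  + exact: (regat_Lam_fiber t (@regat_entry _ _ _ 1%:M i j)).
- move=> tau tS.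
  have dW t : dom base_space (affine_point t) by apply: dom_base; exact: base_points_chart.
  (* The preimage of a section: the matrix of a tangent vector is read from its values on the entry
     functions of the chart. *)
  pose s (t : K^o) : g := \matrix_(i, j) tau (affine_point t) (fun y => Lam false y.2 i j).
  exists s.
    move=> t [_ Vt]; have rV : ringed (subsp (aff K^o) V) by exact: ringed_subsp.
    have dt : dom (subsp (aff K^o) V) t by [].
    apply/(mxregP rV dt) => i j.
    have [_ rtau] := tS _ (dW t) (ex_intro2 _ _ t Vt erefl).
    have rL : regat total_space (total_one (affine_point t)) (fun y => Lam false y.2 i j).
      have d1 := dom_total_one t; have mL := morph_at_Lam_total d1.
      exact: (((mxregP rt d1 _).2 mL) i j).
    have m : morph_at (subsp (aff K^o) V) base_space affine_point t.
      by apply: morph_at_subdom; exact: affine_point_morph.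
    apply: (regat_ext rV dt (morph_regat m (rtau _ rL))) => r _.
    by rewrite mxE.
  move=> W _ [t Vt <-] f rf.
  have [tt _] := tS _ (dW t) (ex_intro2 _ _ t Vt erefl).
  rewrite lie_sectionE (tangent_fiberE tt rf).
  have rphi := fiber_regat rf.
  apply: (tangent_determined (tangent_der1 infK (s t)) (tangent_pull tt) _ rphi).
  by move=> i j; rewrite der1_entry // mxE.
- split.
  + move=> s u ms mu W _ [t Vt <-] f rf.
    rewrite /= !lie_sectionE; have rphi := fiber_regat rf.
    have t1 := tangent_der1 infK (s t); have t2 := tangent_der1 infK (u t).
    apply: (tangent_determined (tangent_der1 infK (s t + u t)) _ _ rphi (D' :=
        fun phi => der1 (s t) phi + der1 (u t) phi)).
      move=> k rk; split=> [c|k' rk']; first by rewrite !(tangentZ c _ rk) // mulrDr.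
      rewrite !(tangentD _ rk rk') // !(tangentM _ rk rk') //; split; ring.
    by move=> i j; rewrite !der1_entry // mxE.
  + move=> a s ra' ms W _ [t Vt <-] f rf.
    rewrite /= !lie_sectionE; have rphi := fiber_regat rf.
    have t1 := tangent_der1 infK (s t).
    apply: (tangent_determined (tangent_der1 infK (a (affine_point t) *: s t)) _ _ rphi (D' :=
        fun phi => a (affine_point t) * der1 (s t) phi)).
      move=> k rk; split=> [c|k' rk']; first by rewrite !(tangentZ c _ rk) // mulrCA.
      rewrite !(tangentD _ rk rk') // !(tangentM _ rk rk') //; split; ring.
    by move=> i j; rewrite !der1_entry // mxE.
  + move=> s u ms mu W _ [t Vt <-] f rf; exact: lie_section_bracket.
- by [].
Qed.

End LieFamily.

Lemma morphism_subcod (K : fieldType) T S (M : cspace K T) (N : cspace K S) A f :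
  ringed M -> morphism M N f -> (forall x, dom M x -> A (f x)) ->
  morphism M (subsp N A) f.
Proof.
move=> rM mf fA x Mx; apply: (morph_at_subcod rM Mx); last exact: mf.
by move=> y My; split; [have [] := mf y My|exact: fA].
Qed.

(** * Complex fibers *)

Section FiberGroups.
Variables (K : fieldType) (p q : nat) (i0 : 'I_q) (j0 : 'I_p).
Local Notation g := 'M[K]_(q + p).
Local Notation h := ('M[K]_(q + p) * 'M[K]_(q + p))%type.
Local Notation base_points := (@base_points K p q).
Local Notation total_points := (@total_points K p q).
Local Notation total_space := (total_space K p q).
Local Notation total_ops := (@total_ops K p q).
Implicit Types (c : K * K) (X Y : g) (w : h).

Lemma ringed_fiber_at W : ringed (fiber total_space fst W).
Proof. by apply: ringed_subsp; exact: ringed_total. Qed.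

Lemma fiber_snd W y : dom (fiber total_space fst W) y ->
  morph_at (fiber total_space fst W) (aff h) snd y.
Proof. by move=> [dy _]; apply: morph_at_subdom; exact: total_snd. Qed.

Lemma to_fiber T (M : cspace K T) W (f : T -> h) : ringed M ->
  base_points W -> (forall y, dom M y -> f y \in W /\ punit (f y)) ->
  morphism M (aff h) f -> morphism M (fiber total_space fst W) (fun y => (W, f y)).
Proof.
move=> rM bW fW mf y My.
have tW z : dom M z -> total_points (W, f z) by move=> /fW[? ?].
apply: (morph_at_subcod rM My).
  by move=> z Mz; split=> //; apply: dom_total; exact: tW.
apply: (to_total rM My) => //.
  by apply: morph_at_cst => //; exact: base_points_Gr.
exact: mf.
Qed.

(** The first projection is an isomorphism: dividing the off-diagonal blocks by c.1 and c.2 recovers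
    the coordinate matrix, and the second component is the conjugate of the first by diag(c.2 / c.1,
    1), hence invertible with it. *)
Lemma generic_fiber_iso W : open_base_points W ->
  group_iso (fiber_group total_space total_ops W)
            (GSpace (subsp (aff g) [set x | x \in unitmx]) mulmx).
Proof.
move=> [c [c1 c2 ->]].
have c0 : c != 0 by apply: contra_neq c1 => ->.
pose X (x : g) : g := block_mx (ulsubmx x) (c.1^-1 *: ursubmx x) (c.2^-1 *: dlsubmx x) (drsubmx x).
have X1 x : (Tab c (X x)).1 = x.
  by rewrite /X TabE /= !scalerA !mulfV // !scale1r submxK.
pose r := c.2 / c.1.
have X2 x : (Tab c (X x)).2 = block_mx r%:M 0 0 1%:M *m x *m block_mx r^-1%:M 0 0 1%:M.
  rewrite -[x in RHS]submxK !mulmx_block !(mulmx0, mul0mx, addr0, add0r, mul1mx, mulmx1).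
  rewrite !mul_scalar_mx !mul_mx_scalar /X TabE /= !scalerA mulVf ?scale1r; last first.
    by rewrite mulf_neq0 ?invr_eq0.
  by rewrite /r invf_div.
have r0 : r != 0 by rewrite mulf_neq0 ?invr_eq0.
have uX x : x \in unitmx -> punit (Tab c (X x)).
  move=> ux; split; rewrite ?X1 ?X2 // !unitmx_mul ux !block_diag_mx_unit !unitmx1 !unitmxE !det_scalar.
  by rewrite !unitfE !expf_neq0 ?invr_eq0.
have bW : base_points (Wab p q c) by exists c.
exists (fun y => y.2.1), (fun x => (Wab p q c, Tab c (X x))); split; last first.
  by move=> [W1 w1] [W2 w2].
have rG : ringed (subsp (aff g) [set x | x \in unitmx]) by apply: ringed_subsp; exact: ringed_aff.
split.
- apply: morphism_subcod; first exact: ringed_fiber_at; last first.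
    by move=> z [[_ [_ [_ [u1 _]]]] _].
  move=> y dy; have rW := ringed_fiber_at (Wab p q c); apply/(mxregP rW dy).
  by have [] := mxreg_h rW dy (fiber_snd dy).
- apply: to_fiber => //.
    by move=> x [_ ux]; split; [exact: mem_Tab|exact: uX].
  move=> x dx.
  have rx : mxreg (subsp (aff g) [set x | x \in unitmx]) x (fun x => x).
    by apply/(mxregP rG dx); exact: morph_at_incl.
  have rc a : regat (subsp (aff g) [set x | x \in unitmx]) x (fun=> a) by exact: regat_cst.
  apply: morph_at_Tab => //; apply: mxreg_block => //.
  + exact: mxreg_ulsub.
  + by apply: mxreg_scale => //; exact: mxreg_ursub.
  + by apply: mxreg_scale => //; exact: mxreg_dlsub.
  + exact: mxreg_drsub.
- move=> [V w] [[_ [_ [wW _]]] WE]; have {}WE : V = Wab p q c := WE.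
  subst V; congr (_, _); move: wW => /= /mem_WabP[Y ->].
  congr Tab; rewrite /X /Tab /= !(block_mxKul, block_mxKur, block_mxKdl, block_mxKdr).
  by rewrite !scalerA !mulVf // !scale1r submxK.
- by move=> x _; exact: X1.
Qed.

Lemma invmxM n (U V : 'M[K]_n) : U \in unitmx -> V \in unitmx ->
  invmx (U *m V) = invmx V *m invmx U.
Proof.
move=> uU uV; have uUV : U *m V \in unitmx by rewrite unitmx_mul uU.
by rewrite -[RHS](mulmxK uUV) mulmxA -[invmx V *m _ *m _]mulmxA mulVmx // mulmx1 mulVmx // mul1mx.
Qed.

Section SpecialFiber.
Variable e : bool.
Let c0 := cab e (0 : K).

Definition diag_part X : g := block_mx (ulsubmx X) 0 0 (drsubmx X).
Definition nil_part (B : 'M[K]_(q, p)) (D : 'M[K]_(p, q)) : h := Tab c0 (block_mx 0 B D 0).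
Definition nil_set : set h := [set P | exists B D, P = nil_part B D].
Definition diag_set : set g :=
  [set x | exists A D, [/\ A \in unitmx, D \in unitmx & x = block_mx A 0 0 D]].

Lemma pmul_Tab0 X Y : pmul (Tab c0 X) (Tab c0 Y) = Tab c0 (twist 0 X Y).
Proof. by rewrite pmul_Tab /c0; case: (e); rewrite /= ?mulr0 ?mul0r. Qed.

(** At t = 0 both components are block triangular with the same diagonal blocks. *)
Lemma punit_Tab0 X : punit (Tab c0 X) <-> ulsubmx X \in unitmx /\ drsubmx X \in unitmx.
Proof.
rewrite /punit /Tab /c0; case: (e); rewrite /= !scale0r !unitmxE det_ublock det_lblock unitrM;
by split=> [[/andP[? ?] _]|[-> ->]].
Qed.

Lemma Tab_diag c (A : 'M[K]_q) (D : 'M[K]_p) :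
  Tab c (block_mx A 0 0 D) = (block_mx A 0 0 D, block_mx A 0 0 D).
Proof. by rewrite TabE !scaler0. Qed.

Lemma twist0E (A A' : 'M[K]_q) (B B' : 'M[K]_(q, p)) (D D' : 'M[K]_(p, q)) (E E' : 'M[K]_p) :
  twist 0 (block_mx A B D E) (block_mx A' B' D' E') =
  block_mx (A *m A') (A *m B' + B *m E') (D *m A' + E *m D') (E *m E').
Proof.
by rewrite /twist !(block_mxKul, block_mxKur, block_mxKdl, block_mxKdr) !scale0r addr0 add0r.
Qed.

(** For the twisted product at t = 0, a unit [A, B; D, E] factors as (1 + n) k with k = diag(A, E)
    and n = [0, B E^-1; D A^-1, 0], and the product of two such n is zero; k and n are the two
    components of the isomorphism. *)
Lemma special_fiber_iso :
  group_iso (fiber_group total_space total_ops (Wab p q c0))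
    (semidirect (GSpace (subsp (aff g) diag_set) mulmx) (subsp (aff h) nil_set)
       (fun k P => pmul (pmul (k, k) P) (pinv (k, k)))).
Proof.
have cc0 : c0 != 0 by exact: cab_neq0.
have bW : base_points (Wab p q c0) by exists c0.
have rW := ringed_fiber_at (Wab p q c0).
have rA := @ringed_aff K g; have rh := @ringed_aff K h.
have rD : ringed (subsp (aff g) diag_set) by exact: ringed_subsp.
have rN : ringed (subsp (aff h) nil_set) by exact: ringed_subsp.
have rP : ringed (prodsp (subsp (aff g) diag_set) (subsp (aff h) nil_set)) by exact: ringed_prodsp.
pose L (y : {vspace h} * h) : g := Lam e y.2.
pose f (y : {vspace h} * h) : g * h :=
  (diag_part (L y), nil_part (ursubmx (L y) *m invmx (drsubmx (L y)))
                             (dlsubmx (L y) *m invmx (ulsubmx (L y)))).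
pose X (z : g * h) : g :=
  block_mx (ulsubmx z.1) (ursubmx (Lam e z.2) *m drsubmx z.1)
           (dlsubmx (Lam e z.2) *m ulsubmx z.1) (drsubmx z.1).
have LT y : dom (fiber total_space fst (Wab p q c0)) y ->
    [/\ y = (Wab p q c0, Tab c0 (L y)), ulsubmx (L y) \in unitmx & drsubmx (L y) \in unitmx].
  case: y => W w [[_ [_ [wW uw]]] WE]; have {}WE : W = Wab p q c0 := WE; subst W.
  have ew : Tab c0 (L (Wab p q c0, w)) = w by exact: TabK.
  have [u1 u2] : ulsubmx (L (Wab p q c0, w)) \in unitmx /\ drsubmx (L (Wab p q c0, w)) \in unitmx.
    by apply/punit_Tab0; rewrite ew.
  by split=> //; rewrite ew.
have rL y : dom (fiber total_space fst (Wab p q c0)) y ->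
    mxreg (fiber total_space fst (Wab p q c0)) y L.
  by move=> dy; apply: (morph_at_Lam rW dy); exact: fiber_snd.
have LX (z : g * h) : L (Wab p q c0, Tab c0 (X z)) = X z by exact: LamK.
exists f, (fun z => (Wab p q c0, Tab c0 (X z))); split; last first.
  move=> y y' /LT[ey u1 u2] /LT[ey' u1' u2'].
  have eL : L (total_mul y y') = twist 0 (L y) (L y').
    by rewrite [in LHS]ey [in LHS]ey' /total_mul /= pmul_Tab0; exact: LamK.
  rewrite /f /= eL.
  move: (L y) (L y') u1 u2 u1' u2' => x x' {eL ey ey'}.
  rewrite -[x]submxK -[x']submxK twist0E.
  move: (ulsubmx x) (ursubmx x) (dlsubmx x) (drsubmx x) => A B D E.
  move: (ulsubmx x') (ursubmx x') (dlsubmx x') (drsubmx x') => A' B' D' E'.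
  rewrite !(block_mxKul, block_mxKur, block_mxKdl, block_mxKdr) => uA uE uA' uE'.
  congr (_, _); rewrite /= /diag_part !(block_mxKul, block_mxKdr).
    by rewrite mulmx_block !(mulmx0, mul0mx, addr0, add0r).
  have uk : block_mx A 0 0 E \in unitmx by rewrite block_diag_mx_unit uA.
  (* The pair (k, k) and its inverse lie in W_c0, so the action of K can be computed with the
     twisted product. *)
  have -> : pinv (block_mx A 0 0 E, block_mx A 0 0 E) = Tab c0 (block_mx (invmx A) 0 0 (invmx E)).
    by rewrite Tab_diag /pinv /= invmx_block_diag.
  rewrite -(Tab_diag c0) /nil_part !pmul_Tab0 -TabD.
  rewrite [twist 0 (block_mx A 0 0 E) _]twist0E twist0E add_block_mx.
  rewrite !(mulmx0, mul0mx, addr0, add0r).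
  have eB : (A *m B' + B *m E') *m invmx (E *m E') =
      B *m invmx E + A *m (B' *m invmx E') *m invmx E.
    by rewrite invmxM // mulmxDl !mulmxA (mulmxK uE') addrC.
  have eD : (D *m A' + E *m D') *m invmx (A *m A') =
      D *m invmx A + E *m (D' *m invmx A') *m invmx A.
    by rewrite invmxM // mulmxDl !mulmxA (mulmxK uA').
  by rewrite eB eD.
split.
- move=> y dy; have [ey u1 u2] := LT y dy.
  have df z : dom (fiber total_space fst (Wab p q c0)) z ->
      dom (subsp (aff g) diag_set) (f z).1 /\ dom (subsp (aff h) nil_set) (f z).2.
    move=> /LT[ez v1 v2]; split; split=> //.
      by exists (ulsubmx (L z)), (drsubmx (L z)).
    by eexists; eexists.
  apply: (morph_at_pair rW dy) => //; apply: (morph_at_subcod rW dy).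
  + by move=> z /df[].
  + apply/(mxregP rW dy); apply: mxreg_block => //; try exact: mxreg_cst.
      by apply: mxreg_ulsub => //; exact: rL.
    by apply: mxreg_drsub => //; exact: rL.
  + by move=> z /df[].
  + apply: morph_at_Tab => //; try exact: regat_cst.
    apply: mxreg_block => //; try exact: mxreg_cst; apply: mxreg_mul => //.
    * by apply: mxreg_ursub => //; exact: rL.
    * by apply: mxreg_inv => //; apply: mxreg_drsub => //; exact: rL.
    * by apply: mxreg_dlsub => //; exact: rL.
    * by apply: mxreg_inv => //; apply: mxreg_ulsub => //; exact: rL.
- apply: to_fiber => //.
    move=> z [[_ [A [D [uA uD ez]]]] _]; split; first exact: mem_Tab.
    by apply/punit_Tab0; rewrite /X block_mxKul block_mxKdr ez block_mxKul block_mxKdr.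
  move=> z dz; case: (dz) => dz1 dz2.
  have r1 : mxreg (prodsp (subsp (aff g) diag_set) (subsp (aff h) nil_set)) z (fun z => z.1).
    apply/(mxregP rP dz); apply: (@morph_at_subcodW _ _ _ _ _ diag_set).
    by exact: morph_at_fst.
  have r2 : mxreg (prodsp (subsp (aff g) diag_set) (subsp (aff h) nil_set)) z (fun z => Lam e z.2).
    apply: (morph_at_Lam rP dz); apply: (@morph_at_subcodW _ _ _ _ _ nil_set).
    by exact: morph_at_snd.
  have rc a : regat (prodsp (subsp (aff g) diag_set) (subsp (aff h) nil_set)) z (fun=> a).
    exact: regat_cst.
  apply: (morph_at_Tab (c := fun=> c0) (X := X) rP dz (rc _) (rc _)); apply: mxreg_block => //.
  + exact: mxreg_ulsub.
  + by apply: mxreg_mul => //; [exact: mxreg_ursub|exact: mxreg_drsub].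
  + by apply: mxreg_mul => //; [exact: mxreg_dlsub|exact: mxreg_ulsub].
  + exact: mxreg_drsub.
- move=> y /LT[ey u1 u2].
  have eX : X (f y) = L y.
    have eN : Lam e (f y).2 = block_mx 0 (ursubmx (L y) *m invmx (drsubmx (L y)))
      (dlsubmx (L y) *m invmx (ulsubmx (L y))) 0 by exact: LamK.
    rewrite /X eN /f /diag_part !(block_mxKul, block_mxKur, block_mxKdl, block_mxKdr).
    by rewrite -!mulmxA !mulVmx // !mulmx1 submxK.
  by rewrite eX; exact: esym ey.
- move=> [k P] [[_ [A [D [uA uD /= ->]]]] [_ [B [E /= ->]]]].
  have eX : X (block_mx A 0 0 D, nil_part B E) = block_mx A (B *m D) (E *m A) D.
    have eN : Lam e (nil_part B E) = block_mx 0 B E 0 by exact: LamK.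
    by rewrite /X eN !(block_mxKul, block_mxKur, block_mxKdl, block_mxKdr).
  rewrite /f LX eX /diag_part !(block_mxKul, block_mxKur, block_mxKdl, block_mxKdr).
  by rewrite !mulmxK.
Qed.

End SpecialFiber.
End FiberGroups.

(** * Identification with the sets of the statement *)

Section Identification.
Variables (R : realType) (p q : nat).
Local Notation C := R[i].

Lemma complex_infinite : infinite_field C.
Proof. exact: numField_infinite. Qed.

(** Over the complex numbers every pair of nonzero scalars has the form (mu^2, nu^2). *)
Lemma X0setE : @X0set R p q = @open_base_points C p q.
Proof.
apply/seteqP; split=> W.
  move=> [_ [mu [nu [m0 n0 ->]]] ->].
  by exists (mu ^+ 2, nu ^+ 2); rewrite !expf_neq0 // Ad_g_zeta.
move=> [[a b] [/= a0 b0 ->]].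
have [m0 n0] : sqrtC a != 0 /\ sqrtC b != 0 by rewrite !sqrtC_eq0.
have e := Ad_g_zeta p q m0 n0; rewrite !sqrtCK in e.
by exists (zeta p q (sqrtC a) (sqrtC b)); [exists (sqrtC a), (sqrtC b)|rewrite e].
Qed.

Lemma G0setE : @G0set R p q = @open_total_points C p q.
Proof.
apply/seteqP; split=> -[W w].
  move=> [_ [[mu [nu [m0 n0 ->]]] /= -> [x ux ->]]].
  exists (mu ^+ 2, nu ^+ 2); rewrite !expf_neq0 // Ad_g_zeta //; split=> //.
    by rewrite -Ad_g_zeta //; apply/mem_Ad_g; exists x.
  have Hz := zeta_unit p q m0 n0.
  apply: punit_mul; last exact: punit_inv.
  by apply: punit_mul => //; split.
move=> [[a b] [/= a0 b0 -> wW Hw]].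
have [m0 n0] : sqrtC a != 0 /\ sqrtC b != 0 by rewrite !sqrtC_eq0.
have e := Ad_g_zeta p q m0 n0; rewrite !sqrtCK in e.
exists (zeta p q (sqrtC a) (sqrtC b)); split=> //.
  by exists (sqrtC a), (sqrtC b).
move: wW; rewrite -e => /mem_Ad_g[x wx]; exists x => //.
case: Hw => + _; rewrite wx /= !unitmx_mul => /andP[/andP[_ +] _]; exact.
Qed.

Section Entry.
Variables (i0 : 'I_q) (j0 : 'I_p).

Lemma XspE : Xsp R p q = base_space C p q.
Proof. by rewrite /Xsp X0setE (@closure_base _ p q complex_infinite). Qed.

Lemma bGE : bG R p q = total_space C p q.
Proof. by rewrite /bG G0setE (@closure_total _ p q i0 j0 complex_infinite). Qed.
End Entry.
End Identification.

(** * Real structure and real fibers *)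

Section Adjoint.
Variable F : numClosedFieldType.

Lemma ctM m n k (A : 'M[F]_(m, n)) (B : 'M[F]_(n, k)) : (A *m B) ^t* = B ^t* *m A ^t*.
Proof. by rewrite trmx_mul map_mxM. Qed.

Lemma ct_block m1 m2 n1 n2 (A : 'M[F]_(m1, n1)) (B : 'M[F]_(m1, n2))
    (D : 'M[F]_(m2, n1)) (E : 'M[F]_(m2, n2)) :
  (block_mx A B D E) ^t* = block_mx (A ^t*) (D ^t*) (B ^t*) (E ^t*).
Proof. by rewrite tr_block_mx map_block_mx. Qed.

Lemma ct0 m n : (0 : 'M[F]_(m, n)) ^t* = 0.
Proof. by rewrite trmx0 map_mx0. Qed.

Lemma ct1 n : (1%:M : 'M[F]_n) ^t* = 1%:M.
Proof. by rewrite trmx1 map_mx1. Qed.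

Lemma ctN m n (A : 'M[F]_(m, n)) : (- A) ^t* = - (A ^t*).
Proof. by apply/matrixP => i j; rewrite !mxE rmorphN. Qed.

Lemma ctZ m n a (A : 'M[F]_(m, n)) : (a *: A) ^t* = Num.conj a *: (A ^t*).
Proof. by apply/matrixP => i j; rewrite !mxE rmorphM. Qed.

Lemma ct_unit n (A : 'M[F]_n) : (A ^t* \in unitmx) = (A \in unitmx).
Proof. by rewrite map_unitmx unitmx_tr. Qed.

Lemma ct_inv n (A : 'M[F]_n) : invmx (A ^t*) = (invmx A) ^t*.
Proof. by rewrite trmx_inv map_invmx. Qed.

Variables p q : nat.
Local Notation g := 'M[F]_(q + p).
Local Notation h := ('M[F]_(q + p) * 'M[F]_(q + p))%type.

(** [sgnJ], [anti_inv] and [anti_pair] are [Jmx], [sigmaG] and [sigmaH] over an arbitrary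
    [numClosedFieldType]. *)
Definition sgnJ : g := block_mx 1%:M 0 0 (- 1%:M).

Lemma sgnJJ : sgnJ *m sgnJ = 1%:M.
Proof.
rewrite /sgnJ mulmx_block !(mulmx0, mul0mx, addr0, add0r, mulmx1) mulNmx mulmxN opprK mulmx1.
by rewrite -scalar_mx_block.
Qed.

Lemma sgnJ_unit : sgnJ \in unitmx.
Proof. by have [] := mulmx1_unit sgnJJ. Qed.

Lemma sgnJ_inv : invmx sgnJ = sgnJ.
Proof. by rewrite -[LHS]mulmx1 -sgnJJ mulmxA mulVmx ?sgnJ_unit // mul1mx. Qed.

Lemma ct_sgnJ : sgnJ ^t* = sgnJ.
Proof. by rewrite /sgnJ ct_block !ct0 ctN !ct1. Qed.

Definition anti_inv (x : g) : g := sgnJ *m invmx (x ^t*) *m sgnJ.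
Definition anti_pair (w : h) : h := (anti_inv w.2, anti_inv w.1).

Lemma anti_inv_unit x : x \in unitmx -> anti_inv x \in unitmx.
Proof. by move=> ux; rewrite /anti_inv !unitmx_mul sgnJ_unit unitmx_inv ct_unit ux. Qed.

Lemma anti_invM x y : x \in unitmx -> y \in unitmx ->
  anti_inv (x *m y) = anti_inv x *m anti_inv y.
Proof.
move=> ux uy; rewrite /anti_inv ctM invmxM ?ct_unit // !mulmxA.
by rewrite -[_ *m sgnJ *m sgnJ]mulmxA sgnJJ mulmx1.
Qed.

Lemma anti_invK x : x \in unitmx -> anti_inv (anti_inv x) = x.
Proof.
move=> ux; have uJ := sgnJ_unit.
have e : (anti_inv x) ^t* = sgnJ *m invmx x *m sgnJ.
  by rewrite /anti_inv !ctM ct_sgnJ -ct_inv trmxCK mulmxA.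
have e' : invmx (sgnJ *m invmx x *m sgnJ) = sgnJ *m x *m sgnJ.
  by rewrite invmxM ?unitmx_mul ?uJ ?unitmx_inv // invmxM ?unitmx_inv // invmxK sgnJ_inv mulmxA.
rewrite {1}/anti_inv e e' !mulmxA sgnJJ mul1mx.
by rewrite -mulmxA sgnJJ mulmx1.
Qed.

Lemma anti_pair_unit w : punit w -> punit (anti_pair w).
Proof. by move=> [u1 u2]; split; exact: anti_inv_unit. Qed.

Lemma anti_pairK w : punit w -> anti_pair (anti_pair w) = w.
Proof. by case: w => a b [/= u1 u2]; rewrite /anti_pair /= !anti_invK. Qed.

Lemma anti_pairM w w' : punit w -> punit w' ->
  anti_pair (pmul w w') = pmul (anti_pair w) (anti_pair w').
Proof. by move=> [u1 u2] [v1 v2]; rewrite /anti_pair /pmul /= !anti_invM. Qed.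

(** One equation suffices: it forces both components to be invertible, and its adjoint is the
    equation for the other component. *)
Lemma anti_pair_fixed w : punit w /\ anti_pair w = w <-> w.2 ^t* *m sgnJ *m w.1 = sgnJ.
Proof.
have key (u v : g) : v \in unitmx -> v ^t* *m sgnJ *m u = sgnJ -> anti_inv v = u.
  move=> uv e; have ucv : v ^t* \in unitmx by rewrite ct_unit.
  have e' : sgnJ *m u = invmx (v ^t*) *m sgnJ by rewrite -[in RHS]e -mulmxA mulKmx.
  by rewrite /anti_inv -mulmxA -e' mulmxA sgnJJ mul1mx.
case: w => u v /=; split.
  move=> [[uu uv] [e _]]; rewrite -e /anti_inv !mulmxA.
  rewrite -[_ *m sgnJ *m sgnJ]mulmxA sgnJJ mulmx1 mulmxV ?ct_unit //.
  by rewrite mul1mx.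
move=> e; have e1 : (sgnJ *m v ^t* *m sgnJ) *m u = 1%:M.
  by rewrite -2!mulmxA [v ^t* *m _]mulmxA e sgnJJ.
have [+ uu] := mulmx1_unit e1; rewrite !unitmx_mul ct_unit => /andP[/andP[_ uv] _].
split=> //; congr (_, _); apply: key => //=.
by have := congr1 (fun A : g => A ^t*) e; rewrite !ctM trmxCK ct_sgnJ mulmxA.
Qed.

(* The conjugate-transpose of a point of the family lies on the conjugate
   member of the family; hence so does the image of [anti_pair]. *)
Lemma anti_pair_Tab c (w : h) : punit w -> w \in Wab p q c ->
  anti_pair w \in Wab p q (Num.conj c.1, Num.conj c.2).
Proof.
move=> uw wW; have := mem_pinv wW uw => /mem_WabP[X eX].
have [e1 e2] : invmx w.1 = (Tab c X).1 /\ invmx w.2 = (Tab c X).2 by rewrite -eX.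
apply/mem_WabP; exists (block_mx ((ulsubmx X) ^t*) (- (dlsubmx X) ^t*)
                                 (- (ursubmx X) ^t*) ((drsubmx X) ^t*)).
rewrite /anti_pair /anti_inv !ct_inv e1 e2 TabE /Tab /= !ct_block !ctZ /sgnJ !mulmx_block.
rewrite !(mulmx0, mul0mx, addr0, add0r, mulmx1, mul1mx).
by rewrite !(mulNmx, mulmxN, mul1mx, mulmx1, opprK, scalerN).
Qed.

(** The equation of [anti_pair_fixed] written in the blocks of the coordinate matrix; the result is
    the same in both charts. *)
Definition realcond (s : F) (X : g) : Prop :=
  [/\ (ulsubmx X) ^t* *m ulsubmx X - s *: ((dlsubmx X) ^t* *m dlsubmx X) = 1%:M,
      (drsubmx X) ^t* *m drsubmx X - s *: ((ursubmx X) ^t* *m ursubmx X) = 1%:M &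
      (ursubmx X) ^t* *m ulsubmx X = (drsubmx X) ^t* *m dlsubmx X].

Lemma Tab_fixed e s X : Num.conj s = s ->
  punit (Tab (cab e s) X) /\ anti_pair (Tab (cab e s) X) = Tab (cab e s) X <-> realcond s X.
Proof.
move=> sr; rewrite anti_pair_fixed -[X]submxK /realcond !TabE.
rewrite !(block_mxKul, block_mxKur, block_mxKdl, block_mxKdr).
move: (ulsubmx X) (ursubmx X) (dlsubmx X) (drsubmx X) => A B D E.
rewrite /= ct_block /sgnJ !mulmx_block !(mulmx0, mul0mx, addr0, add0r, mulmx1).
rewrite !(mulmxN, mulNmx, mulmx1) !ctZ.
(* Of the two off-diagonal blocks of the equation, one carries the factor s, which may be zero. The
   condition comes from the other, and [adj] translates it when that is the upper right one. *)
have adj : B ^t* *m A = E ^t* *m D <-> A ^t* *m B = D ^t* *m E.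
  split=> e1; have := congr1 (fun M => M ^t*) e1; rewrite !ctM !trmxCK => <- //.
have sc x y m n k (U : 'M[F]_(m, n)) (V : 'M[F]_(n, k)) :
    (x *: U) *m (y *: V) = (x * y) *: (U *m V).
  by rewrite -scalemxAl -scalemxAr scalerA.
case: e; rewrite /= ?rmorph1 ?sr ?scale1r -?scalemxAl -?scalemxAr; split.
- move=> /eq_block_mx[e1 e2 _ e4]; split=> //.
    by rewrite -[LHS]opprK opprB e4 opprK.
  by apply/adj/eqP; rewrite -subr_eq0 e2.
- move=> [e1 e2 e3]; rewrite e1 (adj.1 e3) e3 !subrr; congr block_mx.
  by rewrite -e2 opprB.
- move=> /eq_block_mx[e1 _ e3 e4]; split=> //.
    by rewrite -[LHS]opprK opprB e4 opprK.
  by apply/eqP; rewrite -subr_eq0 e3.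
- move=> [e1 e2 e3]; rewrite e1 (adj.1 e3) e3 !subrr; congr block_mx.
  by rewrite -e2 opprB.
Qed.

(* The off-diagonal blocks are rescaled so that the twisted product of parameter
   r1 r2 becomes the matrix product. *)
Definition swap_blocks (r1 r2 : F) (X : g) : 'M[F]_(p + q) :=
  block_mx (drsubmx X) (r1 *: dlsubmx X) (r2 *: ursubmx X) (ulsubmx X).

Definition unswap_blocks (r1 r2 : F) (M : 'M[F]_(p + q)) : g :=
  block_mx (drsubmx M) (r2^-1 *: dlsubmx M) (r1^-1 *: ursubmx M) (ulsubmx M).

Lemma swap_blocksK r1 r2 : r1 != 0 -> r2 != 0 ->
  cancel (swap_blocks r1 r2) (unswap_blocks r1 r2).
Proof.
move=> n1 n2 X; rewrite /unswap_blocks /swap_blocks.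
rewrite !(block_mxKul, block_mxKur, block_mxKdl, block_mxKdr) !scalerA !mulVf //.
by rewrite !scale1r submxK.
Qed.

Lemma unswap_blocksK r1 r2 : r1 != 0 -> r2 != 0 ->
  cancel (unswap_blocks r1 r2) (swap_blocks r1 r2).
Proof.
move=> n1 n2 X; rewrite /unswap_blocks /swap_blocks.
rewrite !(block_mxKul, block_mxKur, block_mxKdl, block_mxKdr) !scalerA !mulfV //.
by rewrite !scale1r submxK.
Qed.

Lemma swap_blocks_twist r1 r2 X Y :
  swap_blocks r1 r2 (twist (r1 * r2) X Y) = swap_blocks r1 r2 X *m swap_blocks r1 r2 Y.
Proof.
rewrite /swap_blocks /twist !(block_mxKul, block_mxKur, block_mxKdl, block_mxKdr) mulmx_block.
rewrite -!(scalemxAl, scalemxAr) !scalerDr !scalerA [r2 * r1]mulrC.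
by congr block_mx; rewrite addrC.
Qed.

Lemma realcond_pq r X : Num.conj r = r -> r != 0 -> realcond (r * r) X <->
  (swap_blocks r r X) ^t* *m block_mx 1%:M 0 0 (- 1%:M) *m swap_blocks r r X =
  block_mx 1%:M 0 0 (- 1%:M).
Proof.
move=> rr r0; rewrite /realcond /swap_blocks.
move: (ulsubmx X) (ursubmx X) (dlsubmx X) (drsubmx X) => A B D E.
rewrite /= ct_block !ctZ rr !mulmx_block !(mulmx0, mul0mx, addr0, add0r, mulmx1).
rewrite !(mulmxN, mulNmx, mulmx1) -!scalemxAl -!scalemxAr !scalerA -!scalerBr.
have adj : B ^t* *m A = E ^t* *m D <-> A ^t* *m B = D ^t* *m E.
  split=> e1; have := congr1 (fun M => M ^t*) e1; rewrite !ctM !trmxCK => <- //.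
split.
  move=> [e1 e2 e3]; rewrite e2 e3 -(adj.1 e3) !subrr !scaler0; congr block_mx.
  by rewrite -e1 opprB.
move=> /eq_block_mx[e1 /eqP + _ e4]; rewrite scaler_eq0 (negbTE r0) subr_eq0 => /eqP e2.
by split=> //; rewrite -[LHS]opprK opprB e4 opprK.
Qed.

(** Scale factors of opposite signs have a negative product, and their signs turn the indefinite
    form into the definite one. *)
Lemma realcond_unitary r X : Num.conj r = r -> r != 0 -> realcond (r * - r) X <->
  (swap_blocks r (- r) X) ^t* *m swap_blocks r (- r) X = 1%:M.
Proof.
move=> rr r0; rewrite /realcond /swap_blocks.
move: (ulsubmx X) (ursubmx X) (dlsubmx X) (drsubmx X) => A B D E.
have rrN : Num.conj (- r) = - r by rewrite rmorphN /= rr.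
rewrite /= ct_block !ctZ rrN rr !mulmx_block !mulrN !scaleNr !opprK.
rewrite !(mulmxN, mulNmx, opprK) -!scalemxAl -!scalemxAr !scalerA -!scalerBr.
have adj : B ^t* *m A = E ^t* *m D <-> A ^t* *m B = D ^t* *m E.
  split=> e1; have := congr1 (fun M => M ^t*) e1; rewrite !ctM !trmxCK => <- //.
rewrite scalar_mx_block; split.
  move=> [e1 e2 e3]; rewrite e2 e3 -(adj.1 e3) !subrr !scaler0; congr block_mx.
  by rewrite addrC.
move=> /eq_block_mx[e1 /eqP + _ e4]; rewrite scaler_eq0 (negbTE r0) subr_eq0 => /eqP e2.
by split=> //; rewrite addrC.
Qed.

Definition herm_offdiag (b : 'M[F]_(p, q)) : 'M[F]_(p + q) := block_mx 0 b (b ^t*) 0.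

(** The two conditions make X Hermitian and anticommuting with the signature matrix, which doubles
    the diagonal blocks to zero. *)
Lemma p_sigmaE (X : 'M[F]_(p + q)) :
  (X ^t* *m block_mx 1%:M 0 0 (- 1%:M) + block_mx 1%:M 0 0 (- 1%:M) *m X = 0 /\ - X ^t* = - X) <-> X = herm_offdiag (ursubmx X).
Proof.
split=> [[e1 /eqP]|->]; last first.
  rewrite /herm_offdiag !ct_block !ct0 trmxCK !mulmx_block.
  rewrite !(mulmx0, mul0mx, addr0, add0r, mulmx1, mul1mx, mulmxN, mulNmx).
  by rewrite add_block_mx !addr0 addNr subrr block_mx0.
rewrite eqr_opp => /eqP e2; move: e1; rewrite e2.
have := e2; rewrite -[X]submxK !ct_block => /eq_block_mx[_ _ e3 _].
rewrite !mulmx_block !(mulmx0, mul0mx, addr0, add0r, mulmx1, mul1mx, mulmxN, mulNmx).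
rewrite add_block_mx => /eqP; rewrite block_mx_eq0 => /and4P[/eqP z1 _ _ /eqP z4].
have two (m n : nat) (A : 'M[F]_(m, n)) : A + A = 0 -> A = 0.
  move=> /eqP; rewrite -mulr2n -scaler_nat scaler_eq0 pnatr_eq0 /= => /eqP //.
have z4' : drsubmx X = 0 by apply: two; rewrite -[LHS]opprK opprD z4 oppr0.
by rewrite /herm_offdiag !block_mxKur (two _ _ _ z1) z4' -e3.
Qed.

End Adjoint.

(** * Complex conjugation on the projective line *)

Section ConjugateLines.
Variable R : realType.
Local Notation C := R[i].
Implicit Types v : 'rV[C]_2.

Definition conjv v : 'rV[C]_2 := map_mx Num.conj v.

Lemma conjvZ a v : conjv (a *: v) = Num.conj a *: conjv v.
Proof. by apply/matrixP => i j; rewrite !mxE rmorphM. Qed.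

Lemma conjvK : involutive conjv.
Proof. by move=> v; apply/matrixP => i j; rewrite !mxE; exact: conjcK. Qed.

Lemma conjv_eq0 v : (conjv v == 0) = (v == 0).
Proof. by rewrite /conjv map_mx_eq0. Qed.

Lemma conj_projE v : v != 0 -> conj_proj <[v]>%VS = <[conjv v]>%VS.
Proof.
move=> v0; have dv : \dim <[v]>%VS = 1%N by rewrite dim_vline v0.
rewrite /conj_proj; case: (vbasis <[v]>%VS) (vbasisP <[v]>%VS) => s /= ss /andP[/eqP bs _].
move: ss; rewrite dv; case: s bs => [|u [|]] //= bs _.
have uv : u \in <[v]>%VS by rewrite -bs; apply: memv_span; rewrite inE.
have [k uk] := vlineP _ _ uv; rewrite span_seq1.
rewrite -/(conjv u) uk conjvZ line_scale // conjC_eq0; apply/eqP => k0.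
by move: bs v0; rewrite uk k0 scale0r span_seq1 => /esym e;
  have := memv_line v; rewrite e => /vlineP[k' ->]; rewrite scaler0 eqxx.
Qed.

Lemma conj_proj_morph : morphism (conjsp (proj_space C 1)) (proj_space C 1) (@conj_proj R).
Proof.
have rP := @ringed_proj C 1; have rn := @ringed_nonzero C 1.
have rcn := ringed_conjsp rn.
move=> L dL; split.
  by case/dom_projP: dL => v v0 ->; rewrite conj_projE //; apply: dom_proj_line; rewrite conjv_eq0.
move=> u ru.
apply: (@regat_from_proj C 1 L (fun L => conjc (u (conj_proj L))) dL) => v v0 vL.
have dv : dom (conjsp (nonzero_vectors C 1)) v by split.
have m : morph_at (conjsp (nonzero_vectors C 1)) (proj_space C 1) (fun v => <[conjv v]>%VS) v.
  apply: morph_at_proj => //; first by move=> w [_ w0]; rewrite conjv_eq0.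
  by apply: mxreg_conjsp; exact: mxreg_nonzero.
have r : regat (proj_space C 1) <[conjv v]>%VS u by rewrite -conj_projE // vL.
have rr : regat (nonzero_vectors C 1) v (fun w => conjc (u <[conjv w]>%VS)).
  exact: (morph_regat m r).
by apply: (regat_ext rn dv rr) => w [_ w0]; rewrite conj_projE.
Qed.

Lemma conj_projK L : dom (proj_space C 1) L -> conj_proj (conj_proj L) = L.
Proof.
by case/dom_projP => v v0 ->; rewrite !conj_projE ?conjv_eq0 // conjvK.
Qed.

Lemma conj_proj_real_structure : real_structure (proj_space C 1) (@conj_proj R).
Proof. by split; [exact: conj_proj_morph|exact: conj_projK]. Qed.

End ConjugateLines.

(** * The real structure of the family and its real fibers *)

Section RealStructure.
Variables (R : realType) (p q : nat) (i0 : 'I_q) (j0 : 'I_p).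
Local Notation C := R[i].
Local Notation g := 'M[C]_(q + p).
Local Notation h := ('M[C]_(q + p) * 'M[C]_(q + p))%type.
Local Notation base_points := (@base_points C p q).
Local Notation base_space := (base_space C p q).
Local Notation total_points := (@total_points C p q).
Local Notation total_space := (total_space C p q).
Local Notation total_ops := (@total_ops C p q).
Local Notation anti_pair := (@anti_pair C p q).

Lemma anti_pair_morph T (M : cspace C T) (f : T -> h) x : ringed M -> dom M x ->
  punit (f x) -> morph_at M (aff h) f x ->
  morph_at (conjsp M) (aff h) (fun y => anti_pair (f y)) x.
Proof.
move=> rM Mx [u1 u2] mf; have [r1 r2] := mxreg_h rM Mx mf.
have rc := ringed_conjsp rM; have Mx' : dom (conjsp M) x by [].
have key (k : T -> g) : mxreg M x k -> k x \in unitmx ->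
    mxreg (conjsp M) x (fun y => anti_inv (k y)).
  move=> rk uk; apply: mxreg_mul => //; last exact: mxreg_cst.
  apply: mxreg_mul => //; first exact: mxreg_cst.
  apply: mxreg_inv => //; last by rewrite ct_unit.
  by apply: mxreg_conjsp; exact: mxreg_tr.
by apply: morph_at_h => //; exact: key.
Qed.

Lemma H_real_structure : real_structure (Hsp C p q) anti_pair.
Proof.
have rH := ringed_Hsp C p q.
split; last first.
  move=> w dw; have [_ uw] := dw.
  exact: (anti_pairK uw).
apply/antimorphismP; apply: morphism_subcod; first exact: ringed_conjsp.
  by move=> w [Iw uw]; apply: anti_pair_morph => //; exact: morph_at_incl.
by move=> w [_ uw]; exact: (anti_pair_unit uw).
Qed.

Definition conj_point (W : {vspace h}) : {vspace h} :=
  point_of_line p q (conj_proj (line_of_point i0 j0 W)).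

Definition conj_total (y : {vspace h} * h) : {vspace h} * h := (conj_point y.1, anti_pair y.2).

Lemma conj_pointE c : c != 0 -> conj_point (Wab p q c) = Wab p q (Num.conj c.1, Num.conj c.2).
Proof.
move=> c0; have rc0 : rowc c != 0 by rewrite rowc_neq0; exact: c0.
have cr0 : conjv (rowc c) != 0 by rewrite conjv_eq0; exact: rc0.
have ec : colc (conjv (rowc c)) = (Num.conj c.1, Num.conj c.2) by rewrite /colc /conjv !mxE.
by rewrite /conj_point line_of_pointE (conj_projE rc0) (point_of_lineE p q cr0) ec.
Qed.

Lemma conj_pair_neq0 (c : C * C) : c != 0 -> (Num.conj c.1, Num.conj c.2) != 0.
Proof.
apply: contra_neq => -[] /eqP; rewrite conjC_eq0 => /eqP a0 /eqP.
by rewrite conjC_eq0 => /eqP b0; case: c a0 b0 => a b /= -> ->.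
Qed.

Lemma base_points_conj W : base_points W -> base_points (conj_point W).
Proof.
move=> [c [c0 ->]]; rewrite conj_pointE //.
by exists (Num.conj c.1, Num.conj c.2); split=> //; exact: conj_pair_neq0.
Qed.

Lemma total_points_conj y : total_points y -> total_points (conj_total y).
Proof.
case: y => W w [bW [wW uw]].
split; first exact: (base_points_conj bW).
split; last exact: (anti_pair_unit uw).
have [c [c0 eW]] := bW; have wc : w \in Wab p q c by rewrite -eW.
have e1 : (conj_total (W, w)).1 = Wab p q (Num.conj c.1, Num.conj c.2).
  exact: (etrans (congr1 conj_point eW) (conj_pointE c0)).
rewrite e1; exact: (anti_pair_Tab uw wc).
Qed.

Lemma conj_point_morph : morphism (conjsp base_space) base_space conj_point.
Proof.
move=> W dW; have m1 := morph_at_conjsp (@line_of_point_morph C p q i0 j0 W dW).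
have m2 := conj_proj_morph (m1.1 : dom (proj_space C 1) _).
have m3 := @point_of_line_morph C p q _ m2.1.
exact: (morph_at_comp (morph_at_comp m1 m2) m3).
Qed.

Lemma base_real_structure : real_structure base_space conj_point.
Proof.
split; first exact: conj_point_morph.
move=> W [_ bW]; rewrite /conj_point point_of_lineK; last first.
  have [d _] := @line_of_point_morph C p q i0 j0 W (dom_base bW).
  by have [] := conj_proj_morph d.
rewrite conj_projK ?line_of_pointK //.
by have [] := @line_of_point_morph C p q i0 j0 W (dom_base bW).
Qed.

Lemma conj_total_morph : morphism (conjsp total_space) total_space conj_total.
Proof.
have rt := ringed_total C p q; have rc := ringed_conjsp rt.
move=> y dy; have dy' : dom (conjsp total_space) y by [].
have uy : punit y.2 by case: dy => _ [_ []].
apply: (to_total rc dy').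
- by move=> z [_ tz]; exact: total_points_conj.
- have m1 := morph_at_conjsp (total_fst dy).
  have m2 := morph_at_comp m1 (conj_point_morph m1.1).
  exact: morph_at_subcodW m2.
- by apply: anti_pair_morph => //; exact: total_snd.
Qed.

Lemma total_real_structure :
  family_real_structure total_space base_space total_ops conj_point conj_total.
Proof.
split; first exact: base_real_structure.
- split; first exact: conj_total_morph.
  move=> [W w] [[Wd _] [bW [_ uw]]]; rewrite /conj_total /= (anti_pairK uw).
  have [_ k] := base_real_structure; by rewrite k //; exact: dom_base.
- by [].
- move=> a b [_ [_ [_ ua]]] [_ [_ [_ ub]]] _.
  by rewrite /conj_total /total_mul /= (anti_pairM ua ub).
Qed.

Section RealFibers.
Variables (e : bool) (x : R).
Local Notation c := (cab e (x%:C : C)).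
Local Notation W := (Wab p q c).

Lemma conj_real : Num.conj (x%:C : C) = x%:C.
Proof. by rewrite /Num.conj /= oppr0. Qed.

Lemma conj_point_real : conj_point W = W.
Proof.
have e1 : (Num.conj c.1, Num.conj c.2) = c.
  by case: (e); congr (_, _); rewrite /= ?conj_real ?rmorph1.
have c0 : c != 0 by exact: cab_neq0.
exact: (etrans (conj_pointE c0) (congr1 (Wab p q) e1)).
Qed.

Definition real_points : set ({vspace h} * h) := [set y | y.1 = W /\ conj_total y = y].

Lemma real_pointsE y : total_points y -> real_points y ->
  y = (W, Tab c (Lam e y.2)) /\ realcond x%:C (Lam e y.2).
Proof.
case: y => V w ty ry; have [eV es] := ry; have [_ [wV uw]] := ty.
have ew : anti_pair w = w := congr1 snd es.
have {}eV : V = W := eV.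
have {}wV : w \in W by rewrite -eV.
have eL : Tab c (Lam e w) = w by exact: (TabK wV).
split; first by rewrite eV; congr (_, _); exact: esym eL.
by apply: (Tab_fixed e (Lam e w) conj_real).1; rewrite eL.
Qed.

Lemma real_points_Tab X : realcond (x%:C : C) X ->
  total_points (W, Tab c X) /\ real_points (W, Tab c X).
Proof.
move=> /(Tab_fixed e X conj_real)[uX fX]; split.
  split; first exact: base_points_chart.
  split; first exact: mem_Tab.
  exact: uX.
split; first by [].
exact: (f_equal2 pair conj_point_real fX).
Qed.

Definition real_fiber_space : cspace R ({vspace h} * h)%type :=
  subsp (realify total_space) real_points.

Lemma ringed_real_fiber : ringed real_fiber_space.
Proof. by apply: ringed_subsp; apply: ringed_realify; exact: ringed_total. Qed.

Lemma mxreg_real_fiber y : dom real_fiber_space y ->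
  mxreg (cplx real_fiber_space) y (fun y => Lam e y.2).
Proof.
move=> dy; have [dy1 _] := dy; have rc := ringed_cplx ringed_real_fiber.
have m : morph_at (cplx real_fiber_space) total_space id y by exact: cplx_sub_realify_id.
by apply: (morph_at_Lam rc dy); exact: (morph_at_comp m (total_snd dy1)).
Qed.

Lemma to_real_fiber T (M : cspace R T) (X : T -> g) : ringed M ->
  (forall y, dom M y -> realcond (x%:C : C) (X y)) ->
  (forall y, dom M y -> mxreg (cplx M) y X) ->
  morphism M real_fiber_space (fun y => (W, Tab c (X y))).
Proof.
move=> rM rX mX; have rc := ringed_cplx rM; apply: morphism_subcod => //; last first.
  by move=> y /rX /real_points_Tab[].
move=> y My; apply: (morph_at_realify rM My).
have My' : dom (cplx M) y by [].
apply: (to_total rc My').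
- by move=> z /rX /real_points_Tab[].
- by apply: morph_at_cst => //; apply: dom_Gr_Wab; exact: cab_neq0.
- by apply: (morph_at_Tab (c := fun=> c) rc My') => //; try exact: regat_cst; exact: mX.
Qed.

Lemma Lam_total_mul y y' : total_points y -> total_points y' -> real_points y -> real_points y' ->
  Lam e (total_mul y y').2 = twist x%:C (Lam e y.2) (Lam e y'.2).
Proof.
move=> ty ty' ry ry'; have [ey _] := real_pointsE ty ry; have [ey' _] := real_pointsE ty' ry'.
have e1 : y.2 = Tab c (Lam e y.2) by rewrite {1}ey.
have e2 : y'.2 = Tab c (Lam e y'.2) by rewrite {1}ey'.
rewrite /total_mul [in LHS]e1 [in LHS]e2 /= pmul_Tab.
have -> : c.1 * c.2 = x%:C by case: (e); rewrite /= ?mulr1 ?mul1r.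
exact: LamK.
Qed.

(** Scale factors of product x turn the twisted product into the matrix product, so a description of
    the fixed points in rescaled blocks is already an isomorphism of groups. It serves both signs of
    x. *)
Lemma real_form_iso (r1 r2 : C) (A : set 'M[C]_(p + q)) :
  r1 != 0 -> r2 != 0 -> r1 * r2 = x%:C ->
  (forall X, realcond (x%:C : C) X <-> A (swap_blocks r1 r2 X)) ->
  group_iso (GSpace real_fiber_space (@total_mul C p q)) (real_affine_group A mulmx).
Proof.
move=> n1 n2 r12 rA.
have rf := ringed_real_fiber; have ra := @ringed_aff C 'M[C]_(p + q).
have rT : ringed (subsp (realify (aff 'M[C]_(p + q))) A).
  by apply: ringed_subsp; exact: ringed_realify.
exists (fun y => swap_blocks r1 r2 (Lam e y.2)), (fun M => (W, Tab c (unswap_blocks r1 r2 M))).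
split; last first.
  move=> y y' [[_ ty] ry] [[_ ty'] ry'].
  by rewrite /= Lam_total_mul // -r12 swap_blocks_twist.
split.
- apply: morphism_subcod => //; last first.
    by move=> y [[_ ty] ry]; apply/rA; have [] := real_pointsE ty ry.
  move=> y dy; apply: (morph_at_realify rf dy).
  have rc := ringed_cplx rf; have dy' : dom (cplx real_fiber_space) y by [].
  apply/(mxregP rc dy'); have rL := mxreg_real_fiber dy.
  have rr (a : C) : regat (cplx real_fiber_space) y (fun=> a) by exact: regat_cst.
  apply: mxreg_block => //.
  + exact: mxreg_drsub.
  + by apply: mxreg_scale => //; exact: mxreg_dlsub.
  + by apply: mxreg_scale => //; exact: mxreg_ursub.
  + exact: mxreg_ulsub.
- apply: to_real_fiber => //.
    by move=> M [_ AM]; apply/rA; rewrite unswap_blocksK.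
  move=> M dM; have rc := ringed_cplx rT.
  have dM' : dom (cplx (subsp (realify (aff 'M[C]_(p + q))) A)) M by [].
  have rM : mxreg (cplx (subsp (realify (aff 'M[C]_(p + q))) A)) M (fun M => M).
    by apply/(mxregP rc dM'); exact: cplx_sub_realify_id.
  have rr (a : C) : regat (cplx (subsp (realify (aff 'M[C]_(p + q))) A)) M (fun=> a).
    exact: regat_cst.
  apply: mxreg_block => //.
  + exact: mxreg_drsub.
  + by apply: mxreg_scale => //; exact: mxreg_dlsub.
  + by apply: mxreg_scale => //; exact: mxreg_ursub.
  + exact: mxreg_ulsub.
- move=> y [[_ ty] ry]; have [ey _] := real_pointsE ty ry.
  by rewrite swap_blocksK // -ey.
- by move=> M _; rewrite /= LamK unswap_blocksK.
Qed.

End RealFibers.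

End RealStructure.

(** * Fixed points at t = 0: the motion group *)

Section UnitaryMotion.
Variables (F : numClosedFieldType) (p q : nat).
Local Notation g := 'M[F]_(q + p).
Implicit Types (X Y : g) (V : 'M[F]_(p + q)).

Lemma unitarymx_left n (A : 'M[F]_n) : A \is unitarymx <-> A ^t* *m A = 1%:M.
Proof. by split=> [/unitarymxP /mulmx1C //|/mulmx1C ?]; exact/unitarymxP. Qed.

Definition motion_rot X : 'M[F]_p * 'M[F]_q := (drsubmx X, ulsubmx X).

(** The nilpotent factor n of X = (1 + n) k, as for the complex fiber at t = 0, with the blocks of
    sizes q and p exchanged to match the order in U(p) x U(q). *)
Definition motion_trans X : 'M[F]_(p + q) :=
  block_mx 0 (dlsubmx X *m invmx (ulsubmx X)) (ursubmx X *m invmx (drsubmx X)) 0.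

Definition motion_mx (k : 'M[F]_p * 'M[F]_q) V : g :=
  block_mx k.2 (dlsubmx V *m k.1) (ursubmx V *m k.2) k.1.

(** At s = 0 the diagonal equations say that A and E are unitary; the off-diagonal one then becomes
    the statement that D A^-1 is the adjoint of B E^-1. *)
Lemma realcond0P X : realcond 0 X <->
  [/\ drsubmx X \is unitarymx, ulsubmx X \is unitarymx &
      motion_trans X = herm_offdiag (ursubmx (motion_trans X))].
Proof.
rewrite /realcond /motion_trans /herm_offdiag !block_mxKur !scale0r !subr0.
move: (ulsubmx X) (ursubmx X) (dlsubmx X) (drsubmx X) => A B D E; split.
  move=> [eA eE e]; have [uA uE] := (mulmx1_unit eA, mulmx1_unit eE).
  split; [exact/unitarymx_left|exact/unitarymx_left|].
  congr block_mx; apply: (can_inj (mulmxK uE.2)); rewrite mulmxKV ?uE.2 //.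
  rewrite ctM -ct_inv -mulmxA; apply: (can_inj (mulKmx uA.1)).
  rewrite mulKVmx ?uA.1 //; have := congr1 (fun M => M ^t*) e.
  by rewrite !ctM !trmxCK.
move=> [/unitarymx_left eE /unitarymx_left eA /eq_block_mx[_ _ e _]]; split=> //.
have [uA uE] := (mulmx1_unit eA, mulmx1_unit eE).
have eB : B = (D *m invmx A) ^t* *m E by rewrite -e mulmxKV ?uE.2.
by rewrite eB (ctM (_ ^t*)) trmxCK -!mulmxA mulVmx ?mulmx1 ?uA.2.
Qed.

Lemma motion_mxK X : ulsubmx X \in unitmx -> drsubmx X \in unitmx ->
  motion_mx (motion_rot X) (motion_trans X) = X.
Proof.
move=> uA uE; rewrite /motion_mx /motion_trans block_mxKdl block_mxKur /=.
by rewrite !mulmxKV // submxK.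
Qed.

Lemma motion_rotK k V : motion_rot (motion_mx k V) = k.
Proof. by rewrite /motion_rot block_mxKul block_mxKdr; case: k. Qed.

Lemma motion_transK k V : k.1 \in unitmx -> k.2 \in unitmx ->
  V = herm_offdiag (ursubmx V) -> motion_trans (motion_mx k V) = V.
Proof.
move=> u1 u2 eV; rewrite /motion_trans !(block_mxKul, block_mxKur, block_mxKdl, block_mxKdr).
rewrite !mulmxK // (_ : dlsubmx V = (ursubmx V) ^t*); first exact: esym eV.
by rewrite {1}eV block_mxKdl.
Qed.

Lemma motion_trans_twist X Y : ulsubmx X \in unitmx -> drsubmx X \in unitmx ->
  ulsubmx Y \in unitmx -> drsubmx Y \in unitmx ->
  motion_trans (twist 0 X Y) = motion_trans X +
    (let k := block_mx (drsubmx X) 0 0 (ulsubmx X) in k *m motion_trans Y *m invmx k).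
Proof.
rewrite -[X]submxK -[Y]submxK twist0E.
move: (ulsubmx X) (ursubmx X) (dlsubmx X) (drsubmx X) => A B D E.
move: (ulsubmx Y) (ursubmx Y) (dlsubmx Y) (drsubmx Y) => A' B' D' E'.
rewrite /motion_trans !(block_mxKul, block_mxKur, block_mxKdl, block_mxKdr) => uA uE uA' uE'.
have uk : block_mx E 0 0 A \in unitmx by rewrite block_diag_mx_unit uE.
rewrite /= invmx_block_diag // !mulmx_block !(mulmx0, mul0mx, addr0, add0r) add_block_mx !addr0.
congr block_mx.
  by rewrite invmxM // mulmxDl !mulmxA (mulmxK uA').
by rewrite invmxM // mulmxDl !mulmxA (mulmxK uE') addrC.
Qed.

Lemma motion_rot_twist X Y :
  motion_rot (twist 0 X Y) = (drsubmx X *m drsubmx Y, ulsubmx X *m ulsubmx Y).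
Proof.
by rewrite /motion_rot /twist block_mxKul block_mxKdr !scale0r addr0 add0r.
Qed.

End UnitaryMotion.

Section SpecialRealFibers.
Variables (R : realType) (p q : nat) (i0 : 'I_q) (j0 : 'I_p) (e : bool).
Local Notation C := R[i].
Local Notation c := (cab e ((0 : R)%:C : C)).
Local Notation W := (Wab p q c).
Local Notation real_fiber := (real_fiber_space i0 j0 e 0).

Definition unitary_pairs : set ('M[C]_p * 'M[C]_q) :=
  [set k | k.1 \is unitarymx /\ k.2 \is unitarymx].

Lemma dom_motion y : dom real_fiber y ->
  [/\ y = (W, Tab c (Lam e y.2)), unitary_pairs (motion_rot (Lam e y.2)),
      p_sigma (motion_trans (Lam e y.2)), ulsubmx (Lam e y.2) \in unitmx &
      drsubmx (Lam e y.2) \in unitmx].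
Proof.
move=> [[_ ty] ry]; have [ey /realcond0P[uE uA eV]] := real_pointsE ty ry.
split; [exact: ey|by []|exact/p_sigmaE|exact: unitarymx_unit|exact: unitarymx_unit].
Qed.

Lemma real_motion_iso :
  group_iso (GSpace real_fiber (@total_mul C p q)) (motion_pq R p q).
Proof.
have rf := @ringed_real_fiber R p q i0 j0 e 0.
have rk := @ringed_aff C ('M[C]_p * 'M[C]_q)%type; have rv := @ringed_aff C 'M[C]_(p + q).
have rU : ringed (subsp (realify (aff ('M[C]_p * 'M[C]_q)%type)) unitary_pairs).
  by apply: ringed_subsp; exact: ringed_realify.
have rV : ringed (subsp (realify (aff 'M[C]_(p + q))) (@p_sigma R p q)).
  by apply: ringed_subsp; exact: ringed_realify.
pose N := prodsp (subsp (realify (aff ('M[C]_p * 'M[C]_q)%type)) unitary_pairs)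
                 (subsp (realify (aff 'M[C]_(p + q))) (@p_sigma R p q)).
have rN : ringed N by exact: ringed_prodsp.
exists (fun y => (motion_rot (Lam e y.2), motion_trans (Lam e y.2))).
exists (fun z => (W, Tab c (motion_mx z.1 z.2))).
split; last first.
  move=> y y' dy dy'; have [_ _ _ uA uE] := dom_motion dy.
  have [_ _ _ uA' uE'] := dom_motion dy'.
  have eL : Lam e (total_mul y y').2 = twist 0 (Lam e y.2) (Lam e y'.2).
    have [[_ ty] ry] := dy; have [[_ ty'] ry'] := dy'.
    have e0 : (0 : R)%:C = 0 :> C by [].
    exact: (etrans (@Lam_total_mul R p q i0 j0 e 0 y y' ty ty' ry ry')
                   (congr1 (fun s : C => twist s (Lam e y.2) (Lam e y'.2)) e0)).
  apply: (etrans (congr1 (fun X => (motion_rot X, motion_trans X)) eL)).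
  exact: (f_equal2 pair (motion_rot_twist _ _) (motion_trans_twist uA uE uA' uE')).
split.
- move=> y dy; have rc := ringed_cplx rf; have dy' : dom (cplx real_fiber) y by [].
  have rL := mxreg_real_fiber dy.
  have [_ _ _ uA uE] := dom_motion dy.
  have rr0 m n : mxreg (cplx real_fiber) y (fun=> 0 : 'M_(m, n)) by exact: mxreg_cst.
  apply: (morph_at_pair rf dy).
  + by move=> z /dom_motion[].
  + apply: (morph_at_subcod rf dy); first by move=> z /dom_motion[].
    apply: (morph_at_realify rf dy); apply: (morph_at_aff_pair rc dy').
      by apply/(mxregP rc dy'); exact: mxreg_drsub.
    by apply/(mxregP rc dy'); exact: mxreg_ulsub.
  + apply: (morph_at_subcod rf dy); first by move=> z /dom_motion[].
    apply: (morph_at_realify rf dy); apply/(mxregP rc dy').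
    apply: mxreg_block => //; apply: mxreg_mul => //.
    * exact: mxreg_dlsub.
    * by apply: mxreg_inv => //; exact: mxreg_ulsub.
    * exact: mxreg_ursub.
    * by apply: mxreg_inv => //; exact: mxreg_drsub.
- apply: to_real_fiber => //.
    move=> z [[_ [u1 u2]] [_ sv]]; have eV := (p_sigmaE z.2).1 sv.
    apply/realcond0P; rewrite block_mxKdr block_mxKul motion_transK //;
      exact: unitarymx_unit.
  move=> z dz; have rc := ringed_cplx rN; have dz' : dom (cplx N) z by [].
  have [dz1 dz2] := dz.
  have m1 : morph_at (cplx N) (aff ('M[C]_p * 'M[C]_q)%type) (fun z => z.1) z := morph_at_comp (morph_at_cplx (morph_at_fst rU rV dz1 dz2))
    (cplx_sub_realify_id unitary_pairs dz1.1).
  have m2 := morph_at_comp (morph_at_cplx (morph_at_snd rU rV dz1 dz2))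
    (cplx_sub_realify_id (@p_sigma R p q) dz2.1).
  have mV : mxreg (cplx N) z snd by apply/(mxregP rc dz'); exact: m2.
  have mE : mxreg (cplx N) z (fun z => z.1.1).
    apply/(mxregP rc dz').
    exact: (morph_at_linear rc dz' (fst : {linear ('M[C]_p * 'M[C]_q)%type -> 'M[C]_p}) m1).
  have mA : mxreg (cplx N) z (fun z => z.1.2).
    apply/(mxregP rc dz').
    exact: (morph_at_linear rc dz' (snd : {linear ('M[C]_p * 'M[C]_q)%type -> 'M[C]_q}) m1).
  apply: mxreg_block => //; apply: mxreg_mul => //.
  + exact: mxreg_dlsub.
  + exact: mxreg_ursub.
- move=> y /dom_motion[ey _ _ uA uE]; rewrite /= motion_mxK //; exact: esym ey.
- move=> z [[_ [u1 u2]] [_ sv]]; have eV := (p_sigmaE z.2).1 sv.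
  have eL : Lam e (W, Tab c (motion_mx z.1 z.2)).2 = motion_mx z.1 z.2 by exact: LamK.
  have v1 := unitarymx_unit u1; have v2 := unitarymx_unit u2.
  rewrite eL motion_rotK (motion_transK v1 v2 eV).
  by case: (z).
Qed.

End SpecialRealFibers.

(** * The contraction bracket as a commutator of the twisted product *)

Section ContractionFibers.
Variables (F : numClosedFieldType) (p q : nat).
Local Notation g := 'M[F]_(q + p).
Local Notation J := (sgnJ F p q).
Implicit Types X Y : g.

Lemma sgnJ_conj X : J *m X *m invmx J =
  block_mx (ulsubmx X) (- ursubmx X) (- dlsubmx X) (drsubmx X).
Proof.
rewrite -{1}[X]submxK sgnJ_inv /sgnJ !mulmx_block.
rewrite !(mulmx0, mul0mx, addr0, add0r, mulmx1, mul1mx).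
by rewrite !(mulNmx, mulmxN, mulmx1, mul1mx, opprK).
Qed.

Lemma half_double m n (A : 'M[F]_(m, n)) : 2%:R^-1 *: (A + A) = A.
Proof.
by rewrite -mulr2n -scaler_nat scalerA mulVf ?scale1r // pnatr_eq0.
Qed.

Lemma kpart_block X : kpart (fun X => J *m X *m invmx J) X = block_mx (ulsubmx X) 0 0 (drsubmx X).
Proof.
rewrite /kpart sgnJ_conj -{1}[X]submxK add_block_mx !subrr scale_block_mx !scaler0.
by rewrite !half_double.
Qed.

Lemma ppart_block X : ppart (fun X => J *m X *m invmx J) X = block_mx 0 (ursubmx X) (dlsubmx X) 0.
Proof.
rewrite /ppart sgnJ_conj -{1}[X]submxK opp_block_mx add_block_mx !subrr !opprK scale_block_mx !scaler0.
by rewrite !half_double.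
Qed.

Lemma contraction_bracket_twist z X Y :
  contraction_bracket (fun X Y => X *m Y - Y *m X) (fun X => J *m X *m invmx J) z X Y =
  twist z X Y - twist z Y X.
Proof.
rewrite /contraction_bracket !kpart_block !ppart_block /twist.
move: (ulsubmx X) (ursubmx X) (dlsubmx X) (drsubmx X) => A B D E.
move: (ulsubmx Y) (ursubmx Y) (dlsubmx Y) (drsubmx Y) => A' B' D' E'.
rewrite !mulmx_block !(mulmx0, mul0mx, addr0, add0r) !opp_block_mx !add_block_mx.
rewrite !scale_block_mx !add_block_mx !(scaler0, subr0, sub0r, addr0, add0r, scalerBr, oppr0).
congr block_mx; rewrite ?opprD addrACA.
- by [].
- by rewrite [- (B' *m E) - _]addrC.
- by rewrite [E *m D' + _]addrC.
- by rewrite [E *m E' + _]addrC [- (E' *m E) - _]addrC.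
Qed.

End ContractionFibers.

(** * Real fibers over nonzero points, and the group family axioms *)

Section RealForms.
Variables (R : realType) (p q : nat) (i0 : 'I_q) (j0 : 'I_p).
Local Notation C := R[i].

Lemma real_pq_iso (e : bool) (x : R) : 0 < x ->
  group_iso (GSpace (real_fiber_space i0 j0 e x) (@total_mul C p q)) (unitary_pq R p q).
Proof.
move=> x0; pose r : C := (Num.sqrt x)%:C.
have r0 : r != 0 by rewrite /r eq_complex /= negb_and sqrtr_eq0 -ltNge x0.
have rr : Num.conj r = r := conj_real (Num.sqrt x).
have r2 : r * r = x%:C.
  by rewrite /r -[LHS](rmorphM (real_complex R)) -expr2 sqr_sqrtr // ltW.
apply: (real_form_iso i0 j0 e r0 r0 r2) => X; rewrite -r2.
exact: (realcond_pq X rr r0).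
Qed.

Lemma real_unitary_iso (e : bool) (x : R) : x < 0 ->
  group_iso (GSpace (real_fiber_space i0 j0 e x) (@total_mul C p q)) (unitary_group R (p + q)).
Proof.
move=> x0; pose r : C := (Num.sqrt (- x))%:C.
have r0 : r != 0 by rewrite /r eq_complex /= negb_and sqrtr_eq0 -ltNge oppr_gt0 x0.
have rr : Num.conj r = r := conj_real (Num.sqrt (- x)).
have r2 : r * - r = x%:C.
  rewrite mulrN /r -[X in - X](rmorphM (real_complex R)) -expr2 sqr_sqrtr ?oppr_ge0 ?ltW //.
  by rewrite rmorphN opprK.
have rN : - r != 0 by rewrite oppr_eq0.
apply: (real_form_iso i0 j0 e r0 rN r2) => X; rewrite -r2.
apply: (iff_trans (realcond_unitary X rr r0)).
by split=> h; [apply/(unitarymx_left _).2|exact: (unitarymx_left _).1].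
Qed.

End RealForms.

Section GroupFamilyRecord.
Variables (K : fieldType) (p q : nat) (i0 : 'I_q) (j0 : 'I_p).
Hypothesis infK : infinite_field K.
Local Notation g := 'M[K]_(q + p).
Local Notation h := ('M[K]_(q + p) * 'M[K]_(q + p))%type.
Local Notation total_space := (total_space K p q).
Local Notation base_space := (base_space K p q).
Local Notation total_ops := (@total_ops K p q).

Lemma total_group_family : is_group_family total_space base_space total_ops.
Proof.
have uP y : dom total_space y -> punit y.2 by case=> _ [_ []].
split.
- split; [exact: total_quasi_projective i0 j0|exact: total_irreducible i0 j0 infK|].
  exact: total_nonsingular i0 j0.
- split; [exact: base_quasi_projective i0 j0|exact: base_irreducible i0 j0 infK|].
  exact: base_nonsingular i0 j0.
- exact: total_smooth i0 j0.
- exact: total_mul_morph.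
- exact: total_one_morph.
- exact: total_inv_morph.
- by [].
- by [].
- by [].
- by move=> a b c _ _ _ _ _; congr (_, _); exact: pmulA.
- by case=> W w _; congr (_, _); exact: pmul1r.
- by case=> W w _; congr (_, _); exact: pmul1l.
- by case=> W w /uP uw; congr (_, _); exact: pmulVr.
- by case=> W w /uP uw; congr (_, _); exact: pmulVl.
Qed.

Lemma total_subfamily :
  dom total_space `<=` dom (prodsp base_space (Hsp K p q)) /\
  morphism total_space (prodsp base_space (Hsp K p q)) id.
Proof.
have rt := ringed_total K p q.
have dH y : dom total_space y -> dom base_space y.1 /\ dom (Hsp K p q) y.2.
  by move=> [_ [by1 [_ uy]]]; split=> //; exact: dom_base.
split; first by move=> y /dH.
move=> y dy; have m : morph_at total_space (prodsp base_space (Hsp K p q)) (fun y => (y.1, y.2)) y.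
  apply: (morph_at_pair rt dy dH); first exact: total_fst.
  by apply: (morph_at_subcod rt dy) => [z /dH[]|]; last exact: total_snd.
by apply: (morph_at_ext rt dy _ m) => -[].
Qed.

Lemma affine_point_iso :
  space_iso (subsp (aff K^o) [set t | t != 0]) (subsp (grass (\dim {: g}) h) (@open_base_points K p q))
    (@affine_point K p q) (Tco i0 j0 false).
Proof.
have ra := @ringed_aff K K^o.
have rA : ringed (subsp (aff K^o) [set t : K^o | t != 0]) by exact: ringed_subsp.
have rG := ringed_Gr K p q.
have rO : ringed (subsp (grass (\dim {: g}) h) (@open_base_points K p q)) by exact: ringed_subsp.
have opT W : open_base_points W -> exists2 t : K, t != 0 & W = affine_point p q t.
  move=> [[a b] [/= a0 b0 ->]]; exists (a / b); first by rewrite mulf_neq0 ?invr_eq0.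
  rewrite /affine_point -(Wab_scale p q (cab false (a / b)) b0) /= mulr1.
  by rewrite mulrCA mulfV ?mulr1.
split.
- apply: morphism_subcod => //; last first.
    by move=> t [_ t0]; exists (cab false t); split=> //=; exact: oner_neq0.
  move=> t [_ t0]; have m := @affine_point_morph K p q i0 j0 t I.
  apply: morph_at_subdom; exact: (morph_at_comp m (base_to_Gr m.1)).
- apply: morphism_subcod => //; last first.
    by move=> W [_ /opT[t t0 ->]]; rewrite /affine_point Tco_Wab.
  move=> W dW; apply: (morph_at_scalar rO dW).
  have [GW /opT[t t0 eW]] := dW.
  have r : regat (grass (\dim {: g}) h) W (Tco i0 j0 false).
    by apply: regat_Tco => //; rewrite eW; exact: Vset_Wab.
  exact: (morph_regat (morph_at_incl _ GW) r).
- by move=> t _; rewrite /affine_point Tco_Wab.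
- by move=> W [_ /opT[t t0 ->]]; rewrite /affine_point Tco_Wab.
Qed.

End GroupFamilyRecord.

Lemma Wab_ratio (K : fieldType) p q (a b : K) : b != 0 -> Wab p q (a, b) = Wab p q (cab false (a / b)).
Proof.
move=> b0; rewrite -(Wab_scale p q (cab false (a / b)) b0) /= mulr1.
by rewrite mulrCA mulfV ?mulr1.
Qed.

Lemma Wab_eq_ratio (K : fieldType) p q (i0 : 'I_q) (j0 : 'I_p) (a b a' b' : K) :
  b != 0 -> b' != 0 -> Wab p q (a, b) = Wab p q (a', b') <-> a / b = a' / b'.
Proof.
move=> b0 b0'; rewrite (Wab_ratio p q a b0) (Wab_ratio p q a' b0'); split=> [e|-> //].
by rewrite -(Tco_Wab i0 j0 false (a / b)) e (Tco_Wab i0 j0 false).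
Qed.

(** * Translation to homogeneous coordinates *)

Section Assembly.
Variables (R : realType) (p q : nat) (i0 : 'I_q) (j0 : 'I_p).
Local Notation C := R[i].
Local Notation phi := (@point_of_line C p q).
Local Notation total_space := (total_space C p q).
Local Notation base_space := (base_space C p q).
Local Notation total_ops := (@total_ops C p q).

Lemma point_of_hcoord (a b : C) : (a, b) != 0 -> phi (hcoord a b) = Wab p q (a, b).
Proof.
move=> ab; have v0 : rowc (a, b) != 0 by rewrite rowc_neq0.
exact: (etrans (point_of_lineE p q v0) (congr1 (Wab p q) (rowcK (a, b)))).
Qed.

Lemma point_of_cab (e : bool) (t : C) :
  phi (hcoord (cab e t).1 (cab e t).2) = Wab p q (cab e t).
Proof. by case: e; apply: point_of_hcoord; [exact: (cab_neq0 true)|exact: (cab_neq0 false)]. Qed.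

Lemma point_of_affine : (fun t : C => phi (hcoord t 1)) = @affine_point C p q.
Proof. by apply/funext => t; exact: (point_of_cab false). Qed.

Lemma Ad_g_zeta_eq (mu nu mu' nu' : C) : mu != 0 -> nu != 0 -> mu' != 0 -> nu' != 0 ->
  Ad_g (zeta p q mu nu) = Ad_g (zeta p q mu' nu') <-> mu ^+ 2 * nu ^- 2 = mu' ^+ 2 * nu' ^- 2.
Proof.
move=> m0 n0 m0' n0'; rewrite (Ad_g_zeta p q m0 n0) (Ad_g_zeta p q m0' n0').
by apply: (@Wab_eq_ratio C p q i0 j0); rewrite expf_neq0.
Qed.

Lemma point_of_Ad_g (mu nu : C) : mu != 0 -> nu != 0 ->
  phi (hcoord (mu ^+ 2) (nu ^+ 2)) = Ad_g (zeta p q mu nu).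
Proof.
move=> m0 n0; rewrite (Ad_g_zeta p q m0 n0); apply: point_of_hcoord.
by apply/eqP => -[/eqP]; rewrite expf_eq0 (negbTE m0).
Qed.

Lemma p_zeroE : @p_zero R p q = nil_set false.
Proof.
apply/seteqP; split=> P.
  by move=> [c [b ->]]; exists b, c; rewrite /nil_part TabE /= !scale0r !scale1r.
by move=> [b [c ->]]; exists c, b; rewrite /nil_part TabE /= !scale0r !scale1r.
Qed.

Lemma p_inftyE : @p_infty R p q = nil_set true.
Proof.
apply/seteqP; split=> P.
  by move=> [c [b ->]]; exists b, c; rewrite /nil_part TabE /= !scale0r !scale1r.
by move=> [b [c ->]]; exists c, b; rewrite /nil_part TabE /= !scale0r !scale1r.
Qed.

Lemma special_zero_iso :
  group_iso (fiber_group total_space total_ops (phi (hcoord 0 1))) (K_semidirect (@p_zero R p q)).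
Proof.
rewrite (point_of_cab false 0) p_zeroE.
exact: (@special_fiber_iso C p q false).
Qed.

Lemma special_infty_iso :
  group_iso (fiber_group total_space total_ops (phi (hcoord 1 0))) (K_semidirect (@p_infty R p q)).
Proof.
rewrite (point_of_cab true 0) p_inftyE.
exact: (@special_fiber_iso C p q true).
Qed.

Lemma contraction_iso :
  lie_sheaf_iso (aff C^o) base_space (@affine_point C p q)
    (contraction_family (@commutator R p q) (@theta R p q))
    (lie_of_family total_space base_space total_ops).
Proof.
apply: (@lie_family_iso C p q i0 j0); first exact: complex_infinite.
exact: contraction_bracket_twist.
Qed.

End Assembly.

Theorem mainTheorem3 (R : realType) (p q : nat) (hp : (1 <= p)%N) (hq : (1 <= q)%N) :
  (* (a) *)
  (forall mu nu mu' nu' : R[i], mu != 0 -> nu != 0 -> mu' != 0 -> nu' != 0 ->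
     Ad_g (zeta p q mu nu) = Ad_g (zeta p q mu' nu') <->
     mu ^+ 2 * nu ^- 2 = mu' ^+ 2 * nu' ^- 2) /\
  exists (phi : {vspace 'rV[R[i]]_2} -> {vspace ('M[R[i]]_(q + p) * 'M[R[i]]_(q + p))%type})
         (psi : {vspace ('M[R[i]]_(q + p) * 'M[R[i]]_(q + p))%type} -> {vspace 'rV[R[i]]_2}),
  [/\ [/\ space_iso (proj_space R[i] 1) (Xsp R p q) phi psi,
          forall mu nu : R[i], mu != 0 -> nu != 0 ->
            phi (hcoord (mu ^+ 2) (nu ^+ 2)) = Ad_g (zeta p q mu nu) &
          exists psi0, space_iso (subsp (aff R[i]^o) [set t | t != 0]) (X0sp R p q)
                                 (fun t : R[i] => phi (hcoord t 1)) psi0],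
      (* (b) *)
      [/\ is_group_family (bG R p q) (Xsp R p q) (const_ops R p q),
          dom (bG R p q) `<=` dom (const_family R p q) /\
            morphism (bG R p q) (const_family R p q) id,
          forall W, X0set W ->
            group_iso (fiber_group (bG R p q) (const_ops R p q) W) (GL_group R p q),
          group_iso (fiber_group (bG R p q) (const_ops R p q) (phi (hcoord 0 1)))
                    (K_semidirect (@p_zero R p q)) &
          group_iso (fiber_group (bG R p q) (const_ops R p q) (phi (hcoord 1 0)))
                    (K_semidirect (@p_infty R p q))],
      (* (c) *)
      lie_sheaf_iso (aff R[i]^o) (Xsp R p q) (fun z : R[i] => phi (hcoord z 1))
        (contraction_family (@commutator R p q) (@theta R p q))
        (lie_of_family (bG R p q) (Xsp R p q) (const_ops R p q)) &
      (* (d) *)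
      let sigmaX := fun W => phi (conj_proj (psi W)) in
      let sigmaE := fun y => (sigmaX y.1, sigmaH y.2) in
      let Gsigma := real_fiber_group (bG R p q) (const_ops R p q) sigmaE in
      [/\ real_structure (Hspace R p q) (@sigmaH R p q) /\
            real_structure (proj_space R[i] 1) (@conj_proj R),
          family_real_structure (bG R p q) (Xsp R p q) (const_ops R p q) sigmaX sigmaE,
          forall x : R, 0 < x ->
            group_iso (Gsigma (phi (hcoord x%:C 1))) (unitary_pq R p q),
          group_iso (Gsigma (phi (hcoord 0 1))) (motion_pq R p q) /\
            group_iso (Gsigma (phi (hcoord 1 0))) (motion_pq R p q) &
          forall x : R, x < 0 ->
            group_iso (Gsigma (phi (hcoord x%:C 1))) (unitary_group R (p + q))]].
Proof.
(* The hypotheses provide an off-diagonal entry, from which the coordinate of the base is read. *)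
pose i0 : 'I_q := Ordinal hq; pose j0 : 'I_p := Ordinal hp.
split; first exact: (Ad_g_zeta_eq i0 j0).
exists (@point_of_line _ p q), (@line_of_point _ p q i0 j0).
rewrite XspE (bGE R i0 j0).
have infC := @complex_infinite R.
(* The real fibers were computed at the points W_(cab e x); this restates them at the points of the
   projective line. Only the point at infinity needs the chart [true]. *)
have real_fiberE e (x : R) (H : gspace R _) :
    group_iso (GSpace (real_fiber_space i0 j0 e x) (@total_mul R[i] p q)) H ->
    group_iso (real_fiber_group (total_space R[i] p q) (const_ops R p q) (conj_total i0 j0)
      (point_of_line p q (hcoord (cab e (x%:C : R[i])).1 (cab e (x%:C : R[i])).2))) H.
  by rewrite point_of_cab.
split.
- split; first exact: base_iso.
    exact: point_of_Ad_g.
  exists (Tco i0 j0 false); rewrite point_of_affine /X0sp X0setE.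
  exact: affine_point_iso.
- split.
  + exact: (total_group_family i0 j0 infC).
  + rewrite /const_family XspE; exact: total_subfamily.
  + move=> W; rewrite X0setE; exact: generic_fiber_iso.
  + exact: special_zero_iso.
  + exact: special_infty_iso.
- rewrite point_of_affine; exact (@contraction_iso R p q i0 j0).
- split.
  + split; [exact: (H_real_structure R p q)|exact: conj_proj_real_structure].
  + exact: (total_real_structure R i0 j0).
  + by move=> x x0; exact (real_fiberE _ false x _ (real_pq_iso i0 j0 false x0)).
  + split; first exact (real_fiberE _ false 0 _ (@real_motion_iso R p q i0 j0 false)).
    exact (real_fiberE _ true 0 _ (@real_motion_iso R p q i0 j0 true)).
  + by move=> x x0; exact (real_fiberE _ false x _ (real_unitary_iso i0 j0 false x0)).
Qed.
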